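(* In the two-group factor model described in the context, fix $\mathbf w\in\mathbb R^k$ and assume that, conditionally on $\mathbf W=\mathbf w$, all of the following hold: (1) $\sup_{1\le i\le m<\infty}\|\mathbf L_{mi}\|_2^2<1$; (2) there exist an even integer $Q>2$ and $\gamma>0$ with $\frac{\gamma}{2+\gamma}+\frac2Q<1$ and $\sum_{d=1}^\infty d^{Q-2}\alpha(d)^{\gamma/(Q+\gamma)}<\infty$; (3) for all $t\in[0,1]$ and $r\in\{0,1\}$ the limit $F_r(t)=\lim_{m\to\infty}F_{m,r}(t)$ exists; (4) $\tau_*>0$, $\tau_*=\sup\{t\in(0,1):G(t)>t/q\}$, and $\tau_*$ is not an accumulation point of $\{t\in(0,1):G(t)=t/q\}$; (5) for all $s,t\in[a,b]$ and $r_0,r_1\in\{0,1\}$ the limits $\lim_{m}\frac{\pi_{r_0}^{(m)}\pi_{r_1}^{(m)}}{m}\sum_{i=1}^m\gamma_{mir_0}(t)\gamma_{mir_1}(s)$ and $\lim_{m}\frac{\pi_{r_0}^{(m)}\pi_{r_1}^{(m)}}{m}\sum_{i\ne j}\tilde\rho\big(\gamma_{mir_0}(t),\gamma_{mjr_1}(s),\Gamma^{(m)}_{ij}\big)$ both exist; (6) $F_0$ and $F_1$ are differentiable at $\tau_*$; (7) $\lim_{m\to\infty}\sup_{t\in[a,b]}\big|\sqrt m\,(F_{m,r}(t)-F_r(t))\big|=0$ for $r\in\{0,1\}$. Then, conditionally on $\mathbf W=\mathbf w$, $$\sqrt m\Big(\mathrm{FDP}_m-\frac{qF_0(\tau_*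 )}{\tau_*}\Big)\xrightarrow{d}\mathcal N(0,\sigma_L^2)\quad\text{as }m\to\infty,$$ where $$\sigma_L^2=\frac{q^2}{\tau_*^2}\Big((1+\alpha)^2c^{(0,0)}(\tau_*,\tau_* )+\alpha^2c^{(1,1)}(\tau_*,\tau_* )+2\alpha(1+\alpha)c^{(1,0)}(\tau_*,\tau_* )\Big),\qquad \alpha=\frac{F_0'(\tau_* )-F_0(\tau_* )/\tau_*}{1/q-G'(\tau_* )}.$$
   Context: Notation: $\Phi$ is the standard normal CDF, $\bar\Phi=1-\Phi$. Fix $q\in(0,1)$, $\mu_A>0$ and an integer $k\ge0$. Model. For each $m\ge1$: $\pi_1^{(m)}\in(0,1)$, $\pi_0^{(m)}=1-\pi_1^{(m)}$; $H_{m1},\dots,H_{mm}$ are i.i.d. Bernoulli$(\pi_1^{(m)})$ ($H_{mi}=1$ iff hypothesis $i$ is nonnull); $\mathbf L_{mi}\in\mathbb R^k$ ($1\le i\le m$) are deterministic; $(\varepsilon_{m1},\dots,\varepsilon_{mm})\sim\mathcal N(0,\Sigma^{(m)})$ with $\Sigma^{(m)}_{ii}>0$ and $\|\mathbf L_{mi}\|_2^2+\Sigma^{(m)}_{ii}=1$; $\mathbf W\sim\mathcal N(0,I_k)$ is a single latent factor not depending on $m$. The $H$'s, the $\varepsilon$'s and $\mathbf W$ are independent of each other. $\Gamma^{(m)}$ is the correlation matrix corresponding to $\Sigma^{(m)}$. The $p$-values are $P_{mi}=\bar\Phi(\mu_AH_{mi}+\mathbf L_{mi}^{\mathsf T}\mathbf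 W+\varepsilon_{mi})$. Benjamini-Hochberg (BH) at level $q$: with sorted $p$-values $P_{m(1)}\le\dots\le P_{m(m)}$ and $P_{m(0)}=0$, let $R_m=\max\{j\in\{0,\dots,m\}:P_{m(j)}\le jq/m\}$, $\tau_{\mathrm{BH},m}=P_{m(R_m)}$, $V_m=\sum_{i=1}^mI\{P_{mi}\le\tau_{\mathrm{BH},m},H_{mi}=0\}$, $\mathrm{FDP}_m=V_m/\max\{R_m,1\}$. Everything below is conditional on $\mathbf W=\mathbf w$ (i.e. with $\mathbf W$ replaced by the fixed vector $\mathbf w$). Mixing coefficients: $\xi_{mi}=(\varepsilon_{mi},H_{mi})$, $\mathcal A_1^n(m)=\sigma(\xi_{mi}:1\le i\le n)$, $\mathcal A_{n+d}^\infty(m)=\sigma(\xi_{mi}:n+d\le i\le m)$, and $\alpha(d)=\sup_{n,m}\sup\{|P(A_0\cap A_1)-P(A_0)P(A_1)|:A_0\in\mathcal A_1^n(m),A_1\in\mathcal A_{n+d}^\infty(m)\}$ (the function $\alpha(\cdot)$ is distinct from the constant $\alpha$ in the variance). Subdistributions: for $r\in\{0,1\}$, $t\in[0,1]$, $\gamma_{mir}(t)=\Pr(P_{mi}\le t\mid H_{mi}=r,\mathbf W=\mathbf w)=\bar\Phi\Big(\frac{\bar\Phi^{-1}(t)-\mu_Ar-\mathbf L_{mi}^{\mathsf T}\mathbf w}{\sqrt{1-\|\mathbf L_{mi}\|_2^2}}\Big)$, $F_{m,r}(t)=\frac{\pi_r^{(m)}}m\sum_{i=1}^m\gamma_{mir}(t)$,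 $F_r=\lim_mF_{m,r}$ (pointwise), $G=F_0+F_1$, $\hat F_{m,r}(t)=\frac1m\sum_{i=1}^mI\{H_{mi}=r\}I\{P_{mi}\le t\}$. Simes point: $\tau_*=\sup\{t\in(0,1):G(t)\ge t/q\}$, with $\sup\emptyset=0$. Interval $[a,b]$: a fixed interval with $a\in(0,q)$, $b\in(q,1)$, $G(a)>a/q$, and such that $\tau_*$ is the unique $t\in(a,b)$ with $G(t)=t/q$ (such an interval exists under hypotheses (1), (3), (4)). Covariances: for $t,s\in[0,1]$, $|\rho|\le1$, $\tilde\rho(t,s,\rho)=\Pr(Z_1\ge\bar\Phi^{-1}(t),Z_2\ge\bar\Phi^{-1}(s))-ts$ where $(Z_1,Z_2)$ is centered bivariate normal with unit variances and correlation $\rho$. $W_{m,r}(t)=\sqrt m(\hat F_{m,r}(t)-F_{m,r}(t))$, $c_m^{(r_0,r_1)}(t,s)=\mathrm{cov}(W_{m,r_0}(t),W_{m,r_1}(s))$ (conditionally on $\mathbf W=\mathbf w$), and $c^{(r_0,r_1)}(t,s)=\lim_{m\to\infty}c_m^{(r_0,r_1)}(t,s)$, which exists under hypotheses (3) and (5). $\mathcal N(0,0)$ denotes the point mass at $0$.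
   Formalization: The formal theorem additionally assumes 1/q − G'(τ_* ) ≠ 0, so that the constant α is defined; hypotheses (1)–(7) do not exclude G'(τ_* ) = 1/q, where α and σ_L² are undefined. *)

(* Defs.v *)
From HB Require Import structures.
From mathcomp Require Import all_boot all_order all_algebra.
From mathcomp Require Import all_classical all_reals all_analysis.

Set Implicit Arguments.
Unset Strict Implicit.
Unset Printing Implicit Defensive.

Import Order.TTheory GRing.Theory Num.Theory.
Import numFieldNormedType.Exports.

Local Open Scope classical_set_scope.
Local Open Scope ring_scope.

Section normal_laws.
Context {R : realType}.

Definition std_normal_cdf (x : R) : R := fine (normal_prob (0 : R) 1 `]-oo, x]).

Definition barPhi (x : R) : R := 1 - std_normal_cdf x.

(* The inverse of barPhi on [0, 1], extended by barPhi_inv 0 = +oo and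
   barPhi_inv 1 = -oo. *)
Definition barPhi_inv (t : R) : \bar R :=
  ereal_inf [set x%:E | x in [set x : R | barPhi x <= t]].

(* N(0, v). The library's normal_prob is parametrized by the standard deviation
   and is not the point mass when that is 0. *)
Definition centered_normal (v : R) : set R -> \bar R :=
  if v == 0 then dirac (0 : R) else normal_prob 0 (Num.sqrt v).

(* (Z_1, Z_2) is realized as (X, r X + sqrt (1 - r^2) Y), X and Y being
   independent standard normal variables. *)
Definition rho_tilde (t s r : R) : R :=
  fine ((normal_prob (0 : R) 1 \x normal_prob (0 : R) 1)%E
    [set z : R * R | (barPhi_inv t <= z.1%:E)%E /\
       (barPhi_inv s <= (r * z.1 + Num.sqrt (1 - r ^+ 2) * z.2)%:E)%E]) - t * s.

End normal_laws.

Section random_vectors.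
Context {d : measure_display} {T : measurableType d} {R : realType}.
Variable P : probability T R.

(* X ~ N(0, S), with S possibly singular: every linear combination of the
   coordinates of X is centered normal with the variance prescribed by S. *)
Definition gaussian_vector n (X : 'I_n -> T -> R) (S : 'M[R]_n) : Prop :=
  [/\ S^T = S,
      forall c : 'rV[R]_n, 0 <= (c *m S *m c^T) 0 0,
      forall i, measurable_fun setT (X i)
    & forall (c : 'rV[R]_n) (A : set R), measurable A ->
        P ((fun omega => \sum_(i < n) c 0 i * X i omega) @^-1` A) =
        centered_normal ((c *m S *m c^T) 0 0) A].

Definition iid_bernoulli n (H : 'I_n -> T -> bool) (p : R) : Prop :=
  [/\ forall i, measurable_fun setT (H i),
      forall i, P [set omega | H i omega = true] = p%:E
    & forall (J : {set 'I_n}) (A : 'I_n -> set bool),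
        fine (P (\bigcap_(i in [set i | i \in J]) H i @^-1` A i)) =
        \prod_(i in J) fine (P (H i @^-1` A i))].

(* The sigma-algebras contain setT, so the triple product rule entails the
   pairwise ones. *)
Definition independent3 (F1 F2 F3 : set (set T)) : Prop :=
  forall A B C, F1 A -> F2 B -> F3 C ->
    fine (P (A `&` B `&` C)) = fine (P A) * fine (P B) * fine (P C).

(* The laws of the X n converge weakly to the law mu: convergence of the
   distribution functions at the continuity points of that of mu. *)
Definition cvg_in_distribution (X : nat -> T -> R) (mu : set R -> \bar R) :
    Prop :=
  forall x : R, {for x, continuous (fun y : R => fine (mu `]-oo, y]%classic))} ->
    fine (P [set omega | X n omega <= x]) @[n --> \oo] -->
    fine (mu `]-oo, x]%classic).

End random_vectors.

Section benjamini_hochberg.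
Context {R : realType}.
Variables (q : R) (m : nat) (p : 'I_m -> R).

(* The j-th order statistic, with value 0 at j = 0. *)
Definition order_stat (j : nat) : R :=
  nth 0 (0 :: sort <=%R [seq p i | i <- enum 'I_m]) j.

Definition bh_rejections : nat :=
  \max_(j < m.+1 | order_stat j <= j%:R * q / m%:R) j.

Definition bh_threshold : R := order_stat bh_rejections.

(* h i = true iff hypothesis i is nonnull. *)
Definition bh_false_rejections (h : 'I_m -> bool) : nat :=
  #|[set i : 'I_m | (p i <= bh_threshold) && ~~ h i]|.

Definition bh_fdp (h : 'I_m -> bool) : R :=
  (bh_false_rejections h)%:R / (maxn bh_rejections 1)%:R.

End benjamini_hochberg.

Definition sqnorm2 {R : realType} k (u : 'rV[R]_k) : R :=
  \sum_(j < k) u 0 j ^+ 2.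

Definition dotprod {R : realType} k (u v : 'rV[R]_k) : R :=
  \sum_(j < k) u 0 j * v 0 j.

(* The hypotheses i = 1, ..., m are indexed by 'I_m, hence from 0. *)
Record factor_model (d : measure_display) (T : measurableType d) (R : realType)
    (P : probability T R) (k : nat) := FactorModel {
  muA : R;
  pi1 : nat -> R;
  H : forall m, 'I_m -> T -> bool;
  L : forall m, 'I_m -> 'rV[R]_k;
  Sigma : forall m, 'M[R]_m;
  eps : forall m, 'I_m -> T -> R;
  W : 'I_k -> T -> R;
  muA_gt0 : 0 < muA;
  pi1_range : forall m, (0 < m)%N -> 0 < pi1 m < 1;
  H_law : forall m, iid_bernoulli P (@H m) (pi1 m);
  eps_law : forall m, gaussian_vector P (@eps m) (Sigma m);
  W_law : gaussian_vector P W 1%:M;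
  Sigma_diag_gt0 : forall m (i : 'I_m), 0 < Sigma m i i;
  unit_variance : forall m (i : 'I_m), sqnorm2 (L i) + Sigma m i i = 1;
  H_eps_W_independent : forall m,
    independent3 P (g_sigma_preimage (@H m)) (g_sigma_preimage (@eps m))
      (g_sigma_preimage W)
}.

Section factor_model_theory.
Context {d : measure_display} {T : measurableType d} {R : realType}.
Context {P : probability T R} {k : nat}.
Variable M : factor_model P k.

Definition pi_ (m : nat) (r : bool) : R := if r then pi1 M m else 1 - pi1 M m.

(* The correlation matrix Gamma^(m) of eps. *)
Definition noise_corr m (i j : 'I_m) : R :=
  Sigma M m i j / Num.sqrt (Sigma M m i i * Sigma M m j j).

Definition xi m (i : 'I_m) (omega : T) : R * bool :=
  (eps M i omega, H M i omega).

Definition sigma_xi m (I : set 'I_m) : set (set T) :=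
  <<s \bigcup_(i in I) preimage_set_system setT (xi i) measurable >>.

(* The strong mixing coefficient alpha(e); the paper's index of i : 'I_m is
   i.+1. *)
Definition mixing_coef (e : nat) : R :=
  sup [set x : R | exists n m : nat, [/\ (0 < n)%N, (0 < m)%N &
    exists A0 A1 : set T,
      [/\ sigma_xi [set i : 'I_m | (i.+1 <= n)%N] A0,
          sigma_xi [set i : 'I_m | (n + e <= i.+1)%N] A1
        & x = `|fine (P (A0 `&` A1)) - fine (P A0) * fine (P A1)|]]].

(* P_mi with the latent factor W replaced by the vector v; the unconditional
   p-value is the case v = \row_j W M j omega. *)
Definition pvalue m (i : 'I_m) (v : 'rV[R]_k) (omega : T) : R :=
  barPhi (muA M * (H M i omega)%:R + dotprod (L M i) v + eps M i omega).

(* From here on everything is conditional on W = w. Since W is independent of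
   (H, eps), this amounts to replacing W by w and keeping P. *)
Variable w : 'rV[R]_k.

(* Pr(P_mi <= t | H_mi = r, W = w) *)
Definition gamma_ m (i : 'I_m) (r : bool) (t : R) : R :=
  fine (P [set omega | pvalue i w omega <= t /\ H M i omega = r]) /
  fine (P [set omega | H M i omega = r]).

Definition Fm (m : nat) (r : bool) (t : R) : R :=
  pi_ m r / m%:R * \sum_(i < m) gamma_ i r t.

Definition F (r : bool) (t : R) : R := limn (fun m => Fm m r t).

Definition G (t : R) : R := F false t + F true t.

Definition Fhat (m : nat) (r : bool) (t : R) (omega : T) : R :=
  m%:R^-1 *
  \sum_(i < m) (H M i omega == r)%:R * (pvalue i w omega <= t)%R%:R.

Definition Wproc (m : nat) (r : bool) (t : R) (omega : T) : R :=
  Num.sqrt m%:R * (Fhat m r t omega - Fm m r t).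

Definition cov_m (m : nat) (r0 r1 : bool) (t s : R) : R :=
  fine (covariance P (Wproc m r0 t) (Wproc m r1 s)).

Definition cov_lim (r0 r1 : bool) (t s : R) : R :=
  limn (fun m => cov_m m r0 r1 t s).

Variable q : R.

(* sup set0 = 0 in the library. *)
Definition simes_point : R := sup [set t : R | 0 < t < 1 /\ t / q <= G t].

Definition is_simes_interval (a b : R) : Prop :=
  [/\ 0 < a < q, q < b < 1, a / q < G a,
      a < simes_point < b /\ G simes_point = simes_point / q
    & forall t, a < t < b -> G t = t / q -> t = simes_point].

Definition FDP (m : nat) (omega : T) : R :=
  bh_fdp q (fun i : 'I_m => pvalue i w omega) (fun i => H M i omega).

Definition alpha_const : R :=
  let tau := simes_point in
  (derive1 (F false) tau - F false tau / tau) / (q^-1 - derive1 G tau).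

Definition sigmaL2 : R :=
  let tau := simes_point in
  let al := alpha_const in
  q ^+ 2 / tau ^+ 2 *
  ((1 + al) ^+ 2 * cov_lim false false tau tau
   + al ^+ 2 * cov_lim true true tau tau
   + 2 * al * (1 + al) * cov_lim true false tau tau).

End factor_model_theory.

(* Main.v *)
(* Conditionally on W = w, let W_r(t) = sqrt m (Fhat_r(t) - F_{m,r}(t)), and replace
   the BH threshold by tauhat = q R_m / m: the same hypotheses are rejected, tauhat
   solves Ghat(tauhat) = tauhat / q exactly and FDP_m = q Fhat_0(tauhat) / tauhat.

   The summability hypothesis forces alpha(d) = O(d^-4), and this is all that is used
   of it. With a covariance inequality it gives E (W_r(t) - W_r(s))^2 <=
   C ((F_{m,r}(t) - F_{m,r}(s)) / eta + eta) for every eta > 0, whence by Chebyshev at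
   finitely many points and by monotonicity of Fhat_r and F_{m,r}:
   - sqrt m (tauhat - tau) is tight, because G crosses the line t / q transversally
     at tau and stays below it on the right of tau;
   - W_r oscillates negligibly at distance O(1 / sqrt m) of tau.
   Linearizing Ghat(tauhat) = tauhat / q and FDP_m at tau then shows that
   sqrt m (FDP_m - q F_0(tau) / tau) is, up to o_P(1), the linear combination
   (q / tau) ((1 + alpha) W_0(tau) + alpha W_1(tau)).

   This combination is asymptotically normal by a recursion on partial sums S_j of a
   mixing array: E cos(t S_{j+1} + c) is E cos(t S_j + c) times
   1 - t^2 E(X_j^2 + 2 X_j (S_j - S_{j-s})) / 2 up to summable errors, the gap s growing
   like m^(1/6). Its variance is computed from the bivariate normal law of the noises.
   Convergence of the transforms E cos(t Z + c) is turned into convergence of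
   distribution functions by explicit trigonometric approximations of a step. *)
Require Import Defs.
From HB Require Import structures.
From mathcomp Require Import all_boot all_order all_algebra.
From mathcomp Require Import all_classical all_reals all_analysis.
From mathcomp Require Import measurable_realfun.
From mathcomp Require Import ring lra.

Set Implicit Arguments.
Unset Strict Implicit.
Unset Printing Implicit Defensive.

Import Order.TTheory GRing.Theory Num.Theory.
Import numFieldNormedType.Exports.

Local Open Scope classical_set_scope.
Local Open Scope ring_scope.

(** * Expectations of bounded functions *)

(** The rate [d ^ -4] serves two separate steps. In the recursion the summands are O(1 / sqrt m);
    with gap [s] the Taylor remainders add up to O(s ^ 2 / sqrt m) and the decoupling errors to
    O(sqrt m * alpha(s)), up to smaller terms. Taking sqrt m of order s ^ 3 makes both O(1 / s) when
    alpha(s) = O(s ^ -4). In the increment bound, the covariance of two indicators at distance d is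
    at most 4 alpha(d) and also at most the probability p of one of them, hence at most 2 sqrt
    (alpha(d) p), and sqrt alpha(d) = O(d ^ -2) is summable. The price is sqrt p in place of p,
    which sqrt p <= p / eta + eta turns into a bound linear in p. Such a bound is enough because
    only single points are compared by Chebyshev, and monotonicity fills the gaps between them.
    Cosines with an arbitrary phase replace complex characteristic functions: a phase of - pi / 2
    gives the sine, products of cosines are again sums of cosines, and everything stays real and
    bounded. The limit law may be a point mass, so distribution functions are compared with a margin
    in the argument, and continuity at the point enters only at the end. *)

Section bounded_expectation.
Context {d : measure_display} {T : measurableType d} {R : realType}.
Variable P : probability T R.
Implicit Types (f g : T -> R) (A B : set T).

(** No measure enters, so the same predicate expresses measurability for a sub-sigma-algebra once
    the domain is read as a [g_sigma_algebraType]. Boundedness makes every expectation finite under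
    any probability. *)
Definition bmf f := measurable_fun setT f /\ exists M : R, forall x, `|f x| <= M.

Definition Ex f : R := \int[P]_x f x.

Lemma bmf_meas f : bmf f -> measurable_fun setT f. Proof. by case. Qed.

Lemma bmfP f (C : R) : measurable_fun setT f -> (forall x, `|f x| <= C) -> bmf f.
Proof. by move=> mf fC; split => //; exists C. Qed.

Lemma bmf_cst (c : R) : bmf (fun _ => c).
Proof. by apply: (@bmfP _ `|c|). Qed.

Lemma bmfD f g : bmf f -> bmf g -> bmf (fun x => f x + g x).
Proof.
move=> [mf [M fM]] [mg [N gN]]; apply: (@bmfP _ (M + N)).
  exact: measurable_funD.
by move=> x; rewrite (le_trans (ler_normD _ _))// lerD.
Qed.

Lemma bmfM f g : bmf f -> bmf g -> bmf (fun x => f x * g x).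
Proof.
move=> [mf [M fM]] [mg [N gN]]; apply: (@bmfP _ (M * N)).
  exact: measurable_funM.
by move=> x; rewrite normrM ler_pM.
Qed.

Lemma bmfZ (c : R) f : bmf f -> bmf (fun x => c * f x).
Proof. by apply: bmfM; exact: bmf_cst. Qed.

Lemma bmfN f : bmf f -> bmf (fun x => - f x).
Proof.
move=> [mf [M fM]]; apply: (@bmfP _ M); last by move=> x; rewrite normrN.
exact: measurableT_comp.
Qed.

Lemma bmfB f g : bmf f -> bmf g -> bmf (fun x => f x - g x).
Proof. by move=> bf bg; apply: bmfD => //; exact: bmfN. Qed.

Lemma bmfX n f : bmf f -> bmf (fun x => f x ^+ n).
Proof.
move=> bf; elim: n => [|n IHn]; first exact: bmf_cst.
under [X in bmf X]eq_fun do rewrite exprS.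
exact: bmfM.
Qed.

Lemma bmf_sum (I : Type) (r : seq I) (p : pred I) (F : I -> T -> R) :
  (forall i, bmf (F i)) -> bmf (fun x => \sum_(i <- r | p i) F i x).
Proof.
move=> bF; elim: r => [|i r IHr].
  under [X in bmf X]eq_fun do rewrite big_nil.
  exact: bmf_cst.
under [X in bmf X]eq_fun do rewrite big_cons.
by case: (p i) => //; exact: bmfD.
Qed.

Lemma bmf_cos f : measurable_fun setT f -> bmf (fun x => cos (f x)).
Proof.
move=> mf; apply: (@bmfP _ 1); last first.
  by move=> x; rewrite ler_norml cos_geN1 cos_le1.
apply: measurableT_comp mf; apply: continuous_measurable_fun.
exact: continuous_cos.
Qed.

Lemma bmf_sin f : measurable_fun setT f -> bmf (fun x => sin (f x)).
Proof.
move=> mf; apply: (@bmfP _ 1); last first.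
  by move=> x; rewrite ler_norml sin_geN1 sin_le1.
apply: measurableT_comp mf; apply: continuous_measurable_fun.
exact: continuous_sin.
Qed.

Lemma bmf_indic A : measurable A -> bmf (\1_A).
Proof.
move=> mA; apply: (@bmfP _ 1); first exact: measurable_indic.
by move=> x; rewrite indicE; case: (_ \in _); rewrite /= ?normr1 ?normr0.
Qed.

Lemma bmf_integrable f : bmf f -> P.-integrable setT (EFin \o f).
Proof.
move=> [mf [M fM]]; apply: measurable_bounded_integrable => //.
  by have := probability_setT P; rewrite /= => ->; rewrite ltry.
exists M; split; first exact: num_real.
by move=> y My x _ /=; rewrite (le_trans (fM x))// ltW.
Qed.

Lemma eq_Ex f g : f =1 g -> Ex f = Ex g.
Proof. by move=> fg; apply: eq_Rintegral => x _; rewrite fg. Qed.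

Lemma ExD f g : bmf f -> bmf g -> Ex (fun x => f x + g x) = Ex f + Ex g.
Proof. by move=> bf bg; rewrite /Ex RintegralD//; exact: bmf_integrable. Qed.

Lemma ExB f g : bmf f -> bmf g -> Ex (fun x => f x - g x) = Ex f - Ex g.
Proof. by move=> bf bg; rewrite /Ex RintegralB//; exact: bmf_integrable. Qed.

Lemma ExZ (c : R) f : bmf f -> Ex (fun x => c * f x) = c * Ex f.
Proof. by move=> bf; rewrite /Ex RintegralZl//; exact: bmf_integrable. Qed.

Lemma Ex_cst (c : R) : Ex (fun _ => c) = c.
Proof.
rewrite /Ex Rintegral_cst//; have := probability_setT P; rewrite /= => ->.
by rewrite mulr1.
Qed.

Lemma Ex_sum (I : Type) (r : seq I) (p : pred I) (F : I -> T -> R) :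
  (forall i, bmf (F i)) ->
  Ex (fun x => \sum_(i <- r | p i) F i x) = \sum_(i <- r | p i) Ex (F i).
Proof.
move=> bF; elim: r => [|i r IHr].
  by under eq_Ex do rewrite big_nil; rewrite Ex_cst big_nil.
rewrite big_cons; under eq_Ex do rewrite big_cons.
by case: (p i); rewrite // ExD ?IHr//; exact: bmf_sum.
Qed.

Lemma Ex_le f g : bmf f -> bmf g -> (forall x, f x <= g x) -> Ex f <= Ex g.
Proof.
by move=> bf bg fg; apply: le_Rintegral => //; exact: bmf_integrable.
Qed.

Lemma Ex_ge0 f : (forall x, 0 <= f x) -> 0 <= Ex f.
Proof. by move=> f0; apply: Rintegral_ge0 => x _; exact: f0. Qed.

Lemma Ex_bound (C : R) f : bmf f -> (forall x, `|f x| <= C) -> `|Ex f| <= C.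
Proof.
move=> bf fC; rewrite ler_norml -{1}(Ex_cst (- C)) -{2}(Ex_cst C); apply/andP.
split; apply: Ex_le => //; do ?exact: bmf_cst => //.
  by move=> x; have := fC x; rewrite ler_norml => /andP[].
by move=> x; have := fC x; rewrite ler_norml => /andP[].
Qed.

Lemma Ex_dist (C : R) f g : bmf f -> bmf g ->
  (forall x, `|f x - g x| <= C) -> `|Ex f - Ex g| <= C.
Proof.
by move=> bf bg fg; rewrite -ExB//; apply: Ex_bound => //; exact: bmfB.
Qed.

Lemma Ex_indic A : measurable A -> Ex (\1_A) = fine (P A).
Proof. by move=> mA; rewrite /Ex /Rintegral integral_indic// setIT. Qed.

Lemma fineP_ge0 A : 0 <= fine (P A).
Proof. exact: fine_ge0. Qed.

Lemma fineP_le1 A : measurable A -> fine (P A) <= 1.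
Proof.
move=> mA; rewrite -lee_fin fineK ?probability_le1//.
exact: fin_num_measure.
Qed.

Lemma fineP_le A B : measurable A -> measurable B -> A `<=` B ->
  fine (P A) <= fine (P B).
Proof.
move=> mA mB AB; apply: fine_le; rewrite ?fin_num_measure//.
by apply: le_measure => //; rewrite inE.
Qed.

Lemma fineP_setU A B : measurable A -> measurable B ->
  fine (P (A `|` B)) <= fine (P A) + fine (P B).
Proof.
move=> mA mB; rewrite -fineD ?fin_num_measure//; apply: fine_le.
- by rewrite fin_num_measure//; exact: measurableU.
- by rewrite fin_numD !fin_num_measure.
- exact: measureU2.
Qed.

Lemma fineP_setC A : measurable A -> fine (P (~` A)) = 1 - fine (P A).
Proof.
move=> mA; rewrite probability_setC// fineB ?fin_num_measure//.
Qed.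

Lemma fineP_bigU n (A : nat -> set T) : (forall i, measurable (A i)) ->
  fine (P (\big[setU/set0]_(i < n) A i)) <= \sum_(i < n) fine (P (A i)).
Proof.
move=> mA; elim: n => [|n IHn]; first by rewrite !big_ord0 measure0.
rewrite !big_ord_recr/=; apply: le_trans (fineP_setU _ _) _ => //.
  exact: bigsetU_measurable.
by rewrite lerD2r.
Qed.

Lemma chebyshev2 f (c : R) : bmf f -> 0 < c ->
  fine (P [set x | c <= `|f x|]) <= Ex (fun x => f x ^+ 2) / c ^+ 2.
Proof.
move=> bf c0; have mA : measurable [set x | c <= `|f x|].
  rewrite -[X in measurable X]setTI.
  apply: (@measurable_fun_le _ _ _ setT (cst c) (fun x => `|f x|)) => //.
  by apply: measurableT_comp => //; exact: bmf_meas.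
rewrite -Ex_indic// ler_pdivlMr ?exprn_gt0// mulrC -ExZ; last exact: bmf_indic.
apply: Ex_le; [exact/bmfZ/bmf_indic|exact: bmfX|].
move=> x; rewrite indicE; case: (boolP (x \in _)) => [|_]; last first.
  by rewrite mulr0 sqr_ge0.
rewrite inE/= mulr1 => cf; rewrite -[leRHS]real_normK ?num_real//.
by rewrite lerXn2r ?nnegrE// ltW.
Qed.

End bounded_expectation.

(** * The normal law and its cosine transform *)

Section gaussian_integrals.
Context {R : realType}.
Local Notation mu := (@lebesgue_measure R).

(** The change of variables is stated with a Radon-Nikodym derivative, known only up to null sets.
    It agrees almost everywhere with [normal_pdf] because both have the same integral over every
    measurable set. *)
Lemma integral_normal_prob (m s : R) (f : R -> R) :
  bmf f ->
  \int[normal_prob m s]_x f x = \int[mu]_x (f x * normal_pdf m s x).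
Proof.
move=> bf; congr fine.
have mf := bmf_meas bf.
have inf := bmf_integrable (normal_prob m s) bf.
rewrite -(Radon_Nikodym_change_of_variables (normal_prob_dominates m s))//=.
apply: ae_eq_integral => //.
- apply: emeasurable_funM => //; first exact/measurable_EFinP.
  apply: (measurable_int mu).
  apply: (integrableS _ _ (@subsetT _ _)) => //=.
  by apply: Radon_Nikodym_integrable; exact: normal_prob_dominates.
- apply/measurable_EFinP/measurable_funM => //.
  exact: measurable_normal_pdf.
- under [X in ae_eq _ _ _ X]eq_fun do rewrite EFinM.
  apply: ae_eqe_mul2l => /=.
  rewrite Radon_NikodymE//=; first exact: normal_prob_dominates.
  move=> abmu.
  case: cid => /= h [h1 h2 h3].
  apply: integral_ae_eq => //=.
  + by apply/measurable_EFinP; exact: measurable_normal_pdf.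
  + by move=> E _ mE; rewrite -h3.
Qed.

Lemma cvg_integral_symitv (f : R -> R) :
  mu.-integrable setT (EFin \o f) ->
  \int[mu]_(x in `[- n%:R, n%:R]) f x @[n --> \oo] --> \int[mu]_x f x.
Proof.
move=> intf.
have mf : measurable_fun setT f.
  by apply/measurable_EFinP; exact: measurable_int intf.
pose A (n : nat) : set R := `[- n%:R, n%:R]%classic.
have mA n : measurable (A n) by exact: measurable_itv.
have [] := @dominated_convergence _ _ _ mu setT measurableT
  (fun n x => (f x * \1_(A n) x)%:E) (EFin \o f) (fun x => `|f x|%:E).
- move=> n; apply/measurable_EFinP; apply: measurable_funM => //.
  exact: bmf_meas (bmf_indic (mA n)).
- exact/measurable_EFinP.
- apply: aeW => x _ /=; apply: cvg_near_cst.
  near=> n; rewrite indicE mem_set ?mulr1//= /A/= in_itv/= -ler_norml.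
  by near: n; exact: nbhs_infty_ger.
- by have := integrable_abse intf.
- apply: aeW => x n _ /=; rewrite lee_fin normrM -[leRHS]mulr1 ler_wpM2l//.
  by rewrite indicE; case: (_ \in _); rewrite /= ?normr1 ?normr0.
move=> _ _ h.
rewrite /Rintegral; apply: fine_cvg; rewrite fineK//; last first.
  exact: integrable_fin_num.
rewrite (_ : (fun n => _) = fun n => \int[mu]_x (f x * \1_(A n) x)%:E)%E//.
apply/funext => n; rewrite integral_mkcond/=; apply: eq_integral => x _.
by rewrite patchE indicE /A; case: ifPn => _; rewrite ?mulr1 ?mulr0.
Unshelve. all: by end_near. Qed.

(** The fundamental theorem of calculus on [-n, n], whose boundary terms vanish in the limit. *)
Lemma Rintegral_derive_eq0 (F f : R -> R) :
  (forall x, is_derive (x : R) 1 F (f x)) -> continuous f ->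
  mu.-integrable setT (EFin \o f) ->
  F n%:R @[n --> \oo] --> 0 -> F (- n%:R) @[n --> \oo] --> 0 ->
  \int[mu]_x f x = 0.
Proof.
move=> dF cf intf F1 F2.
have cF : continuous F.
  move=> x; apply: differentiable_continuous; apply/derivable1_diffP.
  by case: (dF x).
rewrite -(cvg_lim _ (cvg_integral_symitv intf))//; apply: cvg_lim => //.
apply: (@cvg_trans _ (F n%:R - F (- n%:R) @[n --> \oo])); last first.
  by have := cvgB F1 F2; rewrite subr0; exact.
apply: near_eq_cvg; near=> n.
rewrite /Rintegral (@continuous_FTC2 _ f F)//.
- have n0 : (0 < n)%N by near: n; exact: nbhs_infty_gt.
  by rewrite gtrN// ltr0n.
- exact: continuous_subspaceT.
- split; first by move=> x _; case: (dF x).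
    exact/cvg_at_right_filter/cF.
  exact/cvg_at_left_filter/cF.
- by move=> x _; rewrite derive1E; case: (dF x).
Unshelve. all: by end_near. Qed.

Lemma normal_pdf0E (s x : R) : s != 0 ->
  normal_pdf 0 s x = normal_peak s * expR (- x ^+ 2 / (s ^+ 2 *+ 2)).
Proof. by move=> s0; rewrite normal_pdfE//= /normal_fun subr0. Qed.

Lemma is_derive_normal_pdf (s x : R) : s != 0 ->
  is_derive x 1 (normal_pdf 0 s) (- (x / s ^+ 2) * normal_pdf 0 s x).
Proof.
move=> s0.
have -> : normal_pdf 0 s =
    (fun x => normal_peak s * expR (- (s ^+ 2 *+ 2)^-1 * (x * x))).
  apply/funext => y; rewrite normal_pdf0E//; congr (_ * expR _).
  by rewrite expr2; ring.
apply: is_derive_eq.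
rewrite /GRing.scale/= !mulr1.
have s2 : s ^+ 2 != 0 by rewrite expf_neq0.
rewrite mulr2n; field.
by rewrite s0 -mulr2n mulrn_eq0/= s2.
Qed.

(** Doubling the variance frees a factor exp(-y) with y = x ^ 2 / (4 s ^ 2), and |x| exp(-y) is
    bounded by (1 + 4 s ^ 2) / 2. So [C] times the density of standard deviation s sqrt 2
    dominates. *)
Lemma normal_abs_integrable (s : R) : 0 < s ->
  mu.-integrable setT (fun x : R => (x * normal_pdf 0 s x)%:E).
Proof.
move=> s0; have sN0 : s != 0 by rewrite gt_eqF.
pose s' := s * Num.sqrt 2.
have s'N0 : s' != 0 by rewrite mulf_neq0// gt_eqF// sqrtr_gt0.
have s'2 : s' ^+ 2 = 2 * s ^+ 2 by rewrite exprMn sqr_sqrtr// mulrC.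
pose C := (1 + 4 * s ^+ 2) / 2 * normal_peak s / normal_peak s'.
have pk' : 0 < normal_peak s' by exact: normal_peak_gt0.
have C0 : 0 <= C.
  have pk : 0 < normal_peak s by exact: normal_peak_gt0.
  have s2 := sqr_ge0 s.
  rewrite /C; apply: divr_ge0; last exact: ltW.
  apply: mulr_ge0; last exact: ltW.
  lra.
apply: (@le_integrable _ _ _ mu setT measurableT _
  (fun x => (C * normal_pdf 0 s' x)%:E)) => //.
- apply/measurable_EFinP; apply: measurable_funM => //.
  exact: measurable_normal_pdf.
- move=> x _ /=; rewrite lee_fin [leRHS]ger0_norm; last first.
    by rewrite mulr_ge0// normal_pdf_ge0.
  rewrite normrM (ger0_norm (normal_pdf_ge0 _ _ _)) !normal_pdf0E// s'2.
  set y := x ^+ 2 / (4 * s ^+ 2).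
  have -> : - x ^+ 2 / (2 * s ^+ 2 *+ 2) = - y.
    by rewrite /y mulrnAl -[in RHS]mulNr; congr (_ / _); ring.
  have -> : - x ^+ 2 / (s ^+ 2 *+ 2) = - y + - y.
    rewrite /y; field; rewrite ?sN0//.
  rewrite expRD.
  have -> : C * (normal_peak s' * expR (- y)) =
      normal_peak s * expR (- y) * ((1 + 4 * s ^+ 2) / 2).
    by rewrite /C; field; rewrite gt_eqF.
  rewrite [leLHS](_ : _ = normal_peak s * expR (- y) * (`|x| * expR (- y)));
    last by ring.
  rewrite ler_wpM2l ?mulr_ge0 ?expR_ge0 ?normal_peak_ge0//.
  have y0 : 0 <= y by rewrite divr_ge0 ?sqr_ge0// mulr_ge0 ?sqr_ge0.
  rewrite expRN ler_pdivrMr ?expR_gt0//.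
  have xy : x ^+ 2 = 4 * s ^+ 2 * y.
    by rewrite /y; field; rewrite sN0.
  have h1 : `|x| <= (1 + x ^+ 2) / 2.
    rewrite -[x ^+ 2]real_normK ?num_real//.
    by have := sqr_ge0 (`|x| - 1); rewrite sqrrB1; lra.
  apply: (le_trans h1); rewrite xy.
  have e1 := expR_ge1Dx y.
  have s2 : 0 <= s ^+ 2 by exact: sqr_ge0.
  nra.
- under eq_fun do rewrite EFinM; apply: integrableZl => //.
  exact: integrable_normal_pdf.
Qed.

Lemma Rintegral_bmf_pdf (s : R) (f : R -> R) : bmf f ->
  mu.-integrable setT (fun x : R => (f x * normal_pdf 0 s x)%:E).
Proof.
move=> [mf [M fM]].
have [M0|M0] := ltP M 0.
  by have := le_lt_trans (fM 0) M0; rewrite normr_lt0.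
apply: (@le_integrable _ _ _ mu setT measurableT _
  (fun x => (M * normal_pdf 0 s x)%:E)) => //.
- apply/measurable_EFinP; apply: measurable_funM => //.
  exact: measurable_normal_pdf.
- move=> x _ /=; rewrite lee_fin !normrM (ger0_norm M0) ler_wpM2r//.
- under eq_fun do rewrite EFinM; apply: integrableZl => //.
  exact: integrable_normal_pdf.
Qed.

Lemma normal_abs_bmf_integrable (s : R) (f : R -> R) : 0 < s -> bmf f ->
  mu.-integrable setT (fun x : R => (x * f x * normal_pdf 0 s x)%:E).
Proof.
move=> s0 [mf [M fM]].
have [M0|M0] := ltP M 0.
  by have := le_lt_trans (fM 0) M0; rewrite normr_lt0.
apply: (@le_integrable _ _ _ mu setT measurableT _
  (fun x => (M * (x * normal_pdf 0 s x))%:E)) => //.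
- apply/measurable_EFinP; apply: measurable_funM => //.
    exact: measurable_funM.
  exact: measurable_normal_pdf.
- move=> x _ /=; rewrite lee_fin !normrM (ger0_norm M0).
  by rewrite mulrA (mulrC M) ler_wpM2r// ler_wpM2l.
- under eq_fun do rewrite EFinM; apply: integrableZl => //.
  exact: normal_abs_integrable.
Qed.

Lemma cvg_normal_pdf_pm (s : R) (u : R^nat) : s != 0 ->
  (forall n, u n ^+ 2 = n%:R ^+ 2) ->
  normal_pdf 0 s (u n) @[n --> \oo] --> 0.
Proof.
move=> s0 un.
pose k := (s ^+ 2 *+ 2)^-1.
have k0 : 0 < k by rewrite invr_gt0 pmulrn_lgt0// exprn_even_gt0.
have pk : 0 < normal_peak s by exact: normal_peak_gt0.
apply: (@squeeze_cvgr _ _ _ _ (fun=> 0)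
    (fun n => normal_peak s / k * (n%:R)^-1)).
- near=> n; rewrite normal_pdf0E// mulr_ge0 ?expR_ge0 ?(ltW pk)//=.
  have n0 : 0 < n%:R :> R by rewrite ltr0n; near: n; exact: nbhs_infty_gt.
  rewrite -mulrA ler_wpM2l ?(ltW pk)//.
  rewrite un mulNr -/k expRN -invfM.
  rewrite lef_pV2 ?posrE ?expR_gt0 ?mulr_gt0//.
  rewrite (le_trans _ (expR_ge1Dx _))//.
  apply: (@le_trans _ _ (n%:R ^+ 2 * k)).
    rewrite mulrC ler_wpM2r ?(ltW k0)// expr2 ler_peMl ?(ltW n0)//.
    by rewrite ler1n; near: n; exact: nbhs_infty_gt.
  by rewrite lerDr.
- exact: cvg_cst.
- rewrite -[X in _ --> X](mulr0 (normal_peak s / k)); apply: cvgMr.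
  apply/gtr0_cvgV0; last exact: cvgr_idn.
  by near=> n; rewrite ltr0n; near: n; exact: nbhs_infty_gt.
Unshelve. all: by end_near. Qed.

(** Stein's identity E (X g(X)) = s ^ 2 E g'(X) for g(x) = sin (t x + c): the derivative of g times
    the density integrates to 0. *)
Lemma normal_ibp (s t c : R) : 0 < s ->
  \int[mu]_x (x * sin (t * x + c) * normal_pdf 0 s x) =
  s ^+ 2 * t * \int[mu]_x (cos (t * x + c) * normal_pdf 0 s x).
Proof.
move=> s0; have sN0 : s != 0 by rewrite gt_eqF.
have ml : measurable_fun setT (fun x : R => t * x + c).
  by apply: measurable_funD => //; exact: measurable_funM.
have bs : bmf (fun x : R => sin (t * x + c)) by exact: bmf_sin.
have bc : bmf (fun x : R => cos (t * x + c)) by exact: bmf_cos.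
pose F (x : R) := sin (t * x + c) * normal_pdf 0 s x.
pose f x := t * (cos (t * x + c) * normal_pdf 0 s x) -
  s ^- 2 * (x * sin (t * x + c) * normal_pdf 0 s x).
have i1 : mu.-integrable setT
    (EFin \o fun x => t * (cos (t * x + c) * normal_pdf 0 s x)).
  rewrite /comp; under eq_fun do rewrite EFinM; apply: integrableZl => //.
  exact: Rintegral_bmf_pdf.
have i2 : mu.-integrable setT
    (EFin \o fun x => s ^- 2 * (x * sin (t * x + c) * normal_pdf 0 s x)).
  rewrite /comp; under eq_fun do rewrite EFinM; apply: integrableZl => //.
  exact: normal_abs_bmf_integrable.
have : \int[mu]_x f x = 0.
  apply: (@Rintegral_derive_eq0 F).
  - move=> x; have dn := is_derive_normal_pdf x sN0.
    apply: is_derive_eq.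
    rewrite /f /GRing.scale/= !mulr1 addr0; ring.
  - have cp := @continuous_normal_pdf R 0 s sN0.
    have cl : continuous (fun x : R => t * x + c).
      by move=> x; apply: cvgD; [apply: cvgMr; exact: cvg_id|exact: cvg_cst].
    have cs : continuous (fun x : R => sin (t * x + c)).
      by move=> x; apply: continuous_comp; [exact: cl|exact: continuous_sin].
    have cc : continuous (fun x : R => cos (t * x + c)).
      by move=> x; apply: continuous_comp; [exact: cl|exact: continuous_cos].
    move=> x; apply: cvgB; apply: cvgMr; apply: cvgM; try exact: cp.
      exact: cc.
    by apply: cvgM; [exact: cvg_id|exact: cs].
  - rewrite /f; under [X in _.-integrable _ X]eq_fun do rewrite /= EFinB.
    exact: integrableB.
  - apply: (@squeeze_cvgr _ _ _ _ (fun n => - normal_pdf 0 s n%:R)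
      (fun n => normal_pdf 0 s n%:R)).
    + near=> n; rewrite -ler_norml /F normrM (ger0_norm (normal_pdf_ge0 _ _ _)).
      by rewrite ler_piMl ?normal_pdf_ge0// sin_max.
    + by rewrite -[X in _ --> X]oppr0; apply: cvgN; exact: cvg_normal_pdf_pm.
    + exact: cvg_normal_pdf_pm.
  - apply: (@squeeze_cvgr _ _ _ _ (fun n => - normal_pdf 0 s (- n%:R))
      (fun n => normal_pdf 0 s (- n%:R))).
    + near=> n; rewrite -ler_norml /F normrM (ger0_norm (normal_pdf_ge0 _ _ _)).
      by rewrite ler_piMl ?normal_pdf_ge0// sin_max.
    + rewrite -[X in _ --> X]oppr0; apply: cvgN; apply: cvg_normal_pdf_pm => // n.
      by rewrite sqrrN.
    + by apply: cvg_normal_pdf_pm => // n; rewrite sqrrN.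
rewrite /f RintegralB// RintegralZl//; last exact: Rintegral_bmf_pdf.
rewrite RintegralZl//; last exact: normal_abs_bmf_integrable.
move/eqP; rewrite subr_eq0 => /eqP h.
have s2 : s ^+ 2 != 0 by rewrite expf_neq0.
by rewrite -mulrA h mulrA divff// mul1r.
Unshelve. all: by end_near. Qed.

(** Differentiation under the integral, dominated by |x| times the density, followed by
    [normal_ibp]. The outcome is the differential equation phi' = - s ^ 2 t phi. *)
Lemma derive_cos_normal (s c t : R) : 0 < s ->
  is_derive t 1 (fun t => \int[mu]_x (cos (t * x + c) * normal_pdf 0 s x))
    (- (s ^+ 2 * t * \int[mu]_x (cos (t * x + c) * normal_pdf 0 s x))).
Proof.
move=> s0.
pose f (t x : R) := cos (t * x + c) * normal_pdf 0 s x.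
have ml (u : R) : measurable_fun setT (fun x : R => u * x + c).
  by apply: measurable_funD => //; exact: measurable_funM.
have df (u x : R) :
    is_derive u 1 (f ^~ x) (- (x * sin (u * x + c) * normal_pdf 0 s x)).
  rewrite /f.
  by apply: is_derive_eq; rewrite /GRing.scale/= !(mulr1, mulr0, addr0, add0r); ring.
have d1 (u x : R) : partial1of2 f u x = - (x * sin (u * x + c) * normal_pdf 0 s x).
  by rewrite partial1of2E; case: (df u x).
have tI : `](t - 1), (t + 1)[%classic t.
  by rewrite /= in_itv/=; apply/andP; split; lra.
have h1 (u : R) : mu.-integrable setT (EFin \o f u).
  by apply: Rintegral_bmf_pdf; exact: bmf_cos.
have h2 := @normal_abs_integrable s s0.
have h3 := integrable_abse h2.
have H1 (x : R) : `](t - 1), (t + 1)[%classic x -> mu.-integrable setT (EFin \o f x).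
  by move=> _; exact: h1.
have H2 (x y : R) : `](t - 1), (t + 1)[%classic x -> [set: R] y -> derivable (f ^~ y) x 1.
  by move=> _ _; case: (df x y).
have H3 (y : R) : 0 <= `|y * normal_pdf 0 s y| by [].
have H4 (x y : R) : `](t - 1), (t + 1)[%classic x -> [set: R] y ->
    `|partial1of2 f x y| <= `|y * normal_pdf 0 s y|.
  move=> _ _; rewrite d1 normrN !normrM ler_wpM2r// ler_piMr//; exact: sin_max.
have D := derivable_under_integral measurableT tI H1 H2 H3 h3 H4.
have E := differentiation_under_integral measurableT tI H1 H2 H3 h3 H4.
apply: DeriveDef => //.
rewrite -derive1E E.
under eq_Rintegral do rewrite d1 -mulN1r.
rewrite RintegralZl//; last exact: normal_abs_bmf_integrable (bmf_sin (ml _)).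
by rewrite normal_ibp// mulN1r.
Qed.

(** By the differential equation of [derive_cos_normal], exp (s ^ 2 t ^ 2 / 2) phi(t) has derivative
    0, and its value at t = 0 is cos c. *)
Lemma cos_normal (s t c : R) : 0 < s ->
  \int[mu]_x (cos (t * x + c) * normal_pdf 0 s x) =
  expR (- (s ^+ 2 * t ^+ 2 / 2)) * cos c.
Proof.
move=> s0.
pose phi t := \int[mu]_x (cos (t * x + c) * normal_pdf 0 s x).
pose h t := expR (s ^+ 2 * (t * t) / 2) * phi t.
have /(_ t 0) : forall x y, h x = h y.
  move=> x y; apply: is_derive_0_is_cst => {x y}u.
  have dphi : is_derive (u : R) 1 phi (- (s ^+ 2 * u * phi u)).
    exact: derive_cos_normal.
  apply: is_derive_eq; rewrite /GRing.scale/= !(mulr1, mulr0, addr0, add0r).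
  by field.
rewrite /h !mulr0 mul0r expR0 mul1r.
have -> : phi 0 = cos c.
  rewrite /phi; under eq_Rintegral do rewrite mul0r add0r.
  rewrite RintegralZl//; last exact: integrable_normal_pdf.
  by rewrite /Rintegral integral_normal_pdf mulr1.
rewrite -expr2 => <-; rewrite mulrA -expRD addNr expR0 mul1r//.
Qed.

Lemma Ex_cos_normal (s t c : R) : 0 < s ->
  Ex (normal_prob 0 s) (fun x => cos (t * x + c)) =
  expR (- (s ^+ 2 * t ^+ 2 / 2)) * cos c.
Proof.
move=> s0; rewrite /Ex integral_normal_prob ?cos_normal//; apply: bmf_cos.
by apply: measurable_funD => //; exact: measurable_funM.
Qed.

End gaussian_integrals.

(** * From cosine transforms to distribution functions *)

Section trigonometric_bounds.
Context {R : realType}.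
Implicit Types a h x y : R.

Lemma mvt_between (f df : R -> R) a b :
  (forall x : R, is_derive x 1 f (df x)) ->
  exists2 c, `|c - a| <= `|b - a| & f b - f a = df c * (b - a).
Proof.
move=> fdf.
have cf : continuous f.
  move=> x; apply: differentiable_continuous; apply/derivable1_diffP.
  by case: (fdf x).
have [ab|ba] := leP a b.
  have [|c] := @MVT_segment R f df a b ab (fun x _ => fdf x).
    exact: continuous_subspaceT.
  rewrite in_itv/= => /andP[ac cb] fE; exists c => //.
  by rewrite !ger0_norm ?subr_ge0// lerB.
have [|c] := @MVT_segment R f df b a (ltW ba) (fun x _ => fdf x).
  exact: continuous_subspaceT.
rewrite in_itv/= => /andP[bc ca] fE; exists c => //.
  rewrite distrC (distrC b) !ger0_norm ?subr_ge0 ?(ltW ba)//.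
  by rewrite lerB.
by rewrite -[LHS]opprB fE -mulrN opprB.
Qed.

Lemma sin_lip x y : `|sin x - sin y| <= `|x - y|.
Proof.
have [c _ ->] := @mvt_between sin cos y x (fun z => is_derive_sin z).
by rewrite normrM ler_piMl// cos_max.
Qed.

Lemma cos_lip x y : `|cos x - cos y| <= `|x - y|.
Proof.
have [c _ ->] := @mvt_between cos (fun z => - sin z) y x (fun z => is_derive_cos z).
by rewrite normrM normrN ler_piMl// sin_max.
Qed.

Lemma cos_taylor1 a h : `|cos (a + h) - cos a + h * sin a| <= h ^+ 2.
Proof.
have [c ch E] :=
  @mvt_between cos (fun z => - sin z) a (a + h) (fun z => is_derive_cos z).
move: ch; rewrite (addrC a) addrK in E *; rewrite E => ch.
rewrite (_ : _ + _ = - (sin c - sin a) * h); last by ring.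
rewrite normrM normrN -[leRHS]real_normK ?num_real// expr2 ler_wpM2r//.
exact: le_trans (sin_lip _ _) ch.
Qed.

Lemma sin_taylor1 a h : `|sin (a + h) - sin a - h * cos a| <= h ^+ 2.
Proof.
have := cos_taylor1 (a - pi / 2) h.
by rewrite (addrAC a) !cosBpihalf sinBpihalf mulrN.
Qed.

(** The derivative in h of the remainder is minus the remainder of [sin_taylor1]. The mean value
    theorem does not integrate it, whence the constant 1 instead of 1 / 6. *)
Lemma cos_taylor2 a h :
  `|cos (a + h) - cos a + h * sin a + h ^+ 2 / 2 * cos a| <= `|h| ^+ 3.
Proof.
pose f h := cos (a + h) + h * sin a + h * h / 2 * cos a.
pose df h := - (sin (a + h) - sin a - h * cos a).
have fdf (x : R) : is_derive x 1 f (df x).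
  have d1 : is_derive x 1 (fun h => a + h) 1.
    by have := @is_deriveD _ _ _ (cst a) id x 1 0 1 _ _; rewrite add0r; exact.
  apply: is_derive_eq.
  by rewrite /df /GRing.scale/= !(mulr0, mulr1, add0r, addr0); field.
have [c] := @mvt_between f df 0 h fdf; rewrite !subr0 => ch E.
have -> : cos (a + h) - cos a + h * sin a + h ^+ 2 / 2 * cos a = f h - f 0.
  by rewrite /f addr0; ring.
rewrite E normrM /df normrN exprSr ler_wpM2r//.
apply: le_trans (sin_taylor1 _ _) _.
by rewrite -[leLHS]real_normK ?num_real// lerXn2r ?nnegrE.
Qed.

(** The mean value theorem gives sin y = y cos c with |c| <= 1, and cos c = 1 - 2 sin (c / 2) ^ 2 >=
    1 - 2 / 4. *)
Lemma sin_ge_half y : 0 <= y <= 1 -> y / 2 <= sin y.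
Proof.
move=> /andP[y0 y1].
have [c c1] := @mvt_between sin cos 0 y (fun z => is_derive_sin z).
rewrite sin0 !subr0 => ->.
rewrite mulrC ler_wpM2r//.
have c2 : `|c| <= 1.
  by move: c1; rewrite !subr0 => /le_trans; apply; rewrite ger0_norm.
have -> : cos c = 1 - (sin (c / 2)) ^+ 2 *+ 2.
  by rewrite {1}(splitr c) cosD -!expr2 cos2sin2; ring.
have : `|sin (c / 2)| <= 1 / 2.
  have := sin_lip (c / 2) 0; rewrite sin0 !subr0 => /le_trans; apply.
  by rewrite normrM [`|2^-1|]gtr0_norm// ler_wpM2r.
rewrite -[X in 1 - X *+ _]real_normK ?num_real//.
have := normr_ge0 (sin (c / 2)); move: `|_| => s s0 s1.
have : s ^+ 2 <= (1 / 2) ^+ 2 by rewrite lerXn2r ?nnegrE.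
have -> : (1 / 2) ^+ 2 = 1 / 4 :> R by field.
by rewrite -mulr_natr; lra.
Qed.

Lemma bernoulli_ineq x n : -1 <= x -> 1 + n%:R * x <= (1 + x) ^+ n.
Proof.
move=> x1; elim: n => [|n IHn]; first by rewrite mul0r addr0.
rewrite exprSr; apply: (@le_trans _ _ ((1 + n%:R * x) * (1 + x))).
  rewrite -natr1; have : 0 <= n%:R * x ^+ 2 by rewrite mulr_ge0// sqr_ge0.
  by rewrite expr2; lra.
by rewrite ler_wpM2r//; lra.
Qed.

(** Multiply by (1 + x) ^ n: the product (1 - x ^ 2) ^ n is at most 1, and Bernoulli bounds the new
    factor below. *)
Lemma expr1B_le x n : 0 <= x <= 1 -> (1 - x) ^+ n <= (1 + n%:R * x)^-1.
Proof.
move=> /andP[x0 x1].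
have p : 0 < 1 + n%:R * x by rewrite ltr_wpDr// mulr_ge0.
rewrite -div1r ler_pdivlMr//.
apply: (@le_trans _ _ ((1 - x) ^+ n * (1 + x) ^+ n)).
  by rewrite ler_wpM2l ?bernoulli_ineq ?exprn_ge0//; lra.
rewrite -exprMn exprn_ile1//; nra.
Qed.

End trigonometric_bounds.

Section trigonometric_step.
Context {R : realType}.
Implicit Types x z : R.

(* A trigonometric polynomial in z with values in [0, 1], approximating the
   indicator of ]-oo, x[: for u in [0, 1], (1 - u ^ n) ^ (2 ^ n) is close to 1
   when u < 1 / 2 and close to 0 when u > 1 / 2. *)
Definition trig_step (j : nat) (x z : R) : R :=
  (1 - ((1 + sin ((z - x) / j%:R ^+ 2)) / 2) ^+ (j ^ 4)) ^+ (2 ^ (j ^ 4)).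

Lemma trig_step_base01 (y : R) : 0 <= (1 + sin y) / 2 <= 1.
Proof. by have := sin_geN1 y; have := sin_le1 y; lra. Qed.

Lemma trig_step01 j x z : 0 <= trig_step j x z <= 1.
Proof.
rewrite /trig_step; set u := (1 + _) / 2.
have /andP[u0 u1] : 0 <= u <= 1 by exact: trig_step_base01.
have /andP[v0 v1] : 0 <= u ^+ (j ^ 4) <= 1 by rewrite exprn_ge0//= exprn_ile1.
by rewrite exprn_ge0 ?exprn_ile1//; lra.
Qed.

(** This fixes the exponents in [trig_step]. The frequency 1 / j ^ 2 keeps the argument in [0, 1],
    where sin is at least half of it; the power j ^ 4 then yields j ^ 4 y / (2 j ^ 2), which is at
    least j / 2 as soon as y >= 1 / j. *)
Lemma trig_step_scale j (y : R) : (0 < j)%N -> j%:R^-1 <= y -> y <= j%:R ^+ 2 ->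
  1 + j%:R / 2 <= 1 + (j ^ 4)%:R * sin (y / j%:R ^+ 2).
Proof.
move=> j0 jy yj; have j0' : 0 < j%:R :> R by rewrite ltr0n.
have y0 : 0 <= y by apply: le_trans jy; rewrite invr_ge0 ltW.
rewrite lerD2l; apply: (@le_trans _ _ ((j ^ 4)%:R * (y / j%:R ^+ 2 / 2))).
  rewrite natrX (_ : _ ^+ 4 * _ = j%:R * (j%:R * y) / 2); last by field; rewrite gt_eqF.
  rewrite ler_pM2r// ler_peMr ?(ltW j0')//.
  by rewrite -ler_pdivrMl// mulr1.
rewrite ler_wpM2l//; apply: sin_ge_half.
by rewrite divr_ge0 ?sqr_ge0//= ler_pdivrMr ?exprn_gt0// mul1r.
Qed.

(** With n = j ^ 4 and u = (1 - s) / 2, Bernoulli gives 1 - (1 - u ^ n) ^ (2 ^ n) <= (2 u) ^ n = (1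
    - s) ^ n, which is at most 1 / (1 + n s). *)
Lemma trig_step_left j x z : (0 < j)%N -> `|z - x| <= j%:R ^+ 2 ->
  z <= x - j%:R^-1 -> 1 - trig_step j x z <= 2 / j%:R.
Proof.
move=> j0 zx zl; rewrite /trig_step.
set y := x - z; set n := (j ^ 4)%N.
have j0' : 0 < j%:R :> R by rewrite ltr0n.
have jy : j%:R^-1 <= y by rewrite /y; lra.
have y0 : 0 <= y by apply: le_trans jy; rewrite invr_ge0 ltW.
have yj : y <= j%:R ^+ 2 by apply: le_trans zx; rewrite distrC ler_norm.
have -> : (z - x) / j%:R ^+ 2 = - (y / j%:R ^+ 2) by rewrite /y -mulNr opprB.
rewrite sinN; set s := sin _.
have sc := trig_step_scale j0 jy yj; rewrite -/s -/n in sc.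
have s0 : 0 <= s.
  have : 0 <= y / j%:R ^+ 2 / 2 by rewrite !divr_ge0// sqr_ge0.
  move=> /le_trans; apply; apply: sin_ge_half.
  by rewrite divr_ge0 ?sqr_ge0//= ler_pdivrMr ?exprn_gt0// mul1r.
have s1 : s <= 1 by exact: sin_le1.
set u := (1 - s) / 2.
have u01 : 0 <= u <= 1 by rewrite /u; lra.
have un : -1 <= - u ^+ n.
  by rewrite lerN2 exprn_ile1//; case/andP: u01.
have := bernoulli_ineq (2 ^ n) un.
have -> : (2 ^ n)%:R * - u ^+ n = - (1 - s) ^+ n.
  rewrite mulrN natrX -exprMn; congr (- (_ ^+ _)).
  by rewrite /u mulrC divfK.
have := @expr1B_le R s n; rewrite s0 s1 => /(_ isT) h1 h2.
apply: (@le_trans _ _ ((1 - s) ^+ n)); first by lra.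
apply: (le_trans h1).
apply: (@le_trans _ _ ((1 + j%:R / 2)^-1)).
  by rewrite lef_pV2// posrE ?(lt_le_trans _ sc)// ltr_wpDr// divr_ge0// ltW.
rewrite -[leRHS]invrK invf_div lef_pV2 ?posrE ?divr_gt0//; first by lra.
Qed.

(** Now 2 u = 1 + s exceeds 1, so (1 - u ^ n) ^ (2 ^ n) <= 1 / (1 + (2 u) ^ n), and (1 + s) ^ n >= 1
    + n s. *)
Lemma trig_step_right j x z : (0 < j)%N -> `|z - x| <= j%:R ^+ 2 ->
  x + j%:R^-1 <= z -> trig_step j x z <= 2 / j%:R.
Proof.
move=> j0 zx zl; rewrite /trig_step.
set y := z - x; set n := (j ^ 4)%N.
have j0' : 0 < j%:R :> R by rewrite ltr0n.
have jy : j%:R^-1 <= y by rewrite /y; lra.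
have y0 : 0 <= y by apply: le_trans jy; rewrite invr_ge0 ltW.
have yj : y <= j%:R ^+ 2 by apply: le_trans zx; rewrite ler_norm.
set s := sin _.
have sc := trig_step_scale j0 jy yj; rewrite -/s -/n in sc.
have s0 : 0 <= s.
  have : 0 <= y / j%:R ^+ 2 / 2 by rewrite !divr_ge0// sqr_ge0.
  move=> /le_trans; apply; apply: sin_ge_half.
  by rewrite divr_ge0 ?sqr_ge0//= ler_pdivrMr ?exprn_gt0// mul1r.
have s1 : s <= 1 by exact: sin_le1.
set u := (1 + s) / 2.
have u01 : 0 <= u <= 1 by rewrite /u; lra.
have un : 0 <= u ^+ n <= 1.
  by case/andP: u01 => ? ?; rewrite exprn_ge0//= exprn_ile1.
apply: (le_trans (expr1B_le (2 ^ n) un)).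
have -> : (2 ^ n)%:R * u ^+ n = (1 + s) ^+ n.
  by rewrite natrX -exprMn; congr (_ ^+ _); rewrite /u mulrC divfK.
have h : 1 + j%:R / 2 <= (1 + s) ^+ n.
  by apply: (le_trans sc); apply: bernoulli_ineq; lra.
rewrite -[leRHS]invrK invf_div lef_pV2 ?posrE ?divr_gt0//; first by lra.
by rewrite ltr_wpDr// (le_trans _ h)// ltW// ltr_wpDr// divr_ge0// ltW.
Qed.

End trigonometric_step.

Section bounded_convergence.
Context {d : measure_display} {T : measurableType d} {R : realType}.
Variable P : probability T R.

Lemma bounded_convergence (f_ : nat -> T -> R) (f : T -> R) (C : R) :
  (forall n, measurable_fun setT (f_ n)) -> measurable_fun setT f ->
  (forall n x, `|f_ n x| <= C) ->
  (forall x, f_ n x @[n --> \oo] --> f x) ->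
  Ex P (f_ n) @[n --> \oo] --> Ex P f.
Proof.
move=> mf_ mf fC f_f.
have C0 x : `|f x| <= C.
  have h : `|f_ n x| @[n --> \oo] --> `|f x| by apply: cvg_norm; exact: f_f.
  rewrite -(cvg_lim (@norm_hausdorff _ _) h); apply: limr_le.
    by apply/cvg_ex; eexists; exact: h.
  by apply: nearW => n; exact: fC.
have [] := @dominated_convergence _ _ _ P setT measurableT
  (fun n x => (f_ n x)%:E) (EFin \o f) (cst C%:E).
- by move=> n; exact/measurable_EFinP.
- exact/measurable_EFinP.
- by apply: aeW => x _ /=; apply/fine_cvgP; split; [exact: nearW|exact: f_f].
- have := bmf_integrable P (@bmf_cst _ T R C); exact.
- by apply: aeW => x n _ /=; rewrite lee_fin.
move=> _ _ h; rewrite /Ex /Rintegral; apply: fine_cvg; rewrite fineK//.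
by apply: integrable_fin_num => //; apply: bmf_integrable; split => //; exists C.
Qed.

Lemma tail_vanishes (f : T -> R) (e : R) : measurable_fun setT f -> 0 < e ->
  \forall A \near \oo, fine (P [set x | A%:R <= `|f x|]) <= e.
Proof.
move=> mf e0.
have mA (n : nat) : measurable [set x | n%:R <= `|f x|].
  rewrite -[X in measurable X]setTI.
  apply: (@measurable_fun_le _ _ _ setT (cst n%:R) (fun x => `|f x|)) => //.
  exact: measurableT_comp.
have : Ex P (\1_[set x | n%:R <= `|f x|]) @[n --> \oo] --> Ex P (fun=> 0).
  apply: (@bounded_convergence _ _ 1).
  - by move=> n; exact: bmf_meas (bmf_indic (mA n)).
  - exact: measurable_cst.
  - by move=> n x; rewrite indicE; case: (_ \in _); rewrite /= ?normr1 ?normr0.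
  - move=> x; apply: cvg_near_cst; near=> n; rewrite indicE memNset//=.
    apply/negP; rewrite -ltNge; near: n; exact: nbhs_infty_gtr.
rewrite Ex_cst => /cvgr0Pnorm_le /(_ e e0); apply: filterS => n.
by rewrite Ex_indic// => /(le_trans (ler_norm _)).
Unshelve. all: by end_near. Qed.

End bounded_convergence.

Section trigonometric_polynomials.
Context {R : realType}.

(** The linear span of the phased cosines in two variables. The product-to-sum formula makes it an
    algebra, so it contains the steps in each variable and their products, while expectations on it
    are determined by the cosine transforms. *)
Inductive trig_poly : (R -> R -> R) -> Prop :=
| trig_poly_cos s t c : trig_poly (fun x y => cos (s * x + t * y + c))
| trig_polyD f g : trig_poly f -> trig_poly g ->
    trig_poly (fun x y => f x y + g x y)
| trig_polyZ a f : trig_poly f -> trig_poly (fun x y => a * f x y).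

Lemma eq_trig_poly f g : (forall x y, f x y = g x y) -> trig_poly f -> trig_poly g.
Proof. by move=> fg; suff -> : g = f by []; apply/funext => x; apply/funext => y. Qed.

Lemma trig_poly_cst a : trig_poly (fun _ _ => a).
Proof.
apply: eq_trig_poly (trig_polyZ a (trig_poly_cos 0 0 0)) => x y /=.
by rewrite !mul0r !addr0 cos0 mulr1.
Qed.

Lemma trig_polyM f g : trig_poly f -> trig_poly g ->
  trig_poly (fun x y => f x y * g x y).
Proof.
move=> tf; elim: tf g => [s t c|f1 f2 _ IH1 _ IH2|a f1 _ IH] g tg.
- elim: tg => [s' t' c'|g1 g2 _ IH1 _ IH2|a g1 _ IH].
  + have t1 := trig_poly_cos (s + s') (t + t') (c + c').
    have t2 := trig_poly_cos (s - s') (t - t') (c - c').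
    apply: eq_trig_poly (trig_polyZ (1 / 2) (trig_polyD t1 t2)) => x y /=.
    set u := s * x + t * y + c; set v := s' * x + t' * y + c'.
    have -> : (s + s') * x + (t + t') * y + (c + c') = u + v by rewrite /u /v; ring.
    have -> : (s - s') * x + (t - t') * y + (c - c') = u - v by rewrite /u /v; ring.
    by rewrite cosB cosD; field.
  + by apply: eq_trig_poly (trig_polyD IH1 IH2) => x y; rewrite mulrDr.
  + by apply: eq_trig_poly (trig_polyZ a IH) => x y; rewrite mulrCA.
- by apply: eq_trig_poly (trig_polyD (IH1 _ tg) (IH2 _ tg)) => x y; rewrite mulrDl.
- by apply: eq_trig_poly (trig_polyZ a (IH _ tg)) => x y; rewrite mulrA.
Qed.

Lemma trig_polyX n f : trig_poly f -> trig_poly (fun x y => f x y ^+ n).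
Proof.
move=> tf; elim: n => [|n IHn]; first exact: trig_poly_cst.
by apply: eq_trig_poly (trig_polyM tf IHn) => x y; rewrite exprS.
Qed.

Lemma trig_polyN f : trig_poly f -> trig_poly (fun x y => - f x y).
Proof.
by move=> tf; apply: eq_trig_poly (trig_polyZ (-1) tf) => x y; rewrite mulN1r.
Qed.

Let step_of (j : nat) (f : R -> R -> R) : trig_poly f ->
  trig_poly (fun x y => (1 - ((1 + f x y) / 2) ^+ (j ^ 4)) ^+ (2 ^ (j ^ 4))).
Proof.
move=> tf; apply: trig_polyX; apply: trig_polyD; first exact: trig_poly_cst.
apply: trig_polyN; apply: trig_polyX.
apply: eq_trig_poly (trig_polyZ 2^-1 (trig_polyD (trig_poly_cst 1) tf)) => x y.
by rewrite mulrC.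
Qed.

Lemma trig_poly_step1 j x0 : trig_poly (fun x _ => trig_step j x0 x).
Proof.
have := trig_poly_cos (j%:R ^+ 2)^-1 0 (- x0 / j%:R ^+ 2 - pi / 2).
move=> /(step_of j); apply: eq_trig_poly => x y.
rewrite /trig_step; do 5 f_equal.
congr (1 + _); rewrite -[in RHS]cosBpihalf; congr (cos _); ring.
Qed.

Lemma trig_poly_step2 j y0 : trig_poly (fun _ y => trig_step j y0 y).
Proof.
have := trig_poly_cos 0 (j%:R ^+ 2)^-1 (- y0 / j%:R ^+ 2 - pi / 2).
move=> /(step_of j); apply: eq_trig_poly => x y.
rewrite /trig_step; do 5 f_equal.
congr (1 + _); rewrite -[in RHS]cosBpihalf; congr (cos _); ring.
Qed.

End trigonometric_polynomials.

Section weak_convergence.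
Context {d : measure_display} {T : measurableType d} {R : realType}.
Variable P : probability T R.

Lemma cvg_trig_poly d' (T' : measurableType d') (Q : probability T' R)
    (X Y : nat -> T -> R) (X' Y' : T' -> R) :
  (forall n, measurable_fun setT (X n)) -> (forall n, measurable_fun setT (Y n)) ->
  measurable_fun setT X' -> measurable_fun setT Y' ->
  (forall s t c, Ex P (fun z => cos (s * X n z + t * Y n z + c)) @[n --> \oo] -->
     Ex Q (fun z => cos (s * X' z + t * Y' z + c))) ->
  forall f, trig_poly f ->
    Ex P (fun z => f (X n z) (Y n z)) @[n --> \oo] -->
    Ex Q (fun z => f (X' z) (Y' z)).
Proof.
move=> mX mY mX' mY' h f.
have mc d2 (U : measurableType d2) (A B : U -> R) s t c : measurable_fun setT A ->
    measurable_fun setT B -> bmf (fun z => cos (s * A z + t * B z + c)).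
  move=> mA mB; apply: bmf_cos; apply: measurable_funD => //.
  by apply: measurable_funD; apply: measurable_funM.
have mtp d2 (U : measurableType d2) (A B : U -> R) g : measurable_fun setT A ->
    measurable_fun setT B -> trig_poly g -> bmf (fun z => g (A z) (B z)).
  move=> mA mB; elim=> [s t c|g1 g2 _ b1 _ b2|a g1 _ b1].
  - exact: mc.
  - exact: bmfD.
  - exact: bmfZ.
elim=> [s t c|g1 g2 t1 IH1 t2 IH2|a g1 t1 IH1].
- exact: h.
- rewrite ExD; [|exact: mtp..].
  rewrite (_ : (fun n => _) = (fun n => Ex P (fun z => g1 (X n z) (Y n z)) +
      Ex P (fun z => g2 (X n z) (Y n z)))); last first.
    by apply/funext => n; rewrite ExD; [|exact: mtp..].
  exact: cvgD.
- rewrite ExZ; [|exact: mtp].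
  rewrite (_ : (fun n => _) = (fun n => a * Ex P (fun z => g1 (X n z) (Y n z))));
    last by apply/funext => n; rewrite ExZ; [|exact: mtp].
  exact: cvgMr.
Qed.

Lemma measurable_trig_step d' (T' : measurableType d') j (x : R) (f : T' -> R) :
  measurable_fun setT f -> bmf (fun z => trig_step j x (f z)).
Proof.
move=> mf; apply: bmfX; apply: bmfB; first exact: bmf_cst.
apply: bmfX; under [X in bmf X]eq_fun do rewrite mulrC.
apply: bmfZ; apply: bmfD; first exact: bmf_cst.
apply: bmf_sin; under eq_fun do rewrite mulrC.
by apply: measurable_funM => //; exact: measurable_funB.
Qed.

Lemma indic_bool d' (T' : measurableType d') (p : T' -> bool) z :
  \1_[set x | p x] z = (p z)%:R :> R.
Proof.
rewrite indicE; suff -> : (z \in [set x | p x]) = p z by [].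
by apply/idP/idP; rewrite inE.
Qed.

Lemma measurable_le_cst d' (T' : measurableType d') (f : T' -> R) (x : R) :
  measurable_fun setT f -> measurable [set z | f z <= x].
Proof.
move=> mf; rewrite -[X in measurable X]setTI.
exact: (@measurable_fun_le _ _ _ setT f (cst x)).
Qed.

Lemma measurable_ge_cst d' (T' : measurableType d') (f : T' -> R) (x : R) :
  measurable_fun setT f -> measurable [set z | x <= f z].
Proof.
move=> mf; rewrite -[X in measurable X]setTI.
exact: (@measurable_fun_le _ _ _ setT (cst x) f).
Qed.

Lemma measurable_ge_norm d' (T' : measurableType d') (f : T' -> R) (x : R) :
  measurable_fun setT f -> measurable [set z | x <= `|f z|].
Proof. by move=> mf; apply: measurable_ge_cst; exact: measurableT_comp. Qed.

(* [trig_step j x] is within [2 / j] of the indicator of ]-oo, x] off the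
   interval of radius [1 / j] around x and inside the ball of radius [j ^ 2]. *)
Lemma cdf_le_trig_step d' (T' : measurableType d') (Q : probability T' R)
    (f : T' -> R) j (x : R) : (0 < j)%N -> measurable_fun setT f ->
  fine (Q [set z | f z <= x - j%:R^-1]) <= Ex Q (fun z => trig_step j x (f z)) +
    2 / j%:R + fine (Q [set z | j%:R ^+ 2 <= `|f z - x|]).
Proof.
move=> j0 mf; have mS := measurable_trig_step j x mf.
have mA := measurable_le_cst (x - j%:R^-1) mf.
have mB : measurable [set z | j%:R ^+ 2 <= `|f z - x|].
  by apply: measurable_ge_norm; exact: measurable_funB.
rewrite -(Ex_indic _ mA) -(Ex_indic _ mB) -[2 / j%:R](Ex_cst Q).
have b1 := bmf_indic mA; have b2 := bmf_indic mB.
have b3 := @bmf_cst _ T' R (2 / j%:R).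
rewrite -!ExD//; last exact: bmfD.
apply: Ex_le => //; first by apply: bmfD => //; exact: bmfD.
move=> z; rewrite !indic_bool.
have /andP[s0 s1] := trig_step01 j x (f z).
have j2 : 0 <= 2 / j%:R :> R by rewrite divr_ge0.
have [fz|_] := leP (f z) (x - j%:R^-1); last by rewrite !addr_ge0// ler0n.
have [_|/ltW fj] := leP (j%:R ^+ 2) `|f z - x|; first by rewrite /=; lra.
by rewrite /=; have := trig_step_left j0 fj fz; lra.
Qed.

Lemma trig_step_le_cdf d' (T' : measurableType d') (Q : probability T' R)
    (f : T' -> R) j (x : R) : (0 < j)%N -> measurable_fun setT f ->
  Ex Q (fun z => trig_step j x (f z)) <= fine (Q [set z | f z <= x + j%:R^-1]) +
    2 / j%:R + fine (Q [set z | j%:R ^+ 2 <= `|f z - x|]).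
Proof.
move=> j0 mf; have mS := measurable_trig_step j x mf.
have mA := measurable_le_cst (x + j%:R^-1) mf.
have mB : measurable [set z | j%:R ^+ 2 <= `|f z - x|].
  by apply: measurable_ge_norm; exact: measurable_funB.
rewrite -(Ex_indic _ mA) -(Ex_indic _ mB) -[2 / j%:R](Ex_cst Q).
have b1 := bmf_indic mA; have b2 := bmf_indic mB.
have b3 := @bmf_cst _ T' R (2 / j%:R).
rewrite -!ExD//; last exact: bmfD.
apply: Ex_le => //; first by apply: bmfD => //; exact: bmfD.
move=> z; rewrite !indic_bool.
have /andP[s0 s1] := trig_step01 j x (f z).
have j2 : 0 <= 2 / j%:R :> R by rewrite divr_ge0.
have [fz|/ltW fz] := leP (f z) (x + j%:R^-1).
  by apply: (le_trans s1); rewrite -addrA lerDl addr_ge0// ler0n.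
have [_|/ltW fj] := leP (j%:R ^+ 2) `|f z - x|; first by rewrite /=; lra.
by rewrite /=; have := trig_step_right j0 fj fz; lra.
Qed.

Lemma tail_centered d' (T' : measurableType d') (Q : probability T' R)
    (f : T' -> R) (x A : R) j : measurable_fun setT f ->
  `|x| + A <= j%:R ^+ 2 ->
  fine (Q [set z | j%:R ^+ 2 <= `|f z - x|]) <= fine (Q [set z | A <= `|f z|]).
Proof.
move=> mf xA; apply: fineP_le.
- by apply: measurable_ge_norm; exact: measurable_funB.
- exact: measurable_ge_norm.
- move=> z /= h.
  by have := ler_normB (f z) x; lra.
Qed.

(** For one fixed [j] the expectation of [trig_step j] converges, being that of a trigonometric
    polynomial, and it sandwiches both distribution functions. The slack [dl] in the argument is
    unavoidable here, since [N] may have atoms. *)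
Lemma cvg_cos_cdf d' (T' : measurableType d') (Q : probability T' R)
    (Z : nat -> T -> R) (N : T' -> R) :
  (forall n, measurable_fun setT (Z n)) -> measurable_fun setT N ->
  (forall t c, Ex P (fun z => cos (t * Z n z + c)) @[n --> \oo] -->
     Ex Q (fun z => cos (t * N z + c))) ->
  (forall e : R, 0 < e -> exists A : R,
     \forall n \near \oo, fine (P [set z | A <= `|Z n z|]) <= e) ->
  forall x e dl : R, 0 < e -> 0 < dl ->
  \forall n \near \oo,
    fine (P [set z | Z n z <= x]) <= fine (Q [set z | N z <= x + dl]) + e /\
    fine (Q [set z | N z <= x - dl]) - e <= fine (P [set z | Z n z <= x]).
Proof.
move=> mZ mN hcos tight x e dl e0 dl0.
have e80 : 0 < e / 8 by rewrite divr_gt0.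
have [A PA] := tight _ e80.
have [B QB] : exists B : R, fine (Q [set z | B <= `|N z|]) <= e / 8.
  have [n _ /(_ n (leqnn n)) h] := tail_vanishes Q mN e80.
  by exists n%:R.
pose C : R := `|x| + dl + `|A| + `|B| + 1 + 2 / dl + 16 / e.
(* Large enough for 2 / j <= dl, 2 / j <= e / 8, and for the radius j ^ 2 to reach beyond the tail
   bounds [A] and [B] from both centres x + 1 / j and x - 1 / j. *)
have [j jC] : exists j : nat, C <= j%:R by exact: filter_ex (nbhs_infty_ger C).
have C1 : 1 <= C.
  rewrite /C; have := normr_ge0 x; have := normr_ge0 A; have := normr_ge0 B.
  have : 0 <= 2 / dl by rewrite divr_ge0// ltW.
  have : 0 <= 16 / e by rewrite divr_ge0// ltW.
  lra.
have j1 : 1 <= j%:R :> R by exact: le_trans jC.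
have j0 : (0 < j)%N by rewrite -(@ltr0n R) (lt_le_trans ltr01).
have j0' : 0 < j%:R :> R by rewrite ltr0n.
have jj : j%:R <= j%:R ^+ 2 :> R by rewrite expr2 ler_peMl// ltW.
have jd : j%:R^-1 <= dl / 2.
  rewrite -[leRHS]invrK invf_div lef_pV2 ?posrE ?divr_gt0//.
  apply: le_trans jC; rewrite /C.
  have := normr_ge0 x; have := normr_ge0 A; have := normr_ge0 B.
  have : 0 <= 16 / e by rewrite divr_ge0// ltW.
  lra.
have je : 2 / j%:R <= e / 8.
  rewrite -[leRHS]invrK invf_div -[2 / _]invrK invf_div lef_pV2 ?posrE ?divr_gt0//.
  rewrite ler_pdivlMr//.
  have -> : 8 / e * 2 = 16 / e by rewrite mulrAC -natrM.
  apply: le_trans jC; rewrite /C.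
  have := normr_ge0 x; have := normr_ge0 A; have := normr_ge0 B.
  have : 0 <= 2 / dl by rewrite divr_ge0// ltW.
  lra.
have big (y D : R) : `|y| <= `|x| + dl -> `|D| <= `|A| + `|B| ->
    `|y| + D <= j%:R ^+ 2.
  move=> yx DAB; apply: le_trans jj; apply: le_trans jC; rewrite /C.
  have := ler_norm D.
  have : 0 <= 2 / dl by rewrite divr_ge0// ltW.
  have : 0 <= 16 / e by rewrite divr_ge0// ltW.
  lra.
have yl : `|x + j%:R^-1| <= `|x| + dl.
  apply: (le_trans (ler_normD _ _)); rewrite lerD2l gtr0_norm ?invr_gt0//.
  by lra.
have yr : `|x - j%:R^-1| <= `|x| + dl.
  apply: (le_trans (ler_normB _ _)); rewrite lerD2l gtr0_norm ?invr_gt0//.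
  by lra.
have conv y : Ex P (fun z => trig_step j y (Z n z)) @[n --> \oo] -->
     Ex Q (fun z => trig_step j y (N z)).
  apply: (@cvg_trig_poly _ _ Q Z (fun _ _ => 0) N (fun=> 0) _ _ _ _ _ _
      (trig_poly_step1 j y)) => //.
  - move=> s t c; have a0 (u : R) : u + t * 0 = u by rewrite mulr0 addr0.
    rewrite (@eq_Ex _ _ _ Q _ (fun z => cos (s * N z + c))); last first.
      by move=> z; rewrite a0.
    rewrite (_ : (fun n => Ex P _) = (fun n => Ex P (fun z => cos (s * Z n z + c))))//.
    by apply/funext => n; apply: eq_Ex => z; rewrite a0.
have cl := conv (x + j%:R^-1); have cr := conv (x - j%:R^-1).
near=> n; split.
(* Centred at x + 1 / j, the step is already near 1 up to x. Returning to the distribution function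
   of [N] costs another 1 / j, in total at most [dl]. *)
- have := @cdf_le_trig_step _ _ P (Z n) j (x + j%:R^-1) j0 (mZ n).
  rewrite addrK => /le_trans; apply.
  have h1 : fine (P [set z | j%:R ^+ 2 <= `|Z n z - (x + j%:R^-1)|]) <= e / 8.
    apply: (@le_trans _ _ (fine (P [set z | A <= `|Z n z|]))).
      by apply: tail_centered => //; apply: big => //; rewrite lerDl.
    by near: n.
  have h2 : Ex P (fun z => trig_step j (x + j%:R^-1) (Z n z)) <=
            Ex Q (fun z => trig_step j (x + j%:R^-1) (N z)) + e / 8.
    rewrite -lerBlDl (le_trans (ler_norm _))// distrC.
    by near: n; move/cvgrPdist_le : cl; apply.
  have h3 := @trig_step_le_cdf _ _ Q N j (x + j%:R^-1) j0 mN.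
  have h4 : fine (Q [set z | j%:R ^+ 2 <= `|N z - (x + j%:R^-1)|]) <= e / 8.
    apply: le_trans QB; apply: tail_centered => //; apply: big => //.
    by rewrite lerDr.
  have h5 : fine (Q [set z | N z <= x + j%:R^-1 + j%:R^-1]) <=
            fine (Q [set z | N z <= x + dl]).
    apply: fineP_le; try exact: measurable_le_cst.
    by move=> z /= /le_trans; apply; lra.
  lra.
- have h0 := @trig_step_le_cdf _ _ P (Z n) j (x - j%:R^-1) j0 (mZ n).
  rewrite subrK in h0.
  have h1 : fine (P [set z | j%:R ^+ 2 <= `|Z n z - (x - j%:R^-1)|]) <= e / 8.
    apply: (@le_trans _ _ (fine (P [set z | A <= `|Z n z|]))).
      by apply: tail_centered => //; apply: big => //; rewrite lerDl.
    by near: n.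
  have h2 : Ex Q (fun z => trig_step j (x - j%:R^-1) (N z)) <=
            Ex P (fun z => trig_step j (x - j%:R^-1) (Z n z)) + e / 8.
    rewrite -lerBlDl (le_trans (ler_norm _))//.
    by near: n; move/cvgrPdist_le : cr; apply.
  have h3 := @cdf_le_trig_step _ _ Q N j (x - j%:R^-1) j0 mN.
  have h4 : fine (Q [set z | j%:R ^+ 2 <= `|N z - (x - j%:R^-1)|]) <= e / 8.
    apply: le_trans QB; apply: tail_centered => //; apply: big => //.
    by rewrite lerDr.
  have h5 : fine (Q [set z | N z <= x - dl]) <=
      fine (Q [set z | N z <= x - j%:R^-1 - j%:R^-1]).
    apply: fineP_le; try exact: measurable_le_cst.
    by move=> z /= /le_trans; apply; lra.
  lra.
Unshelve. all: by end_near. Qed.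

(* Cramer-Wold in the plane, through trigonometric polynomials. *)
Lemma cos_eq_joint d' (T' : measurableType d') (Q : probability T' R)
    (X Y : T -> R) (X' Y' : T' -> R) :
  measurable_fun setT X -> measurable_fun setT Y ->
  measurable_fun setT X' -> measurable_fun setT Y' ->
  (forall s t c, Ex P (fun z => cos (s * X z + t * Y z + c)) =
     Ex Q (fun z => cos (s * X' z + t * Y' z + c))) ->
  forall x y, fine (P [set z | (x <= X z) && (y <= Y z)]) =
    fine (Q [set z | (x <= X' z) && (y <= Y' z)]).
Proof.
move=> mX mY mX' mY' h x y.
(* The centre x - 1 / j puts the boundary point u = x where the step is already near 0, so that
   [f j] tends to the indicator of the closed quadrant at every point, its boundary included. *)
pose f j (u v : R) :=
  (1 - trig_step j (x - j%:R^-1) u) * (1 - trig_step j (y - j%:R^-1) v).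
have tf j : trig_poly (f j).
  by apply: trig_polyM; (apply: trig_polyD; first exact: trig_poly_cst);
    apply: trig_polyN; [exact: trig_poly_step1|exact: trig_poly_step2].
have Ef j : Ex P (fun z => f j (X z) (Y z)) = Ex Q (fun z => f j (X' z) (Y' z)).
  have hc : forall s t c, Ex P (fun z => cos (s * X z + t * Y z + c)) @[n --> \oo] -->
      Ex Q (fun z => cos (s * X' z + t * Y' z + c)).
    by move=> s t c; rewrite h; exact: cvg_cst.
  have := cvg_trig_poly (fun=> mX) (fun=> mY) mX' mY' hc (tf j).
  move=> /(cvg_lim (@norm_hausdorff _ _)) <-.
  by rewrite lim_cst//; exact: norm_hausdorff.
have lim1 (a u : R) : 1 - trig_step j (a - j%:R^-1) u @[j --> \oo] -->
    ((a <= u)%R%:R : R).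
  apply/cvgrPdist_le => e e0; near=> j.
  have j0 : (0 < j)%N by near: j; exact: nbhs_infty_gt.
  have j0' : 0 < j%:R :> R by rewrite ltr0n.
  have j1 : j%:R^-1 <= 1 :> R by rewrite invf_le1// ler1n.
  have je : 2 / j%:R <= e.
    rewrite ler_pdivrMr// mulrC -ler_pdivrMr//.
    by near: j; exact: nbhs_infty_ger.
  have jau : `|u - (a - j%:R^-1)| <= j%:R ^+ 2.
    apply: (@le_trans _ _ (`|u - a| + 1)).
      rewrite opprB addrA addrAC (le_trans (ler_normD _ _))// lerD2l.
      by rewrite gtr0_norm ?invr_gt0.
    apply: (@le_trans _ _ j%:R); first by near: j; exact: nbhs_infty_ger.
    by rewrite expr2 ler_peMl ?(ltW j0')// ler1n.
  have /andP[s0 s1] := trig_step01 j (a - j%:R^-1) u.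
  have [au|ua] := leP a u => /=.
    have := @trig_step_right R j (a - j%:R^-1) u j0 jau.
    rewrite subrK => /(_ au) h1.
    rewrite (_ : 1 - _ = trig_step j (a - j%:R^-1) u); last by ring.
    by rewrite ger0_norm//; lra.
  have h1 : u <= a - j%:R^-1 - j%:R^-1.
    suff : 2 / j%:R <= a - u by lra.
    rewrite ler_pdivrMr// mulrC -ler_pdivrMr ?subr_gt0//.
    by near: j; exact: nbhs_infty_ger.
  have := trig_step_left j0 jau h1.
  by rewrite sub0r normrN ger0_norm; lra.
have lim2 d1 (U : measurableType d1) (Q1 : probability U R) (A B : U -> R) :
    measurable_fun setT A -> measurable_fun setT B ->
    Ex Q1 (fun z => f j (A z) (B z)) @[j --> \oo] -->
    fine (Q1 [set z | (x <= A z) && (y <= B z)]).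
  move=> mA mB.
  have mAB : measurable [set z | (x <= A z) && (y <= B z)].
    rewrite (_ : [set z | _] = [set z | x <= A z] `&` [set z | y <= B z]).
      by apply: measurableI; exact: measurable_ge_cst.
    by apply/seteqP; split => z /= => [/andP[]|[-> ->]].
  rewrite -Ex_indic//; apply: (@bounded_convergence _ _ _ _ _ _ 1).
  - move=> j; apply: measurable_funM; apply: measurable_funB => //;
      exact: bmf_meas (measurable_trig_step _ _ _).
  - exact: bmf_meas (bmf_indic mAB).
  - move=> j z; rewrite normrM mulr_ile1// ler_norml.
      by have := trig_step01 j (x - j%:R^-1) (A z); lra.
    by have := trig_step01 j (y - j%:R^-1) (B z); lra.
  - move=> z; rewrite (indic_bool (fun z => (x <= A z) && (y <= B z))).
    by rewrite -mulnb natrM; apply: cvgM; exact: lim1.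
apply: (cvg_unique _ (lim2 _ _ P _ _ mX mY)) => //.
by rewrite /= (funext Ef); exact: lim2.
Unshelve. all: by end_near. Qed.

End weak_convergence.

(** * The normal tail function and the cosine transforms of normal laws *)

Section standard_normal_cdf.
Context {R : realType}.
Local Notation mu := (@lebesgue_measure R).
Local Notation N01 := (normal_prob (0 : R) 1).
Implicit Types x y t : R.

Lemma normal_prob_set1 (m s x : R) : normal_prob m s [set x] = 0%E.
Proof.
have /null_content_dominatesP := @normal_prob_dominates R m s; apply => //.
exact: lebesgue_measure_set1.
Qed.

Lemma std_normal_itv x y : x <= y ->
  fine (N01 `]x, y]%classic) = std_normal_cdf y - std_normal_cdf x.
Proof.
move=> xy; rewrite /std_normal_cdf.
have fN (A : set R) : measurable A -> N01 A \is a fin_num.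
  by move=> mA; exact: fin_num_measure.
have h : N01 `]-oo, y]%classic = (N01 `]-oo, x]%classic + N01 `]x, y]%classic)%E.
  rewrite -measureU//; first by rewrite -itv_bndbnd_setU// bnd_simp.
  by apply/seteqP; split => z //=; rewrite !in_itv/= => -[zx /andP[]]; rewrite ltNge zx.
by rewrite h (fineD (fN _ (measurable_itv _)) (fN _ (measurable_itv _))) addrC addKr.
Qed.

Lemma std_normal_cdf_lip x y : x <= y ->
  std_normal_cdf y - std_normal_cdf x <= normal_peak 1 * (y - x).
Proof.
move=> xy; rewrite -std_normal_itv//.
rewrite -lee_fin fineK ?fin_num_measure//.
apply: (@le_trans _ _ (\int[mu]_(z in `]x, y]) (normal_peak 1)%:E)%E).
  apply: ge0_le_integral => //.
  - by move=> z _; rewrite lee_fin normal_pdf_ge0.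
  - apply/measurable_EFinP/measurable_funTS; exact: measurable_normal_pdf.
  - by move=> z _; rewrite lee_fin normal_pdf_ub// oner_neq0.
rewrite integral_cst//= lebesgue_measure_itv/= lte_fin.
case: ltP => [_|yx]; first by rewrite -EFinD -EFinM.
by rewrite mule0 lee_fin mulr_ge0 ?normal_peak_ge0// subr_ge0.
Qed.

Lemma std_normal_cdf_lt x y : x < y -> std_normal_cdf x < std_normal_cdf y.
Proof.
move=> xy; rewrite -subr_gt0 -std_normal_itv ?(ltW xy)//.
(* A lower bound of the density on ]x, y] whatever the signs, since z ^ 2 <= x ^ 2 + y ^ 2 there. *)
pose c := normal_peak (1 : R) * expR (- (x ^+ 2 + y ^+ 2) / (1 ^+ 2 *+ 2)).
have c0 : 0 < c by rewrite mulr_gt0 ?expR_gt0// normal_peak_gt0// oner_neq0.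
apply: (@lt_le_trans _ _ (c * (y - x))); first by rewrite mulr_gt0// subr_gt0.
rewrite -lee_fin fineK ?fin_num_measure//.
apply: (@le_trans _ _ (\int[mu]_(z in `]x, y]) c%:E)%E).
  by rewrite integral_cst//= lebesgue_measure_itv/= lte_fin xy -EFinD -EFinM.
apply: ge0_le_integral => //.
- by move=> z _; rewrite lee_fin ltW.
- apply/measurable_EFinP/measurable_funTS; exact: measurable_normal_pdf.
- move=> z; rewrite /= in_itv/= => /andP[xz zy]; rewrite lee_fin.
  rewrite normal_pdf0E ?oner_neq0// ler_wpM2l ?normal_peak_ge0// ler_expR.
  rewrite ler_wpM2r ?invr_ge0 ?mulrn_wge0 ?exprn_ge0// lerN2.
  have [z0|z0] := leP 0 z.
    apply: (@le_trans _ _ (y ^+ 2)); last by rewrite lerDr sqr_ge0.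
    by rewrite lerXn2r ?nnegrE// (le_trans z0).
  apply: (@le_trans _ _ (x ^+ 2)); last by rewrite lerDl sqr_ge0.
  by rewrite -[leLHS]sqrrN -[leRHS]sqrrN lerXn2r ?nnegrE ?oppr_ge0 ?lerN2 ?ltW// (lt_trans xz).
Qed.

Lemma barPhi_lt x y : x < y -> barPhi y < barPhi x.
Proof. by move=> /std_normal_cdf_lt; rewrite /barPhi ltrD2l ltrN2. Qed.

Lemma barPhi_le x y : (barPhi y <= barPhi x) = (x <= y).
Proof.
apply/idP/idP => [|]; first by rewrite leNgt => /negP h; rewrite leNgt; apply/negP => /barPhi_lt.
by rewrite le_eqVlt => /predU1P[->//|/barPhi_lt/ltW].
Qed.

Lemma measurable_barPhi : measurable_fun setT (@barPhi R).
Proof.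
apply: nonincreasing_measurable => //.
by move=> x y xy; rewrite barPhi_le.
Qed.

Lemma continuous_barPhi : continuous (@barPhi R).
Proof.
move=> x; apply/cvgrPdist_le => e e0.
have pk : 0 < normal_peak (1 : R) by rewrite normal_peak_gt0// oner_neq0.
near=> y.
have lip (u v : R) : u <= v -> `|barPhi u - barPhi v| <= normal_peak 1 * (v - u).
  move=> uv; rewrite /barPhi opprB addrC addrA subrK ger0_norm.
    exact: std_normal_cdf_lip.
  by rewrite subr_ge0; have := barPhi_le u v; rewrite uv /barPhi; lra.
have : `|barPhi x - barPhi y| <= normal_peak 1 * `|x - y|.
  have [xy|yx] := leP x y.
    by rewrite (distrC x y) (ger0_norm (_ : 0 <= y - x)) ?subr_ge0// lip.
  by rewrite distrC (ger0_norm (_ : 0 <= x - y)) ?subr_ge0 ?(ltW yx)// lip// ltW.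
move=> /le_trans; apply; rewrite mulrC -ler_pdivlMr//; near: y.
by apply: cvgr_dist_le => //; rewrite divr_gt0.
Unshelve. all: by end_near. Qed.

Lemma barPhi_ge0 x : 0 <= barPhi x.
Proof. by rewrite /barPhi subr_ge0 fineP_le1. Qed.

Lemma barPhi_gt0 x : 0 < barPhi x.
Proof.
by apply: (le_lt_trans (barPhi_ge0 (x + 1))); apply: barPhi_lt; rewrite ltrDl.
Qed.

Lemma barPhiE x : barPhi x = fine (N01 [set y | x <= y]).
Proof.
have -> : [set y | x <= y] = [set x] `|` ~` `]-oo, x]%classic.
  apply/seteqP; split => y /=; rewrite in_itv/=.
    by case: (ltgtP x y) => // [xy _|->]; [right|left].
  by move=> [->//|/negP]; rewrite -ltNge => /ltW.
rewrite measureU//; last 2 first.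
- exact: measurableC.
- by apply/seteqP; split => y //= [->]; rewrite in_itv/= lexx.
have := normal_prob_set1 0 1 x; rewrite /= => ->; rewrite add0e.
by rewrite fineP_setC.
Qed.

Lemma barPhi_surj t : 0 < t < 1 -> exists x, barPhi x = t.
Proof.
move=> /andP[t0 t1].
pose e := Num.min t (1 - t).
have e0 : 0 < e by rewrite lt_min t0 subr_gt0.
have mid : measurable_fun [set: R] (fun x : R => x) by exact: measurable_id.
have [n _ /(_ n (leqnn n)) h] := tail_vanishes N01 mid e0.
have hn : barPhi n%:R <= t.
  apply: (@le_trans _ _ e); last by rewrite ge_min lexx.
  apply: le_trans h; rewrite barPhiE; apply: fineP_le.
  - exact: measurable_ge_cst.
  - exact: measurable_ge_norm.
  - by move=> y /= /le_trans; apply; exact: ler_norm.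
have hl : t <= barPhi (- n%:R).
  have : 1 - barPhi (- n%:R) <= 1 - t.
    apply: (@le_trans _ _ e); last by rewrite ge_min lexx orbT.
    apply: le_trans h; rewrite /barPhi opprB addrC subrK; apply: fineP_le => //.
    - exact: measurable_ge_norm.
    - move=> y /=; rewrite in_itv/= => yn.
      by rewrite -normrN (le_trans _ (ler_norm _))// lerNr.
  by lra.
have nn : - n%:R <= n%:R :> R by rewrite (@le_trans _ _ 0)// oppr_le0.
have [||c _ cE] := @IVT R (@barPhi R) (- n%:R) n%:R t nn.
- exact: continuous_subspaceT continuous_barPhi.
- by rewrite ge_min hn orbT/= le_max hl.
- by exists c.
Qed.

Lemma barPhi_inv_barPhi x : barPhi_inv (barPhi x) = x%:E.
Proof.
rewrite /barPhi_inv; apply/eqP; rewrite eq_le; apply/andP; split.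
  by apply: ereal_inf_lbound; exists x => /=.
by apply: le_ereal_inf_tmp => _ [y /= h <-]; rewrite lee_fin -barPhi_le.
Qed.

End standard_normal_cdf.

Section gaussian_laws.
Context {R : realType}.
Local Notation N01 := (normal_prob (0 : R) 1).

(** The law of [Y] is given only through its values on measurable sets, so the expectation passes
    through the image measure. The formula remains right for the point mass v = 0. *)
Lemma Ex_cos_law d (T : measurableType d) (P : probability T R) (Y : T -> R)
    (v t c : R) : 0 <= v -> measurable_fun setT Y ->
  (forall A, measurable A -> P (Y @^-1` A) = centered_normal v A) ->
  Ex P (fun z => cos (t * Y z + c)) = expR (- (v * t ^+ 2 / 2)) * cos c.
Proof.
move=> v0 mY law.
have ml : measurable_fun setT (fun x : R => t * x + c).
  by apply: measurable_funD => //; exact: measurable_funM.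
have mcos : measurable_fun setT (fun x : R => (cos (t * x + c))%:E).
  by apply/measurable_EFinP; exact: bmf_meas (bmf_cos ml).
pose Y' := @mfun_Sub _ _ T (measurableTypeR R) Y (mem_set mY).
have E : \int[P]_z cos (t * Y z + c) =
    fine (\int[distribution P Y']_x (cos (t * x + c))%:E).
  rewrite integral_distribution//.
  have := bmf_integrable P (bmf_cos (measurableT_comp ml mY)); exact.
rewrite /Ex E.
have [v_eq0|v_neq0] := eqVneq v 0.
  rewrite (eq_measure_integral (dirac (0 : measurableTypeR R))); last first.
    move=> A mA _; rewrite /distribution/= /pushforward.
    by have := law A mA; rewrite /centered_normal v_eq0 eqxx.
  rewrite integral_dirac// diracT mul1e/= mulr0 add0r v_eq0 mul0r mul0r oppr0.
  by rewrite expR0 mul1r.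
have -> : (\int[distribution P Y']_x (cos (t * x + c))%:E =
    \int[normal_prob 0 (Num.sqrt v)]_x (cos (t * x + c))%:E)%E.
  apply: eq_measure_integral => A mA _; rewrite /distribution/= /pushforward.
  by have := law A mA; rewrite /centered_normal (negbTE v_neq0).
have vp : 0 < v by rewrite lt_neqAle eq_sym v_neq0.
rewrite -[fine _]/(Ex (normal_prob 0 (Num.sqrt v)) (fun x => cos (t * x + c))).
by rewrite Ex_cos_normal ?sqrtr_gt0// sqr_sqrtr.
Qed.

Lemma Ex_prod d1 d2 (T1 : measurableType d1) (T2 : measurableType d2)
    (P1 : probability T1 R) (P2 : probability T2 R) (f : T1 * T2 -> R) :
  bmf f -> Ex (P1 \x P2)%E f = Ex P1 (fun x => Ex P2 (fun y => f (x, y))).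
Proof.
move=> bf; have := integral12_prod_meas1 (bmf_integrable (P1 \x P2)%E bf).
rewrite /Ex /Rintegral /= => <-; congr fine; apply: eq_integral => x _.
rewrite /fubini_F fineK//; apply: integrable_fin_num => //.
have [mf [M fM]] := bf.
have b2 : bmf (fun y => f (x, y)).
  split; last by exists M.
  by apply: measurableT_comp mf _; exact: pair1_measurable.
exact: bmf_integrable b2.
Qed.

Lemma Ex_cos_prod_normal (r s t c : R) : r ^+ 2 <= 1 ->
  Ex (N01 \x N01)%E
    (fun z => cos (s * z.1 + t * (r * z.1 + Num.sqrt (1 - r ^+ 2) * z.2) + c)) =
  expR (- ((s ^+ 2 + t ^+ 2 + 2 * (s * t * r)) / 2)) * cos c.
Proof.
move=> r1; set k := Num.sqrt _.
have k2 : k ^+ 2 = 1 - r ^+ 2 by rewrite sqr_sqrtr// subr_ge0.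
have m1 := @measurable_fst _ _ (measurableTypeR R) (measurableTypeR R).
have m2 := @measurable_snd _ _ (measurableTypeR R) (measurableTypeR R).
rewrite Ex_prod; last first.
  apply: bmf_cos; apply: measurable_funD => //; apply: measurable_funD.
    exact: measurable_funM.
  by apply: measurable_funM => //; apply: measurable_funD; apply: measurable_funM.
transitivity (Ex N01 (fun x => expR (- (1 ^+ 2 * (t * k) ^+ 2 / 2)) *
    cos ((s + t * r) * x + c))).
  apply: eq_Ex => x; rewrite -Ex_cos_normal//.
  by apply: eq_Ex => y /=; congr (cos _); ring.
rewrite ExZ; last first.
  apply: bmf_cos; apply: measurable_funD => //; exact: measurable_funM.
rewrite Ex_cos_normal// mulrA -expRD; congr (expR _ * _).
by rewrite exprMn k2; field.
Qed.

End gaussian_laws.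

(** Replacing 1 - a_j by exp (- a_j) costs 2 a_j ^ 2 when |a_j| <= 1 / 2. The factors may exceed 1,
    but each amplifies the accumulated error by at most exp b, which explains exp (m b). *)
Lemma exp_recursion (R : realType) (g a : nat -> R) (err b : R) m :
  (forall j, `|g j.+1 - (1 - a j) * g j| <= err) ->
  (forall j, `|a j| <= b) -> b <= 1 / 2 -> (forall j, `|g j| <= 1) ->
  `|g m - expR (- \sum_(j < m) a j) * g 0%N| <=
    m%:R * expR (m%:R * b) * (err + 2 * b ^+ 2).
Proof.
move=> rec ab b1 g1.
have b0 : 0 <= b by exact: le_trans (ab 0%N).
have err0 : 0 <= err by exact: le_trans (rec 0%N).
have exp_quad (x : R) : `|x| <= 1 / 2 -> `|1 - x - expR (- x)| <= 2 * x ^+ 2.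
  rewrite ler_norml => /andP[x1 x2].
  have h1 := expR_ge1Dx (- x); have h2 := expR_ge1Dx x.
  rewrite distrC ger0_norm; last by lra.
  have : expR (- x) * (1 + x) <= 1.
    by rewrite -[leRHS](expRxMexpNx_1 x) mulrC ler_wpM2r// expR_ge0.
  have := sqr_ge0 x.
  move: (expR _) => y x0 h3.
  have : (1 + x) * (1 - x + 2 * x ^+ 2) >= 1.
    have -> : (1 + x) * (1 - x + 2 * x ^+ 2) = 1 + x ^+ 2 * (1 + 2 * x) by ring.
    by rewrite lerDl mulr_ge0//; lra.
  move=> h4.
  have h5 : y <= 1 - x + 2 * x ^+ 2.
    rewrite -(@ler_pM2r _ (1 + x)); last by lra.
    by rewrite [leRHS]mulrC; exact: le_trans h4.
  by lra.
elim: m => [|m IHm].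
  by rewrite big_ord0 oppr0 expR0 mul1r subrr normr0 !mul0r.
rewrite big_ord_recr/= opprD expRD.
set A := \sum_(j < m) a j in IHm *.
set c := err + 2 * b ^+ 2 in IHm *.
have c0 : 0 <= c by rewrite addr_ge0// mulr_ge0// sqr_ge0.
rewrite (_ : _ - _ = (g m.+1 - (1 - a m) * g m) + (1 - a m - expR (- a m)) * g m +
  expR (- a m) * (g m - expR (- A) * g 0%N)); last by ring.
have am := ab m.
have am2 : a m ^+ 2 <= b ^+ 2.
  by rewrite -[leLHS]real_normK ?num_real// lerXn2r ?nnegrE.
have e1 : `|(1 - a m - expR (- a m)) * g m| <= 2 * b ^+ 2.
  rewrite normrM; apply: (@le_trans _ _ (2 * a m ^+ 2)); last by rewrite ler_wpM2l.
  have h := exp_quad (a m) (le_trans am b1).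
  by apply: le_trans h; rewrite ler_piMr.
have e2 : expR (- a m) <= expR b.
  by rewrite ler_expR; move: am; rewrite ler_norml; lra.
have e3 : `|expR (- a m) * (g m - expR (- A) * g 0%N)| <=
    expR b * (m%:R * expR (m%:R * b) * c).
  by rewrite normrM ler_pM// ger0_norm ?expR_ge0.
have Sm : m.+1%:R * b = b + m%:R * b by rewrite -natr1 mulrDl mul1r addrC.
rewrite Sm expRD -natr1.
apply: (@le_trans _ _ (c + expR b * (m%:R * expR (m%:R * b) * c))).
  apply: (le_trans (ler_normD _ _)); apply: lerD => //.
  by apply: (le_trans (ler_normD _ _)); exact: lerD.
rewrite [leRHS](_ : _ = expR b * (m%:R * expR (m%:R * b) * c) +
  expR b * expR (m%:R * b) * c); last by ring.
rewrite addrC lerD2l ler_peMl// -expRD -expR0 ler_expR.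
by rewrite addr_ge0// mulr_ge0.
Qed.

(** * Covariances and sums under mixing *)

Section covariance_inequality.
Context {d : measure_display} {T : measurableType d} {R : realType}.
Variable P : probability T R.
Implicit Types (f g : T -> R).

Definition cov f g : R := Ex P (fun x => f x * g x) - Ex P f * Ex P g.

Lemma covC f g : cov f g = cov g f.
Proof.
by rewrite /cov mulrC; congr (_ - _); apply: eq_Ex => x; rewrite mulrC.
Qed.

Lemma covDl f1 f2 g : bmf f1 -> bmf f2 -> bmf g ->
  cov (fun x => f1 x + f2 x) g = cov f1 g + cov f2 g.
Proof.
move=> b1 b2 bg; rewrite /cov ExD//.
rewrite (@eq_Ex _ _ _ P _ (fun x => f1 x * g x + f2 x * g x)); last first.
  by move=> x; rewrite mulrDl.
by rewrite ExD; [ring|exact: bmfM..].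
Qed.

Lemma covZl a f g : bmf f -> bmf g -> cov (fun x => a * f x) g = a * cov f g.
Proof.
move=> bf bg; rewrite /cov ExZ//.
rewrite (@eq_Ex _ _ _ P _ (fun x => a * (f x * g x))); last first.
  by move=> x; rewrite mulrA.
by rewrite ExZ; [ring|exact: bmfM].
Qed.

Lemma cov_cst a g : bmf g -> cov (fun=> a) g = 0.
Proof. by move=> bg; rewrite /cov ExZ// Ex_cst subrr. Qed.

Lemma cov_suml (I : Type) (r : seq I) (p : pred I) (F : I -> T -> R) g :
  (forall i, bmf (F i)) -> bmf g ->
  cov (fun x => \sum_(i <- r | p i) F i x) g = \sum_(i <- r | p i) cov (F i) g.
Proof.
move=> bF bg; elim: r => [|i r IHr].
  rewrite big_nil -[RHS](cov_cst 0 bg) /cov; congr (_ - _ * _).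
    by apply: eq_Ex => x; rewrite big_nil.
  by apply: eq_Ex => x; rewrite big_nil.
rewrite big_cons.
rewrite (_ : (fun x => _) = (fun x => if p i then F i x + \sum_(i <- r | p i) F i x
    else \sum_(i <- r | p i) F i x)); last first.
  by apply/funext => x; rewrite big_cons.
by case: (p i); rewrite // covDl// ?IHr//; exact: bmf_sum.
Qed.

(** The sum counts the positive integers up to y, so it is the integer part of y. *)
Lemma sum_thresholds (y : R) N : 0 <= y <= N%:R ->
  y - 1 <= \sum_(k < N) (k.+1%:R <= y)%R%:R <= y.
Proof.
elim: N => [|N IHN] /andP[y0 yN]; first by rewrite big_ord0; lra.
have full n : n%:R <= y -> \sum_(k < n) (k.+1%:R <= y)%R%:R = n%:R :> R.
  move=> ny; rewrite (eq_bigr (fun=> 1)); last first.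
    move=> k _; rewrite (_ : (_ <= y)) ?mulr1n//.
    by apply: le_trans ny; rewrite ler_nat.
  by rewrite sumr_const card_ord.
rewrite big_ord_recr/=.
have [yN1|yN1] := leP N.+1%:R y.
  rewrite full; last by apply: le_trans yN1; rewrite ler_nat.
  by rewrite -natr1/=; move: yN yN1; rewrite -natr1; lra.
rewrite addr0; have [yN2|yN2] := leP y N%:R.
  by apply: IHN; rewrite y0 yN2.
by rewrite full ?ltW//; move: yN; rewrite -natr1; lra.
Qed.

Section thresholds.
Variables (G1 G2 : set (set T)).
Hypothesis sG1 : forall A, <<s G1 >> A -> measurable A.
Hypothesis sG2 : forall A, <<s G2 >> A -> measurable A.

Lemma bmf_sub (G : set (set T)) (f : T -> R) : (forall A, <<s G >> A -> measurable A) ->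
  @bmf _ (g_sigma_algebraType G) R f -> bmf f.
Proof.
move=> sG [mf [M fM]]; split; last by exists M.
by move=> _ B mB; apply: sG; exact: mf.
Qed.

(** A Riemann sum of the layer-cake formula for f with values in [0, 1]. It expresses f through
    events, to which the mixing condition applies. *)
Let quant (N : nat) f x := N%:R^-1 * \sum_(k < N) \1_[set z | k.+1%:R <= N%:R * f z] x : R.

Lemma quantP N f x : (0 < N)%N -> 0 <= f x <= 1 ->
  `|f x - quant N f x| <= N%:R^-1 /\ 0 <= quant N f x <= 1.
Proof.
move=> N0 /andP[f0 f1]; have N0' : 0 < N%:R :> R by rewrite ltr0n.
have h : 0 <= N%:R * f x <= N%:R by rewrite mulr_ge0 ?(ltW N0')//= ler_piMr// ltW.
have /andP[h1 h2] := sum_thresholds h.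
rewrite /quant.
have -> : \sum_(k < N) \1_[set z | k.+1%:R <= N%:R * f z] x =
    \sum_(k < N) (k.+1%:R <= N%:R * f x)%R%:R :> R.
  by apply: eq_bigr => k _; rewrite (indic_bool (fun z => k.+1%:R <= N%:R * f z)).
set s := \sum_(_ < _) _ in h1 h2 *.
have Nf : N%:R^-1 * (N%:R * f x) = f x by rewrite mulKf// gt_eqF.
have s0 : 0 <= s by apply: sumr_ge0 => k _; rewrite ler0n.
have V0 : 0 <= N%:R^-1 :> R by rewrite invr_ge0 ltW.
have a1 := ler_wpM2l V0 h1; have a2 := ler_wpM2l V0 h2.
rewrite mulrBr Nf mulr1 in a1; rewrite Nf in a2.
split; first by rewrite ger0_norm; lra.
by rewrite mulr_ge0//=; lra.
Qed.

(** The covariance of the two discretized functions is an average of N ^ 2 covariances of events {f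
    >= k / N} and {g >= l / N}, each at most [a]; discretization changes it by O(1 / N). *)
Lemma cov_indic_thresholds (a : R) f g :
  (forall A B, <<s G1 >> A -> <<s G2 >> B ->
     `|fine (P (A `&` B)) - fine (P A) * fine (P B)| <= a) ->
  @bmf _ (g_sigma_algebraType G1) R f -> @bmf _ (g_sigma_algebraType G2) R g ->
  (forall x, 0 <= f x <= 1) -> (forall x, 0 <= g x <= 1) ->
  `|cov f g| <= a.
Proof.
move=> mix bf bg f01 g01.
have a0 : 0 <= a.
  have e1 : <<s G1 >> set0 by exact: (@measurable0 _ (g_sigma_algebraType G1)).
  have e2 : <<s G2 >> set0 by exact: (@measurable0 _ (g_sigma_algebraType G2)).
  exact: le_trans (mix _ _ e1 e2).
have bfT := bmf_sub sG1 bf; have bgT := bmf_sub sG2 bg.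
apply/ler_addgt0Pr => e e0.
(* The mean of the product and the product of the means each move by at most 2 / N. *)
have [N Ne] : exists N : nat, 4 / e <= N%:R by exact: filter_ex (nbhs_infty_ger _).
have N0' : 0 < N%:R :> R by apply: lt_le_trans Ne; rewrite divr_gt0.
have N0 : (0 < N)%N by rewrite -(@ltr0n R).
have mA k : <<s G1 >> [set z | k.+1%:R <= N%:R * f z].
  have [mf _] := bf.
  have mN : measurable_fun setT (fun z : g_sigma_algebraType G1 => N%:R * f z).
    exact: measurable_funM.
  have := measurable_ge_cst k.+1%:R mN; exact.
have mB k : <<s G2 >> [set z | k.+1%:R <= N%:R * g z].
  have [mg _] := bg.
  have mN : measurable_fun setT (fun z : g_sigma_algebraType G2 => N%:R * g z).
    exact: measurable_funM.
  have := measurable_ge_cst k.+1%:R mN; exact.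
have bA k := @bmf_indic _ _ R _ (sG1 (mA k)).
have bB k := @bmf_indic _ _ R _ (sG2 (mB k)).
have bqf : bmf (quant N f) by apply: bmfZ; exact: bmf_sum.
have bqg : bmf (quant N g) by apply: bmfZ; exact: bmf_sum.
have cq : `|cov (quant N f) (quant N g)| <= a.
  rewrite covZl//; last exact: bmf_sum.
  rewrite cov_suml// normrM ger0_norm ?invr_ge0 ?(ltW N0')//.
  rewrite ler_pdivrMl//.
  apply: (le_trans (ler_norm_sum _ _ _)).
  rewrite -[X in X%:R * _]card_ord mulr_natl -sumr_const; apply: ler_sum => k _.
  rewrite covC covZl//; last exact: bmf_sum.
  rewrite cov_suml// normrM ger0_norm ?invr_ge0 ?(ltW N0')//.
  rewrite ler_pdivrMl//.
  apply: (le_trans (ler_norm_sum _ _ _)).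
  rewrite -[X in X%:R * _]card_ord mulr_natl -sumr_const; apply: ler_sum => l _.
  rewrite covC /cov !Ex_indic//; try exact: sG1; try exact: sG2.
  rewrite (@eq_Ex _ _ _ P _ (\1_([set z | k.+1%:R <= N%:R * f z] `&`
      [set z | l.+1%:R <= N%:R * g z]))); last first.
    by move=> x; rewrite !indicE in_setI -mulnb natrM.
  rewrite Ex_indic; last by apply: measurableI; [exact: sG1|exact: sG2].
  exact: mix.
have d1 x : `|f x * g x - quant N f x * quant N g x| <= 2 / N%:R.
  have [q1 q01] := quantP N0 (f01 x); have [q2 q02] := quantP N0 (g01 x).
  rewrite (_ : _ - _ = (f x - quant N f x) * g x + quant N f x * (g x - quant N g x));
    last by ring.
  rewrite (le_trans (ler_normD _ _))// (_ : 2 / N%:R = N%:R^-1 + N%:R^-1);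
    last by rewrite -mulr2n mulr_natl.
  apply: lerD.
    rewrite normrM (le_trans _ q1)// ler_piMr//.
    by have := g01 x; rewrite ler_norml; lra.
  rewrite normrM (le_trans _ q2)// ler_piMl//.
  by rewrite ler_norml; lra.
have d2 : `|Ex P f * Ex P g - Ex P (quant N f) * Ex P (quant N g)| <= 2 / N%:R.
  have e1 : `|Ex P f - Ex P (quant N f)| <= N%:R^-1.
    by apply: Ex_dist => // x; have [] := quantP N0 (f01 x).
  have e2 : `|Ex P g - Ex P (quant N g)| <= N%:R^-1.
    by apply: Ex_dist => // x; have [] := quantP N0 (g01 x).
  have e3 : `|Ex P g| <= 1.
    by apply: Ex_bound => // x; have := g01 x; rewrite ler_norml; lra.
  have e4 : `|Ex P (quant N f)| <= 1.
    apply: Ex_bound => // x; have [_] := quantP N0 (f01 x).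
    by rewrite ler_norml; lra.
  rewrite (_ : _ - _ = (Ex P f - Ex P (quant N f)) * Ex P g +
    Ex P (quant N f) * (Ex P g - Ex P (quant N g))); last by ring.
  rewrite (le_trans (ler_normD _ _))// (_ : 2 / N%:R = N%:R^-1 + N%:R^-1);
    last by rewrite -mulr2n mulr_natl.
  apply: lerD.
    by rewrite normrM (le_trans _ e1)// ler_piMr.
  by rewrite normrM (le_trans _ e2)// ler_piMl.
have d3 := Ex_dist P (bmfM bfT bgT) (bmfM bqf bqg) d1.
have N4 : 2 / N%:R + 2 / N%:R <= e.
  by rewrite -mulrDl ler_pdivrMr// mulrC -ler_pdivrMr// -natrD.
have -> : cov f g = cov (quant N f) (quant N g) +
    ((Ex P (fun x => f x * g x) - Ex P (fun x => quant N f x * quant N g x)) -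
    (Ex P f * Ex P g - Ex P (quant N f) * Ex P (quant N g))).
  by rewrite /cov; ring.
apply: (le_trans (ler_normD _ _)); apply: lerD => //.
apply: (le_trans (ler_normB _ _)); apply: le_trans N4.
exact: lerD.
Qed.

(** An affine map carries [-A, A] to [0, 1] and divides by 2 A, and likewise for [B]; hence the
    factor 4 A B. Zero bounds are treated apart because of these divisions. *)
Lemma cov_mixing (a A B : R) f g :
  (forall A B, <<s G1 >> A -> <<s G2 >> B ->
     `|fine (P (A `&` B)) - fine (P A) * fine (P B)| <= a) ->
  @bmf _ (g_sigma_algebraType G1) R f -> @bmf _ (g_sigma_algebraType G2) R g ->
  (forall x, `|f x| <= A) -> (forall x, `|g x| <= B) ->
  `|cov f g| <= 4 * A * B * a.
Proof.
move=> mix bf bg fA gB.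
have bfT := bmf_sub sG1 bf; have bgT := bmf_sub sG2 bg.
have A0 : 0 <= A by exact: le_trans (fA point).
have B0 : 0 <= B by exact: le_trans (gB point).
have zero (h : T -> R) : (forall x, `|h x| <= 0) -> h = fun=> 0.
  by move=> h0; apply/funext => x; apply/eqP; rewrite -normr_le0.
move: A0 B0; rewrite le_eqVlt => /predU1P[A0 B0|A0].
  have -> : f = (fun=> 0) by apply: zero => x; rewrite A0.
  by rewrite cov_cst// normr0 -A0 mulr0 !mul0r.
rewrite le_eqVlt => /predU1P[B0|B0].
  have -> : g = (fun=> 0) by apply: zero => x; rewrite B0.
  by rewrite covC cov_cst// normr0 -B0 mulr0 !mul0r.
pose f' x := (2 * A)^-1 * (f x + A); pose g' x := (2 * B)^-1 * (g x + B).
have b1 (G : set (set T)) (h : T -> R) (C : R) : @bmf _ (g_sigma_algebraType G) R h ->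
    @bmf _ (g_sigma_algebraType G) R (fun x => (2 * C)^-1 * (h x + C)).
  by move=> bh; apply: bmfZ; apply: bmfD => //; exact: bmf_cst.
have r1 (h : T -> R) (C : R) : 0 < C -> (forall x, `|h x| <= C) ->
    forall x, 0 <= (2 * C)^-1 * (h x + C) <= 1.
  move=> C0 hC x; have := hC x; rewrite ler_norml => /andP[h1 h2].
  rewrite mulr_ge0 ?invr_ge0//=; [|by lra|by lra].
  by rewrite ler_pdivrMl ?mulr_gt0//; lra.
have := cov_indic_thresholds mix (b1 _ _ A bf) (b1 _ _ B bg) (r1 _ _ A0 fA) (r1 _ _ B0 gB).
have -> : cov f g = 4 * A * B * cov f' g'.
  have bf' : bmf (fun x => f x + A) by apply: bmfD => //; exact: bmf_cst.
  have bg' : bmf (fun x => g x + B) by apply: bmfD => //; exact: bmf_cst.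
  have bg2 : bmf g' by exact: bmfZ.
  rewrite /f' covZl// covDl//; last exact: bmf_cst.
  rewrite cov_cst// addr0 (covC f g') /g' covZl// covDl//; last exact: bmf_cst.
  rewrite cov_cst// addr0 (covC g f).
  by field; rewrite !gt_eqF.
rewrite !normrM (gtr0_norm A0) (gtr0_norm B0) (gtr0_norm (_ : 0 < 4))//.
by move=> h; rewrite ler_wpM2l// !mulr_ge0// ltW.
Qed.

End thresholds.

End covariance_inequality.

(* past n and future l stand for the sigma-algebras generated by the coordinates
   of index at most n, respectively at least l, numbered from 1; index n = 0 is
   the trivial sigma-algebra, whence the first disjunct in the mixing condition. *)
Section mixing_clt.
Context {d : measure_display} {T : measurableType d} {R : realType}.
Variable P : probability T R.
Variables (past future : nat -> set (set T)) (al tau : nat -> R).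
Hypothesis past_meas : forall n A, <<s past n >> A -> measurable A.
Hypothesis future_meas : forall n A, <<s future n >> A -> measurable A.
Hypothesis past_mono : forall n n', (n <= n')%N -> past n `<=` past n'.
Hypothesis future_mono : forall n n', (n <= n')%N -> future n' `<=` future n.
Hypothesis mixing : forall s n l A B, (0 < s)%N -> (n == 0)%N || (n + s <= l)%N ->
  <<s past n >> A -> <<s future l >> B ->
  `|fine (P (A `&` B)) - fine (P A) * fine (P B)| <= al s.
Hypothesis al_sum : forall j s, \sum_(i < j - s) al (j - i)%N <= tau s.
Hypothesis al_ge0 : forall s, 0 <= al s.
Variables (X : nat -> T -> R) (K : R).
Hypothesis X_bound : forall i x, `|X i x| <= K.
Hypothesis X_past : forall i, @bmf _ (g_sigma_algebraType (past i.+1)) R (X i).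
Hypothesis X_future : forall i, @bmf _ (g_sigma_algebraType (future i.+1)) R (X i).
Hypothesis X_centered : forall i, Ex P (X i) = 0.

Local Notation pbmf n := (@bmf _ (g_sigma_algebraType (past n)) R).
Local Notation fbmf n := (@bmf _ (g_sigma_algebraType (future n)) R).

Definition psum n x := \sum_(i < n) X i x.

Lemma bmf_smono (G G' : set (set T)) (f : T -> R) : G `<=` G' ->
  @bmf _ (g_sigma_algebraType G) R f -> @bmf _ (g_sigma_algebraType G') R f.
Proof.
move=> GG' [mf bf]; split=> // mT B mB.
have := mf measurableT B mB; apply: sub_smallest2r => //; exact: smallest_sigma_algebra.
Qed.

Lemma pbmf_mono n n' f : (n <= n')%N -> pbmf n f -> pbmf n' f.
Proof. by move=> nn'; apply: bmf_smono; exact: past_mono. Qed.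

Lemma fbmf_mono n n' f : (n <= n')%N -> fbmf n' f -> fbmf n f.
Proof. by move=> nn'; apply: bmf_smono; exact: future_mono. Qed.

Lemma pbmf_bmf n (f : T -> R) : pbmf n f -> bmf f.
Proof. by move=> bf; exact: bmf_sub (@past_meas n) bf. Qed.

Lemma bmfXi i : bmf (X i). Proof. exact: pbmf_bmf (X_past i). Qed.

Lemma K_ge0 : 0 <= K. Proof. exact: le_trans (X_bound 0 point). Qed.

Lemma pbmf_psum n : pbmf n (psum n).
Proof.
rewrite (_ : psum n = fun x => \sum_(i < n) X (val i) x)//.
apply: bmf_sum => i; apply: pbmf_mono (X_past i); exact: ltn_ord.
Qed.

Lemma bmf_psum n : bmf (psum n). Proof. exact: pbmf_bmf (@pbmf_psum n). Qed.

Lemma psumS n x : psum n.+1 x = psum n x + X n x.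
Proof. by rewrite /psum big_ord_recr. Qed.

Lemma psumB j s x : psum j x - psum (j - s) x = \sum_(j - s <= i < j) X i x.
Proof.
rewrite /psum -!(big_mkord xpredT (X ^~ x)).
by apply/eqP; rewrite subr_eq addrC -big_cat_nat//= leq_subr.
Qed.

Lemma fbmf_psumB j s l : (l <= (j - s).+1)%N ->
  fbmf l (fun x => psum j x - psum (j - s) x).
Proof.
move=> ls; rewrite (_ : (fun x => _) = fun x => \sum_(j - s <= i < j) X i x);
  last by apply/funext => x; exact: psumB.
rewrite -(add0n (j - s)%N); under [X in fbmf _ X]eq_fun do rewrite big_addn.
apply: bmf_sum => i; apply: fbmf_mono (X_future _).
by rewrite (leq_trans ls)// ltnS leq_addl.
Qed.

Lemma psumB_bound j s x : `|psum j x - psum (j - s) x| <= s%:R * K.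
Proof.
rewrite psumB (le_trans (ler_norm_sum _ _ _))//.
apply: (@le_trans _ _ (\sum_(j - s <= i < j) K)).
  by apply: ler_sum => i _; exact: X_bound.
rewrite sumr_const_nat -[leLHS]mulr_natl ler_wpM2r ?K_ge0// ler_nat.
by rewrite leq_subLR addnC -leq_subLR.
Qed.

Lemma cov_past_future s n l f g A B : (0 < s)%N -> (n == 0)%N || (n + s <= l)%N ->
  pbmf n f -> fbmf l g -> (forall x, `|f x| <= A) -> (forall x, `|g x| <= B) ->
  `|cov P f g| <= 4 * A * B * al s.
Proof.
move=> s0 nsl bf bg; apply: (cov_mixing (@past_meas n) (@future_meas l)) => // A' B'.
exact: mixing.
Qed.

Lemma X_cov i j : (i < j)%N -> `|Ex P (fun x => X i x * X j x)| <= 4 * K ^+ 2 * al (j - i).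
Proof.
move=> ij; have := @cov_past_future (j - i) i.+1 j.+1 (X i) (X j) K K.
rewrite subn_gt0 ij addSn subnKC ?(ltnW ij)// leqnn orbT.
move=> /(_ isT isT (X_past i) (X_future j) (X_bound i) (X_bound j)).
by rewrite /cov X_centered mul0r subr0 expr2 !mulrA.
Qed.

Lemma psum_X_cov s j :
  `|Ex P (fun x => psum (j - s) x * X j x)| <= 4 * K ^+ 2 * tau s.
Proof.
rewrite (@eq_Ex _ _ _ P _ (fun x => \sum_(i < j - s) (X i x * X j x))); last first.
  by move=> x; rewrite /psum mulr_suml.
rewrite Ex_sum; last by move=> i; apply: bmfM; exact: bmfXi.
apply: (le_trans (ler_norm_sum _ _ _)).
apply: (@le_trans _ _ (\sum_(i < j - s) 4 * K ^+ 2 * al (j - i))).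
  apply: ler_sum => i _; apply: X_cov.
  by apply: leq_trans (ltn_ord i) _; exact: leq_subr.
by rewrite -mulr_sumr ler_wpM2l// mulr_ge0// sqr_ge0.
Qed.

(** The increase of the variance of the partial sum caused by [X j], with only the covariances at
    lags at most [s] retained. *)
Definition local_var s j : R :=
  Ex P (fun x => (2 * (psum j x - psum (j - s) x) + X j x) * X j x).

Lemma local_varE s j : local_var s j =
  Ex P (fun x => psum j.+1 x ^+ 2) - Ex P (fun x => psum j x ^+ 2) -
  2 * Ex P (fun x => psum (j - s) x * X j x).
Proof.
have b1 := bmf_psum j; have b2 := bmf_psum (j - s); have b3 := bmfXi j.
have b4 := bmf_psum j.+1.
rewrite -ExB; [|exact: bmfX..].
rewrite -ExZ; last exact: bmfM.
rewrite -ExB; last 2 first.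
- by apply: bmfB; exact: bmfX.
- by apply: bmfZ; exact: bmfM.
by apply: eq_Ex => x; rewrite psumS; ring.
Qed.

(** By [local_varE] the sum telescopes to the second moment, except for the covariances at lags
    beyond [s], which cost 2 * 4 K ^ 2 tau(s) for each index. *)
Lemma sum_local_var s m :
  `|\sum_(j < m) local_var s j - Ex P (fun x => psum m x ^+ 2)| <=
  m%:R * (8 * K ^+ 2 * tau s).
Proof.
elim: m => [|m IHm].
  rewrite big_ord0 mul0r (@eq_Ex _ _ _ P _ (fun=> 0)) ?Ex_cst ?subr0 ?normr0//.
  by move=> x; rewrite /psum big_ord0 expr0n.
rewrite big_ord_recr/= local_varE.
have := psum_X_cov s m; set e := Ex P _ => h.
rewrite (_ : _ + _ - _ = (\sum_(j < m) local_var s j - Ex P (fun x => psum m x ^+ 2))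
   - 2 * e); last by ring.
apply: (le_trans (ler_normB _ _)).
have -> (c : R) : m.+1%:R * c = m%:R * c + c by rewrite -natr1 mulrDl mul1r.
rewrite lerD// normrM ger0_norm//.
by rewrite (_ : 8 = 2 * 4)// -?natrM//; lra.
Qed.

(** K ^ 2 for the square, plus twice the bound 4 K ^ 2 al summed over all lags. It does not depend
    on the gap [s], which will grow with m. *)
Definition vmax := K ^+ 2 * (1 + 8 * tau 0).

Lemma local_var_bound s j : `|local_var s j| <= vmax.
Proof.
rewrite /local_var.
have b1 := bmf_psum j; have b2 := bmf_psum (j - s); have b3 := bmfXi j.
rewrite (@eq_Ex _ _ _ P _ (fun x => X j x ^+ 2 +
    \sum_(j - s <= i < j) 2 * (X i x * X j x))); last first.
  by move=> x; rewrite psumB -mulr_sumr -mulr_suml; ring.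
rewrite ExD; last 2 first.
- exact: bmfX.
- by apply: bmf_sum => i; apply: bmfZ; apply: bmfM; exact: bmfXi.
rewrite /vmax mulrDr mulr1; apply: (le_trans (ler_normD _ _)); apply: lerD.
  apply: Ex_bound => [|x]; first exact: bmfX.
  by rewrite normrX lerXn2r ?nnegrE ?K_ge0.
rewrite Ex_sum; last by move=> i; apply: bmfZ; apply: bmfM; exact: bmfXi.
apply: (le_trans (ler_norm_sum _ _ _)).
apply: (@le_trans _ _ (\sum_(j - s <= i < j) 8 * K ^+ 2 * al (j - i))).
  rewrite big_nat_cond [leRHS]big_nat_cond; apply: ler_sum => i /andP[/andP[_ ij] _].
  rewrite ExZ; last by apply: bmfM; exact: bmfXi.
  by rewrite normrM ger0_norm//; have := X_cov ij; lra.
have c0 : 0 <= 8 * K ^+ 2 by apply: mulr_ge0 => //; exact: sqr_ge0.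
rewrite -mulr_sumr [leRHS]mulrCA [leRHS]mulrA ler_wpM2l//.
apply: le_trans (al_sum j 0); rewrite subn0.
rewrite -(big_mkord xpredT (fun i => al (j - i)%N)).
rewrite [leRHS](@big_cat_nat _ _ _ (j - s))//= ?leq_subr//.
by rewrite lerDr sumr_ge0.
Qed.

(** Expand to second order at [S], then move the sine of the first-order term back to [S'], which
    produces the cross term Y D, and freeze the second-order cosines at [U]. Across a gap of [s],
    the centred [Y] decouples from the sine at [S'] and its term nearly vanishes, while [A], a
    function of indices from j - s on, decouples from [U]; its mean is half of [local_var]. Freezing
    at [U] rather than [S'] is what leaves a gap between the cosine and [A]. *)
Lemma cos_recursion (t c : R) s j : (0 < s)%N ->
  `|Ex P (fun x => cos (t * psum j.+1 x + c)) -
    (1 - t ^+ 2 * local_var s j / 2) * Ex P (fun x => cos (t * psum j x + c))| <=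
  `|t| ^+ 3 * (4 * s%:R ^+ 2 * K ^+ 3 + s%:R * K * vmax) +
  (4 * `|t| * K + 8 * t ^+ 2 * s%:R * K ^+ 2) * al s.
Proof.
move=> s0.
pose S := psum j; pose S' := psum (j - s); pose U := psum (j - s - s).
pose D x := S x - S' x; pose Y := X j.
have K0 := K_ge0; have s1 : 1 <= s%:R :> R by rewrite ler1n.
have bS : bmf S := bmf_psum j; have bS' : bmf S' := bmf_psum (j - s).
have bU : bmf U := bmf_psum (j - s - s).
have bY : bmf Y := bmfXi j; have bD : bmf D by exact: bmfB.
have DK x : `|D x| <= s%:R * K := psumB_bound j s x.
have WK x : `|S' x - U x| <= s%:R * K := psumB_bound (j - s) s x.
have YK x : `|Y x| <= K := X_bound j x.
have mlin (f : T -> R) : bmf f -> measurable_fun setT (fun x => t * f x + c).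
  by case=> mf _; apply: measurable_funD => //; exact: measurable_funM.
have bc (f : T -> R) : bmf f -> bmf (fun x => cos (t * f x + c)).
  by move=> bf; apply: bmf_cos; exact: mlin.
have bs (f : T -> R) : bmf f -> bmf (fun x => sin (t * f x + c)).
  by move=> bf; apply: bmf_sin; exact: mlin.
pose A x := Y x * D x + Y x ^+ 2 / 2.
have bA : bmf A.
  apply: bmfD; first exact: bmfM.
  by under [X in bmf X]eq_fun do rewrite mulrC; apply: bmfZ; exact: bmfX.
pose T1 := `|t|.
have T0 : 0 <= T1 by exact: normr_ge0.
have AK x : `|A x| <= 2 * s%:R * K ^+ 2.
  apply: (le_trans (ler_normD _ _)); rewrite normrM normrM normrX.
  rewrite (ger0_norm (_ : 0 <= 2^-1))//.
  have h1 : `|Y x| * `|D x| <= K * (s%:R * K) by rewrite ler_pM.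
  have h2 : `|Y x| ^+ 2 <= K ^+ 2 by rewrite lerXn2r ?nnegrE.
  have h3 : K ^+ 2 <= s%:R * K ^+ 2 by rewrite ler_peMl ?sqr_ge0.
  have h4 := sqr_ge0 K.
  have -> : 2 * s%:R * K ^+ 2 = K * (s%:R * K) + s%:R * K ^+ 2 by ring.
  apply: lerD => //.
  by rewrite ler_pdivrMr//; lra.
(* pointwise expansion around U *)
have expansion x : `|(cos (t * psum j.+1 x + c) - cos (t * S x + c)) -
    (- t * (Y x * sin (t * S' x + c)) - t ^+ 2 * (A x * cos (t * U x + c)))| <=
    T1 ^+ 3 * (4 * s%:R ^+ 2 * K ^+ 3).
  rewrite psumS -/S -/Y.
  set u := t * S x + c; set u' := t * S' x + c; set u0 := t * U x + c.
  have -> : t * (S x + Y x) + c = u + t * Y x by rewrite /u; ring.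
  have uu' : u = u' + t * D x by rewrite /u /u' /D; ring.
  (* [r1] and [r2] are Taylor remainders; [r3] and [r4] are the costs of freezing at [U] the cosines
     that multiply Y D and Y ^ 2 / 2. *)
  pose r1 := cos (u + t * Y x) - cos u + (t * Y x) * sin u + (t * Y x) ^+ 2 / 2 * cos u.
  pose r2 := sin (u' + t * D x) - sin u' - t * D x * cos u'.
  pose r3 := cos u' - cos u0.
  pose r4 := cos u - cos u0.
  have -> : cos (u + t * Y x) - cos u -
      (- t * (Y x * sin u') - t ^+ 2 * (A x * cos u0)) =
      r1 - t * Y x * r2 - t ^+ 2 * Y x * D x * r3 - t ^+ 2 * Y x ^+ 2 / 2 * r4.
    by rewrite /r1 /r2 -uu' /r3 /r4 /A; field.
  have ntY : `|t * Y x| <= T1 * K by rewrite normrM ler_wpM2l.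
  have ntD : `|t * D x| <= T1 * (s%:R * K) by rewrite normrM ler_wpM2l.
  have n1 : `|r1| <= (T1 * K) ^+ 3.
    apply: (le_trans (cos_taylor2 _ _)).
    by rewrite lerXn2r ?nnegrE// mulr_ge0.
  have n2 : `|r2| <= (T1 * (s%:R * K)) ^+ 2.
    apply: (le_trans (sin_taylor1 _ _)).
    rewrite -[leLHS]real_normK ?num_real//.
    by rewrite lerXn2r ?nnegrE// !mulr_ge0.
  have n3 : `|r3| <= T1 * (s%:R * K).
    apply: (le_trans (cos_lip _ _)); rewrite /u' /u0.
    rewrite (_ : _ - _ = t * (S' x - U x)); last by ring.
    by rewrite normrM ler_wpM2l.
  have n4 : `|r4| <= T1 * (2 * (s%:R * K)).
    apply: (le_trans (cos_lip _ _)); rewrite /u /u0.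
    rewrite (_ : _ - _ = t * (D x + (S' x - U x))); last by rewrite /D; ring.
    rewrite normrM ler_wpM2l//; apply: (le_trans (ler_normD _ _)).
    by rewrite mulr_natl mulr2n lerD.
  have m2 : `|t * Y x * r2| <= (T1 * K) * (T1 * (s%:R * K)) ^+ 2.
    by rewrite normrM ler_pM.
  have m3 : `|t ^+ 2 * Y x * D x * r3| <= (T1 ^+ 2 * K * (s%:R * K)) * (T1 * (s%:R * K)).
    rewrite normrM ler_pM// normrM ler_pM// normrM ler_pM//.
    by rewrite normrX.
  have m4 : `|t ^+ 2 * Y x ^+ 2 / 2 * r4| <= (T1 ^+ 2 * K ^+ 2 / 2) * (T1 * (2 * (s%:R * K))).
    rewrite normrM ler_pM// normrM (ger0_norm (_ : 0 <= 2^-1))//.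
    rewrite ler_wpM2r// normrM !normrX ler_wpM2l ?exprn_ge0//.
    by rewrite lerXn2r ?nnegrE.
  apply: (@le_trans _ _ ((T1 * K) ^+ 3 + (T1 * K) * (T1 * (s%:R * K)) ^+ 2 +
    (T1 ^+ 2 * K * (s%:R * K)) * (T1 * (s%:R * K)) +
    (T1 ^+ 2 * K ^+ 2 / 2) * (T1 * (2 * (s%:R * K))))).
    apply: (le_trans (ler_normB _ _)); apply: lerD => //.
    apply: (le_trans (ler_normB _ _)); apply: lerD => //.
    by apply: (le_trans (ler_normB _ _)); exact: lerD.
  rewrite [leLHS](_ : _ = T1 ^+ 3 * K ^+ 3 * (1 + s%:R ^+ 2 + s%:R ^+ 2 + s%:R)); last by field.
  rewrite [leRHS](_ : _ = T1 ^+ 3 * K ^+ 3 * (4 * s%:R ^+ 2)); last by ring.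
  rewrite ler_wpM2l ?mulr_ge0 ?exprn_ge0//.
  have : s%:R <= s%:R ^+ 2 :> R by rewrite expr2 ler_peMl//; lra.
  by lra.
have b0 : bmf (fun x => cos (t * psum j.+1 x + c)) by apply: bc; exact: bmf_psum.
have bYs : bmf (fun x => Y x * sin (t * S' x + c)) by apply: bmfM => //; exact: bs.
have bAc : bmf (fun x => A x * cos (t * U x + c)) by apply: bmfM => //; exact: bc.
have bl : bmf (fun x => - t * (Y x * sin (t * S' x + c)) - t ^+ 2 * (A x * cos (t * U x + c))).
  by apply: bmfB; exact: bmfZ.
have step1 := Ex_dist P (bmfB b0 (bc _ bS)) bl expansion.
have n1 x : `|sin (t * S' x + c)| <= 1 by exact: sin_max.
have n2 (f : T -> R) x : `|cos (t * f x + c)| <= 1 by exact: cos_max.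
have pb n (f : T -> R) : pbmf n f -> measurable_fun (T := g_sigma_algebraType (past n)) setT
    (fun x => t * f x + c).
  by case=> mf _; apply: measurable_funD => //; exact: measurable_funM.
have step2 : `|Ex P (fun x => Y x * sin (t * S' x + c))| <= 4 * K * al s.
  have := @cov_past_future s (j - s)%N j.+1 (fun x => sin (t * S' x + c)) Y 1 K s0 _ _
    (X_future j) n1 YK.
  rewrite /cov X_centered mulr0 subr0 mulr1.
  rewrite (@eq_Ex _ _ _ P _ (fun x => Y x * sin (t * S' x + c))); last first.
    by move=> x; rewrite mulrC.
  apply.
    (* Natural subtraction truncates: for j <= s the past index is 0, the trivial sigma-algebra, and
       no gap is required. *)
    have [js|js] := leqP j s; first by rewrite (eqP js).
    by rewrite subnK ?(ltnW js)// leqnSn orbT.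
  by apply: bmf_sin; apply: pb; exact: pbmf_psum.
have bAf : fbmf (j - s).+1 A.
  apply: bmfD.
    apply: bmfM; last exact: fbmf_psumB.
    by apply: fbmf_mono (X_future j); rewrite ltnS leq_subr.
  under [X in fbmf _ X]eq_fun do rewrite mulrC.
  apply: bmfZ; apply: bmfX.
  by apply: fbmf_mono (X_future j); rewrite ltnS leq_subr.
have step3 : `|Ex P (fun x => A x * cos (t * U x + c)) -
    Ex P A * Ex P (fun x => cos (t * U x + c))| <= 8 * s%:R * K ^+ 2 * al s.
  have := @cov_past_future s (j - s - s)%N (j - s)%N.+1 (fun x => cos (t * U x + c)) A 1
    (2 * s%:R * K ^+ 2) s0 _ _ bAf (n2 U) AK.
  rewrite covC /cov (_ : 4 * 1 * _ * _ = 8 * s%:R * K ^+ 2 * al s); last by ring.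
  apply.
    have [js|js] := leqP (j - s) s; first by rewrite (eqP js).
    by rewrite subnK ?(ltnW js)// leqnSn orbT.
  by apply: bmf_cos; apply: pb; exact: pbmf_psum.
have EA : Ex P A = local_var s j / 2.
  rewrite /local_var mulrC -ExZ.
    by apply: eq_Ex => x; rewrite /A /D /Y /S /S'; field.
  by apply: bmfM => //; apply: bmfD => //; exact: bmfZ.
have step4 : `|Ex P (fun x => cos (t * U x + c)) - Ex P (fun x => cos (t * S x + c))| <=
    T1 * (2 * (s%:R * K)).
  apply: Ex_dist => [||x]; [exact: bc..|].
  apply: (le_trans (cos_lip _ _)).
  rewrite (_ : _ - _ = t * - (D x + (S' x - U x))); last by rewrite /D; ring.
  rewrite normrM normrN ler_wpM2l//; apply: (le_trans (ler_normD _ _)).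
  by rewrite mulr_natl mulr2n lerD.
move: step1; rewrite ExB//; last exact: bc.
rewrite ExB; [|exact: bmfZ..].
rewrite ExZ// ExZ//.
set g1 := Ex P (fun x => cos (t * psum j.+1 x + c)).
rewrite -/S; set g0 := Ex P (fun x => cos (t * S x + c)) in step4 *.
set gU := Ex P (fun x => cos (t * U x + c)) in step3 step4 *.
set e1 := Ex P (fun x => Y x * _) in step2 *.
set e2 := Ex P (fun x => A x * _) in step3 *.
move=> step1.
have lv := local_var_bound s j.
rewrite (_ : g1 - _ = (g1 - g0 - (- t * e1 - t ^+ 2 * e2)) - t * e1 -
  t ^+ 2 * (e2 - Ex P A * gU) - t ^+ 2 * (local_var s j / 2 * (gU - g0)));
  last by rewrite EA; ring.
have m1 : `|t * e1| <= T1 * (4 * K * al s) by rewrite normrM ler_wpM2l.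
have m2 : `|t ^+ 2 * (e2 - Ex P A * gU)| <= t ^+ 2 * (8 * s%:R * K ^+ 2 * al s).
  by rewrite normrM (ger0_norm (sqr_ge0 t)) ler_wpM2l ?sqr_ge0.
have m3 : `|t ^+ 2 * (local_var s j / 2 * (gU - g0))| <=
    T1 ^+ 2 * (vmax / 2 * (T1 * (2 * (s%:R * K)))).
  rewrite normrM normrX ler_wpM2l ?exprn_ge0// normrM ler_pM//.
  by rewrite normrM (ger0_norm (_ : 0 <= 2^-1))// ler_wpM2r.
apply: (le_trans (ler_normB _ _)).
rewrite [leRHS](_ : _ = T1 ^+ 3 * (4 * s%:R ^+ 2 * K ^+ 3) + T1 * (4 * K * al s) +
  t ^+ 2 * (8 * s%:R * K ^+ 2 * al s) +
  T1 ^+ 2 * (vmax / 2 * (T1 * (2 * (s%:R * K))))); last by rewrite -/T1; field.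
apply: lerD => //; apply: (le_trans (ler_normB _ _)); apply: lerD => //.
by apply: (le_trans (ler_normB _ _)); exact: lerD.
Qed.

Lemma cos_psum_bound (t c : R) s m : (0 < s)%N -> t ^+ 2 * vmax / 2 <= 1 / 2 ->
  `|Ex P (fun x => cos (t * psum m x + c)) -
    expR (- (t ^+ 2 * (\sum_(j < m) local_var s j) / 2)) * cos c| <=
  m%:R * expR (m%:R * (t ^+ 2 * vmax / 2)) *
  (`|t| ^+ 3 * (4 * s%:R ^+ 2 * K ^+ 3 + s%:R * K * vmax) +
  (4 * `|t| * K + 8 * t ^+ 2 * s%:R * K ^+ 2) * al s +
  2 * (t ^+ 2 * vmax / 2) ^+ 2).
Proof.
move=> s0 b1.
pose a j := t ^+ 2 * local_var s j / 2.
have ab j : `|a j| <= t ^+ 2 * vmax / 2.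
  rewrite /a normrM (ger0_norm (_ : 0 <= 2^-1))// ler_wpM2r//.
  by rewrite normrM (ger0_norm (sqr_ge0 t)) ler_wpM2l ?sqr_ge0// local_var_bound.
have -> : expR (- (t ^+ 2 * (\sum_(j < m) local_var s j) / 2)) =
    expR (- \sum_(j < m) a j).
  by congr (expR (- _)); rewrite /a mulr_sumr mulr_suml.
have <- : Ex P (fun x => cos (t * psum 0 x + c)) = cos c.
  rewrite -[RHS](Ex_cst P); apply: eq_Ex => x.
  by rewrite /psum big_ord0 mulr0 add0r.
set b := t ^+ 2 * vmax / 2 in b1 ab *.
apply: (@exp_recursion R (fun n => Ex P (fun x => cos (t * psum n x + c))) a).
- by move=> j; exact: cos_recursion.
- exact: ab.
- exact: b1.
- move=> j; apply: Ex_bound => [|x]; last exact: cos_max.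
  apply: bmf_cos; apply: measurable_funD => //; apply: measurable_funM => //.
  exact: bmf_meas (bmf_psum j).
Qed.

End mixing_clt.

(** * Choice of the gap, sums of inverse squares, and variances of partial sums *)

Section clt_rate.
Context {R : realType}.

(* Here sqrt m is between s ^ 3 and 8 s ^ 3. *)
Lemma clt_rate (t kappa C v Kv b al : R) (s m : nat) : (0 < s)%N -> 0 <= kappa -> 0 <= v ->
  0 <= C -> 0 <= al ->
  (s ^ 6 <= m)%N -> (m <= (2 * s) ^ 6)%N ->
  Kv = kappa / Num.sqrt m%:R -> b = t ^+ 2 * (Kv ^+ 2 * v) / 2 ->
  al <= C / s%:R ^+ 4 ->
  m%:R * expR (m%:R * b) * (`|t| ^+ 3 * (4 * s%:R ^+ 2 * Kv ^+ 3 + s%:R * Kv * (Kv ^+ 2 * v)) +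
    (4 * `|t| * Kv + 8 * t ^+ 2 * s%:R * Kv ^+ 2) * al + 2 * b ^+ 2) <=
  expR (t ^+ 2 * kappa ^+ 2 * v / 2) *
   (`|t| ^+ 3 * kappa ^+ 3 * (4 + v) + (32 * `|t| * kappa + 8 * t ^+ 2 * kappa ^+ 2) * C +
    2 * (t ^+ 2 * kappa ^+ 2 * v / 2) ^+ 2) / s%:R.
Proof.
move=> s0 k0 v0 C0 al0 sm ms -> -> alC; set T := `|t|; have T0 : 0 <= T by exact: normr_ge0.
have s1 : 1 <= s%:R :> R by rewrite ler1n.
have sp : 0 < s%:R :> R by rewrite ltr0n.
have m0 : (0 < m)%N by apply: leq_trans sm; rewrite expn_gt0 s0.
pose r : R := Num.sqrt m%:R.
have r0 : 0 < r by rewrite sqrtr_gt0 ltr0n.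
have rN0 : r != 0 by rewrite gt_eqF.
have r2 : m%:R = r ^+ 2 by rewrite sqr_sqrtr.
have sr : s%:R ^+ 3 <= r.
  rewrite -(@ler_pXn2r _ 2)// ?nnegrE ?exprn_ge0 ?(ltW r0) ?(ltW sp)//.
  by rewrite -r2 -exprM -natrX ler_nat.
have rs : r <= 8 * s%:R ^+ 3.
  rewrite -(@ler_pXn2r _ 2)// ?nnegrE ?mulr_ge0 ?exprn_ge0 ?(ltW r0) ?(ltW sp)//.
  rewrite -r2 (_ : (8 * _) ^+ 2 = ((2 * s) ^ 6)%:R) ?ler_nat//.
  by rewrite natrX natrM; ring.
rewrite -/r r2.
have -> : r ^+ 2 * (t ^+ 2 * ((kappa / r) ^+ 2 * v) / 2) = t ^+ 2 * kappa ^+ 2 * v / 2.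
  by field.
set B := t ^+ 2 * kappa ^+ 2 * v / 2.
have B0 : 0 <= B by rewrite /B divr_ge0// mulr_ge0// mulr_ge0// sqr_ge0.
set L := (X in _ * _ * X <= _).
have -> : r ^+ 2 * expR B * L = expR B * (r ^+ 2 * L) by ring.
rewrite -[leRHS]mulrA ler_wpM2l ?expR_ge0//.
(* Each bracket is O(1 / s): r >= s ^ 3 handles the Taylor terms, while r <= 8 s ^ 3 together with
   al <= C / s ^ 4 handles the decoupling term r al. *)
have -> : r ^+ 2 * L =
  T ^+ 3 * kappa ^+ 3 * ((4 * s%:R ^+ 2 + s%:R * v) / r) +
  (4 * T * kappa * (r * al) + 8 * t ^+ 2 * kappa ^+ 2 * (s%:R * al)) +
  2 * B ^+ 2 * r^-1 ^+ 2.
  by rewrite /L /B; field.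
have rV : r^-1 <= (s%:R ^+ 3)^-1 by rewrite lef_pV2// posrE ?exprn_gt0.
have s3V : (s%:R ^+ 3)^-1 <= s%:R^-1 :> R.
  rewrite lef_pV2 ?posrE ?exprn_gt0//.
  by rewrite exprS ler_peMr ?(ltW sp)// exprn_ege1.
have h1 : (4 * s%:R ^+ 2 + s%:R * v) / r <= (4 + v) / s%:R.
  apply: (@le_trans _ _ ((4 * s%:R ^+ 2 + s%:R * v) / s%:R ^+ 3)).
    rewrite ler_wpM2l//; have := sqr_ge0 (s%:R : R).
    by have := mulr_ge0 (ltW sp) v0; lra.
  rewrite ler_pdivrMr ?exprn_gt0//.
  rewrite (_ : _ / s%:R * _ = 4 * s%:R ^+ 2 + s%:R ^+ 2 * v); last by field; rewrite gt_eqF.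
  by rewrite lerD2l ler_wpM2r// expr2 ler_peMl// ltW.
have h2 : r * al <= 8 * C / s%:R.
  apply: (@le_trans _ _ (8 * s%:R ^+ 3 * (C / s%:R ^+ 4))).
    by rewrite ler_pM// ltW.
  rewrite [leLHS](_ : _ = 8 * C / s%:R)//; by field; rewrite gt_eqF.
have h3 : s%:R * al <= C / s%:R.
  apply: (@le_trans _ _ (s%:R * (C / s%:R ^+ 4))); first by rewrite ler_wpM2l// ltW.
  rewrite (_ : s%:R * _ = C / s%:R ^+ 3); last by field; rewrite gt_eqF.
  by rewrite ler_wpM2l.
have h4 : r^-1 ^+ 2 <= s%:R^-1.
  have : r^-1 <= s%:R^-1 by exact: le_trans s3V.
  have r10 : 0 <= r^-1 by rewrite invr_ge0 ltW.
  move=> h; apply: (@le_trans _ _ (s%:R^-1 ^+ 2)); first by rewrite lerXn2r ?nnegrE ?invr_ge0 ?(ltW sp) ?(ltW r0).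
  by rewrite expr2 ler_piMl ?invr_ge0 ?(ltW sp)// invf_le1.
rewrite [leRHS](_ : _ = T ^+ 3 * kappa ^+ 3 * ((4 + v) / s%:R) +
  (4 * T * kappa * (8 * C / s%:R) + 8 * t ^+ 2 * kappa ^+ 2 * (C / s%:R)) +
  2 * B ^+ 2 * s%:R^-1); last by field; rewrite gt_eqF.
have k3 : 0 <= T ^+ 3 * kappa ^+ 3 by rewrite mulr_ge0 ?exprn_ge0.
have p1 : 0 <= 4 * T * kappa by rewrite mulr_ge0// mulr_ge0.
have p2 : 0 <= 8 * t ^+ 2 * kappa ^+ 2 by rewrite mulr_ge0 ?sqr_ge0// mulr_ge0 ?sqr_ge0.
have p3 : 0 <= 2 * B ^+ 2 by apply: mulr_ge0 => //; exact: sqr_ge0.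
apply: lerD; last by rewrite ler_wpM2l.
by apply: lerD; [|apply: lerD]; rewrite ler_wpM2l.
Qed.

(** Take the largest s with s ^ 6 <= m; then m < (s + 1) ^ 6 and s + 1 <= 2 s. *)
Lemma exists_sixth_root (m : nat) : (0 < m)%N ->
  exists s, [/\ (0 < s)%N, (s ^ 6 <= m)%N & (m <= (2 * s) ^ 6)%N].
Proof.
move=> m0.
have ex : exists s, (s ^ 6 <= m)%N by exists 1%N; rewrite exp1n.
have bd s : (s ^ 6 <= m)%N -> (s <= m)%N.
  move=> sm; apply: leq_trans sm; case: s => // s.
  by rewrite -[leqLHS]expn1 leq_pexp2l.
case: (ex_maxnP ex bd) => s sm smax; have s0 : (0 < s)%N by apply: smax; rewrite exp1n.
exists s; split => //.
have : ~~ (s.+1 ^ 6 <= m)%N by apply/negP => /smax; rewrite ltnn.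
rewrite -ltnNge => /ltnW/leq_trans; apply.
by rewrite leq_exp2r// mul2n -addnn -addn1 leq_add2l.
Qed.

End clt_rate.

(** The terms are 1 / n ^ 2 for n from j down to s + 1, and 1 / n ^ 2 <= 2 / n - 2 / (n + 1)
    telescopes. *)
Lemma sum_inv_squares (R : realType) (j s : nat) :
  \sum_(i < j - s) ((j - i)%N%:R ^- 2 : R) <= 2 / s.+1%:R.
Proof.
have gen n : \sum_(i < n) ((n + s - i)%N%:R ^- 2 : R) <=
    2 / s.+1%:R - 2 / (n + s).+1%:R.
  elim: n => [|n IHn]; first by rewrite big_ord0 add0n subrr.
  rewrite big_ord_recl subn0.
  under eq_bigr => i _ do rewrite lift0 addSn subSS.
  apply: le_trans (lerD (lexx _) IHn) _.
  rewrite addSn; set k := (n + s)%N.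
  have k1 : 0 < k.+1%:R :> R by rewrite ltr0n.
  have k2 : 0 < k.+2%:R :> R by rewrite ltr0n.
  suff : (k.+1%:R ^- 2 : R) <= 2 / k.+1%:R - 2 / k.+2%:R.
    by move: (k.+1%:R ^- 2) (2 / k.+1%:R) (2 / k.+2%:R) (2 / s.+1%:R) => x y z u; lra.
  have -> : 2 / k.+1%:R - 2 / k.+2%:R = 2 / (k.+1%:R * k.+2%:R) :> R.
    rewrite -[k.+2%:R]natr1; move: (k.+1%:R : R) k1 => x x0.
    by field; apply/andP; split; rewrite gt_eqF//; lra.
  rewrite -[leLHS]div1r ler_pdivrMr ?exprn_gt0// mulrAC ler_pdivlMr ?mulr_gt0//.
  have : 1 <= k.+1%:R :> R by rewrite ler1n.
  by rewrite -[k.+2%:R]natr1; move: (k.+1%:R : R) k1 => x x0 x1; nra.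
have [sj|js] := leqP s j; last first.
  by rewrite (eqP (ltnW js : j - s == 0)%N) big_ord0 divr_ge0.
have := gen (j - s)%N; rewrite subnK// => /le_trans; apply.
by rewrite gerBl divr_ge0.
Qed.

Section psum_variance.
Context {d : measure_display} {T : measurableType d} {R : realType}.
Variables (P : probability T R) (X : nat -> T -> R).

(** Each covariance is charged to its later index j, so the sum over the earlier ones gives B w_j
    and cross terms contribute 2 B w_j. *)
Lemma psum_var (al w : nat -> R) (B : R) m :
  (forall i, bmf (X i)) ->
  (forall i j, (i < j)%N -> `|Ex P (fun x => X i x * X j x)| <= al (j - i)%N * w j) ->
  (forall j, Ex P (fun x => X j x ^+ 2) <= w j) ->
  (forall j, \sum_(i < j) al (j - i)%N <= B) ->
  Ex P (fun x => psum X m x ^+ 2) <= (1 + 2 * B) * \sum_(j < m) w j.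
Proof.
move=> bX cX vX sB.
have bS n : bmf (psum X n) by apply: bmf_sum => i; exact: bX.
have w0 j : 0 <= w j by apply: le_trans (vX j); apply: Ex_ge0 => x; exact: sqr_ge0.
elim: m => [|m IHm].
  rewrite big_ord0 mulr0 (@eq_Ex _ _ _ P _ (fun=> 0)) ?Ex_cst// => x.
  by rewrite /psum big_ord0 expr0n.
have -> : Ex P (fun x => psum X m.+1 x ^+ 2) = Ex P (fun x => psum X m x ^+ 2) +
    (2 * Ex P (fun x => psum X m x * X m x) + Ex P (fun x => X m x ^+ 2)).
  rewrite -ExZ; last exact: bmfM.
  rewrite -ExD; [|by apply: bmfZ; exact: bmfM|exact: bmfX].
  rewrite -ExD; [|exact: bmfX|]; last first.
    by apply: bmfD; [by apply: bmfZ; exact: bmfM|exact: bmfX].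
  by apply: eq_Ex => x; rewrite psumS; ring.
rewrite big_ord_recr/= mulrDr; apply: lerD => //.
have -> : (1 + 2 * B) * w m = 2 * (B * w m) + w m by ring.
apply: lerD => //; rewrite ler_pM2l//.
rewrite (@eq_Ex _ _ _ P _ (fun x => \sum_(i < m) (X i x * X m x))); last first.
  by move=> x; rewrite /psum mulr_suml.
rewrite Ex_sum; last by move=> i; exact: bmfM.
apply: (@le_trans _ _ (\sum_(i < m) al (m - i)%N * w m)).
  by apply: ler_sum => i _; apply: le_trans (cX i m (ltn_ord i)); exact: ler_norm.
by rewrite -mulr_suml ler_wpM2r.
Qed.

End psum_variance.

(** * Mixing arrays in the factor model *)

Section factor_model_mixing.
Context {d : measure_display} {T : measurableType d} {R : realType}.
Context {P : probability T R} {k : nat}.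
Variable M : factor_model P k.

Definition past m (n : nat) : set (set T) :=
  \bigcup_(i in [set i : 'I_m | (i.+1 <= n)%N]) preimage_set_system setT (xi M i) measurable.

Definition future m (l : nat) : set (set T) :=
  \bigcup_(i in [set i : 'I_m | (l <= i.+1)%N]) preimage_set_system setT (xi M i) measurable.

Lemma measurable_eps m (i : 'I_m) : measurable_fun setT (eps M i).
Proof. by case: (eps_law M m). Qed.

Lemma measurable_H m (i : 'I_m) : measurable_fun setT (H M i).
Proof. by case: (H_law M m). Qed.

Lemma measurable_xi m (i : 'I_m) : measurable_fun setT (xi M i).
Proof. by apply: measurable_fun_pair; [exact: measurable_eps|exact: measurable_H]. Qed.

Lemma sigma_xi_meas m (I : set 'I_m) A :
  <<s \bigcup_(i in I) preimage_set_system setT (xi M i) measurable >> A -> measurable A.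
Proof.
apply: smallest_sub; first exact: sigma_algebra_measurable.
by move=> B [i Ii] [C mC <-]; apply: measurable_xi.
Qed.

Lemma past_mono m n n' : (n <= n')%N -> past m n `<=` past m n'.
Proof.
by move=> nn' A [i /= Ii Ai]; exists i => //=; exact: leq_trans nn'.
Qed.

Lemma future_mono m n n' : (n <= n')%N -> future m n' `<=` future m n.
Proof.
by move=> nn' A [i /= Ii Ai]; exists i => //=; exact: leq_trans Ii.
Qed.

Definition mixing_set (e : nat) := [set x : R | exists n m : nat, [/\ (0 < n)%N, (0 < m)%N &
    exists A0 A1 : set T,
      [/\ sigma_xi M [set i : 'I_m | (i.+1 <= n)%N] A0,
          sigma_xi M [set i : 'I_m | (n + e <= i.+1)%N] A1
        & x = `|fine (P (A0 `&` A1)) - fine (P A0) * fine (P A1)|]]].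

Lemma mixing_set_le1 e x : mixing_set e x -> 0 <= x <= 1.
Proof.
move=> [n [m [_ _ [A0 [A1 [/sigma_xi_meas m0 /sigma_xi_meas m1 ->]]]]]].
rewrite normr_ge0/=.
have p0 := fineP_ge0 P A0; have p1 := fineP_ge0 P A1.
have p2 := fineP_ge0 P (A0 `&` A1).
have q0 := fineP_le1 P m0; have q1 := fineP_le1 P m1.
have q2 := fineP_le1 P (measurableI _ _ m0 m1).
by rewrite ler_norml; apply/andP; split; nra.
Qed.

Lemma mixing_set_sup e : has_sup (mixing_set e).
Proof.
split; last by exists 1 => x /mixing_set_le1/andP[].
have e0 m (I : set 'I_m) : sigma_xi M I set0.
  exact: (@measurable0 _ (g_sigma_algebraType
    (\bigcup_(i in I) preimage_set_system setT (xi M i) measurable))).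
exists `|fine (P (set0 `&` set0)) - fine (P set0) * fine (P set0)|; exists 1%N, 1%N; split => //.
by exists set0, set0; split.
Qed.

Lemma mixing_coefE e : mixing_coef M e = sup (mixing_set e). Proof. by []. Qed.

Lemma mixing_coef_ge0 e : 0 <= mixing_coef M e.
Proof.
have [[x xe] ub] := mixing_set_sup e.
apply: (@le_trans _ _ x); first by case/andP: (mixing_set_le1 xe).
by rewrite mixing_coefE; apply: ub_le_sup.
Qed.

Lemma mixing_coef_le1 e : mixing_coef M e <= 1.
Proof.
have [ne _] := mixing_set_sup e.
by rewrite mixing_coefE; apply: ge_sup => // x /mixing_set_le1/andP[].
Qed.

(** The supremum defining [mixing_coef] ranges over positive n and m. At n = 0 or m = 0 the past is
    trivial and the left side vanishes; otherwise the future from l on lies inside the one from n +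
    s on. *)
Lemma past_future_mixing m s n l A B : (0 < s)%N -> (n == 0)%N || (n + s <= l)%N ->
  <<s past m n >> A -> <<s future m l >> B ->
  `|fine (P (A `&` B)) - fine (P A) * fine (P B)| <= mixing_coef M s.
Proof.
move=> s0 nsl pA fB.
have mB : measurable B by exact: sigma_xi_meas fB.
have trivial : A = set0 \/ A = setT ->
    `|fine (P (A `&` B)) - fine (P A) * fine (P B)| <= mixing_coef M s.
  have PT := probability_setT P.
  by case=> ->; rewrite ?set0I ?setTI ?measure0 ?PT ?mul0r ?mul1r ?subrr ?normr0 mixing_coef_ge0.
have [n0|n0] := posnP n.
  apply: trivial; move: A pA; rewrite n0 => A pA.
  (* The generating family is empty, and the empty set with the whole space already form a
     sigma-algebra containing it. *)
  apply: (pA [set A | A = set0 \/ A = setT]); split.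
  - split; first by left.
    + by move=> C [->|->]; [right; rewrite setD0|left; rewrite setDv].
    + move=> F hF; have [[i Fi]|nF] := pselect (exists i, F i = setT).
        by right; apply/seteqP; split => // x _; exists i => //; rewrite Fi.
      left; apply/seteqP; split => // x [i _]; case: (hF i) => [->//|Fi].
      by case: nF; exists i.
  - by move=> C [i /=]; rewrite ltn0.
have [m0|m0] := posnP m.
  apply: trivial; move: pA; rewrite m0 => pA.
  apply: (pA [set A | A = set0 \/ A = setT]); split.
  - split; first by left.
    + by move=> C [->|->]; [right; rewrite setD0|left; rewrite setDv].
    + move=> F hF; have [[i Fi]|nF] := pselect (exists i, F i = setT).
        by right; apply/seteqP; split => // x _; exists i => //; rewrite Fi.
      left; apply/seteqP; split => // x [i _]; case: (hF i) => [->//|Fi].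
      by case: nF; exists i.
  - by move=> C [[]].
rewrite eqn0Ngt n0/= in nsl.
rewrite mixing_coefE; apply: ub_le_sup; first by case: (mixing_set_sup s).
exists n, m; split => //; exists A, B; split => //.
move: B fB {mB trivial}; apply: sub_smallest2r; first exact: smallest_sigma_algebra.
exact: future_mono.
Qed.

Definition poly_mixing (C : R) := 0 <= C /\ forall e, (0 < e)%N -> mixing_coef M e <= C ^+ 2 / e%:R ^+ 4.

(* The exponent g / (Q + g) is at most 1 / 2 and alpha <= 1, so that sqrt (alpha e) is
   at most the summand without its factor e ^ (Q - 2), hence O(e ^ -2). *)
Lemma poly_mixingP (Q : nat) (g : R) : ~~ odd Q -> (2 < Q)%N -> 0 < g ->
  g / (2 + g) + 2 / Q%:R < 1 ->
  (\sum_(1 <= e <oo) (e%:R ^+ (Q - 2) *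
     mixing_coef M e `^ (g / (Q%:R + g)))%:E < +oo)%E ->
  exists C, poly_mixing C.
Proof.
move=> evQ Q2 g0 gQ sumfin.
set th := g / (Q%:R + g) in sumfin.
pose u e := (e%:R ^+ (Q - 2) * mixing_coef M e `^ th) : R.
have u0 e : 0 <= u e by rewrite mulr_ge0 ?exprn_ge0 ?powR_ge0.
set S := (\sum_(1 <= e <oo) _)%E in sumfin.
have S0 : (0 <= S)%E by apply: nneseries_ge0 => n _ _; rewrite lee_fin; exact: u0.
have Sfin : S \is a fin_num by rewrite ge0_fin_numE.
exists (fine S); split; first exact: fine_ge0.
move=> e e0; set C := fine S.
have ue : u e <= C.
  rewrite -lee_fin /C fineK//.
  have := @nneseries_lim_ge R (fun e => (u e)%:E) xpredT 1%N e.+1.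
  move=> /(_ (fun n _ _ => u0 n)); apply: le_trans.
  rewrite big_nat_recr//= leeDr//.
  by apply: sume_ge0 => i _; rewrite lee_fin.
have Q0 : 2 < Q%:R :> R by rewrite ltr_nat.
have th0 : 0 < th by rewrite divr_gt0// addr_gt0//; lra.
(* Clearing denominators in g / (2 + g) < 1 - 2 / Q gives g < Q - 2. *)
have th2 : th <= 2^-1.
  have h1 : g < Q%:R.
    have : g / (2 + g) < 1 - 2 / Q%:R by lra.
    rewrite ltr_pdivrMr; last by lra.
    have -> : 1 - 2 / Q%:R = (Q%:R - 2) / Q%:R :> R by field; rewrite gt_eqF//; lra.
    rewrite mulrAC ltr_pdivlMr; last by lra.
    by nra.
  by rewrite /th ler_pdivrMr; lra.
have a0 := mixing_coef_ge0 e; have a1 := mixing_coef_le1 e.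
set a := mixing_coef M e in a0 a1 ue *.
have e1 : 1 <= e%:R :> R by rewrite ler1n.
have h : e%:R ^+ 2 * Num.sqrt a <= C.
  apply: le_trans ue; rewrite /u -/a; apply: ler_pM => //.
  (* An even Q above 2 is at least 4, so Q - 2 >= 2. *)
  - by apply: ler_weXn2l => //; rewrite leq_subRL; case: (Q) evQ Q2 => [|[|[|[]]]].
  - rewrite -powR12_sqrt//; have [->|aN0] := eqVneq a 0.
      by rewrite !powR0// gt_eqF.
    have ap : 0 < a by rewrite lt_neqAle eq_sym aN0.
    rewrite /powR (negbTE aN0) ler_expR ler_wnM2r// ln_le0//.
rewrite ler_pdivlMr ?exprn_gt0 ?ltr0n//.
have -> : a * e%:R ^+ 4 = (e%:R ^+ 2 * Num.sqrt a) ^+ 2.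
  by rewrite exprMn sqr_sqrtr//; ring.
by rewrite lerXn2r ?nnegrE ?fine_ge0// mulr_ge0 ?sqrtr_ge0// sqr_ge0.
Qed.

(** A bound on the sum of the mixing coefficients at distances beyond [s]: e ^ -4 is weakened to e ^
    -2, and the decay 1 / s is enough for the truncated variance. *)
Definition tau_mix (C : R) (s : nat) := 2 * C ^+ 2 / s.+1%:R.

Lemma poly_mixing_sqrt C e : poly_mixing C -> (0 < e)%N ->
  Num.sqrt (mixing_coef M e) <= C / e%:R ^+ 2.
Proof.
move=> [C0 aC] e0; have := aC e e0.
have -> : C ^+ 2 / e%:R ^+ 4 = (C / e%:R ^+ 2) ^+ 2.
  by rewrite expr_div_n -exprM.
move=> h; rewrite -(@ler_pXn2r _ 2)// ?nnegrE ?sqrtr_ge0 ?divr_ge0 ?sqr_ge0//.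
by rewrite sqr_sqrtr// mixing_coef_ge0.
Qed.

Lemma poly_mixing_sum C j s : poly_mixing C ->
  \sum_(i < j - s) mixing_coef M (j - i) <= tau_mix C s.
Proof.
move=> [C0 aC].
have h : \sum_(i < j - s) mixing_coef M (j - i) <=
    C ^+ 2 * \sum_(i < j - s) (j - i)%N%:R ^- 2.
  rewrite mulr_sumr; apply: ler_sum => i _.
  have ji : (0 < j - i)%N.
    by rewrite subn_gt0; apply: leq_trans (ltn_ord i) _; exact: leq_subr.
  apply: le_trans (aC _ ji) _; rewrite ler_wpM2l ?sqr_ge0//.
  rewrite lef_pV2 ?posrE ?exprn_gt0 ?ltr0n//.
  by rewrite ler_weXn2l// ler1n.
apply: (le_trans h); rewrite /tau_mix -mulrA mulrCA ler_wpM2l ?sqr_ge0//.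
exact: sum_inv_squares.
Qed.

(** The central limit section treats sequences indexed by [nat]; a row of the triangular array is
    padded by the null function, which is measurable for every past and future. *)
Definition zero_ext m (u : 'I_m -> T -> R) (i : nat) (x : T) : R :=
  if insub i is Some i' then u i' x else 0.

Lemma zero_extE m (u : 'I_m -> T -> R) (i : 'I_m) : zero_ext u i = u i.
Proof. by apply/funext => x; rewrite /zero_ext valK. Qed.

Lemma psum_zero_ext m (u : 'I_m -> T -> R) x : psum (zero_ext u) m x = \sum_i u i x.
Proof. by apply: eq_bigr => i _; rewrite zero_extE. Qed.

Lemma zero_ext_cases m (u : 'I_m -> T -> R) (i : nat) :
  (exists i' : 'I_m, i = i' /\ zero_ext u i = u i') \/ zero_ext u i = fun=> 0.
Proof.
case: (insubP ('I_m) i) => [i' _ ii'|ni].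
  by left; exists i'; split=> //; rewrite -ii' zero_extE.
right; apply/funext => x; rewrite /zero_ext.
by rewrite insubN.
Qed.

Section one_array.
Variables (m : nat) (phi : 'I_m -> R * bool -> R) (K : R).
Hypothesis phi_meas : forall i, measurable_fun setT (phi i).
Hypothesis phi_bound : forall i x, `|phi i x| <= K.
Let u i x := phi i (xi M i x).

Lemma xi_fun_past (i : 'I_m) : @bmf _ (g_sigma_algebraType (past m i.+1)) R (u i).
Proof.
split; last by exists K => x; exact: phi_bound.
move=> _ B mB; rewrite setTI.
apply: sub_gen_smallest; exists i => //=; exists (phi i @^-1` B); rewrite ?setTI//.
by rewrite -[X in measurable X]setTI; exact: phi_meas.
Qed.

Lemma xi_fun_future (i : 'I_m) : @bmf _ (g_sigma_algebraType (future m i.+1)) R (u i).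
Proof.
split; last by exists K => x; exact: phi_bound.
move=> _ B mB; rewrite setTI.
apply: sub_gen_smallest; exists i => //=; exists (phi i @^-1` B); rewrite ?setTI//.
by rewrite -[X in measurable X]setTI; exact: phi_meas.
Qed.

Lemma bmf_xi_fun i : bmf (u i).
Proof.
split; last by exists K => x; exact: phi_bound.
exact: measurableT_comp (phi_meas i) (measurable_xi i).
Qed.

Lemma zero_ext_past (i : nat) : @bmf _ (g_sigma_algebraType (past m i.+1)) R (zero_ext u i).
Proof.
case: (@zero_ext_cases m u i) => [[i' [-> ->]]|->]; first exact: xi_fun_past.
exact: bmf_cst.
Qed.

Lemma zero_ext_future (i : nat) : @bmf _ (g_sigma_algebraType (future m i.+1)) R (zero_ext u i).
Proof.
case: (@zero_ext_cases m u i) => [[i' [-> ->]]|->]; first exact: xi_fun_future.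
exact: bmf_cst.
Qed.

Lemma xi_fun_cov (i j : 'I_m) (A B : R) : (i < j)%N ->
  (forall x, `|phi i x| <= A) -> (forall x, `|phi j x| <= B) ->
  `|cov P (u i) (u j)| <= 4 * A * B * mixing_coef M (j - i).
Proof.
move=> ij hA hB.
apply: (@cov_mixing _ _ _ P (past m i.+1) (future m j.+1)).
- by move=> C; exact: sigma_xi_meas.
- by move=> C; exact: sigma_xi_meas.
- move=> C D; apply: past_future_mixing; rewrite ?subn_gt0//.
  by rewrite addSn subnKC ?(ltnW ij)// leqnn orbT.
- exact: xi_fun_past.
- exact: xi_fun_future.
- by move=> x; exact: hA.
- by move=> x; exact: hB.
Qed.

End one_array.

(** For i < j the covariance is at most 4 alpha(j - i) and at most p_j, hence at most their
    geometric mean 2 sqrt (alpha(j - i)) sqrt (p_j). The first root is at most C / (j - i) ^ 2, the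
    second at most p_j / eta + eta. The variances satisfy u ^ 2 <= u, as values lie in [0, 1]. *)
Lemma var_indicators (C eta : R) m (phi : 'I_m -> R * bool -> R) : poly_mixing C ->
  0 < eta -> (forall i, measurable_fun setT (phi i)) ->
  (forall i x, 0 <= phi i x <= 1) ->
  Ex P (fun x => (\sum_i (phi i (xi M i x) - Ex P (fun x => phi i (xi M i x)))) ^+ 2) <=
  (1 + 8 * C) * \sum_i (Ex P (fun x => phi i (xi M i x)) / eta + eta).
Proof.
move=> mixC eta0 mphi phi01.
have phi1 i x : `|phi i x| <= 1 by have := phi01 i x; rewrite ler_norml; lra.
pose u i x := phi i (xi M i x).
pose p i := Ex P (u i).
have bu i : bmf (u i) by exact: bmf_xi_fun mphi phi1 i.
have p0 i : 0 <= p i by apply: Ex_ge0 => x; case/andP: (phi01 i (xi M i x)).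
have p1 i : p i <= 1.
  by rewrite -(Ex_cst P 1); apply: Ex_le => [||x]; [exact: bu|exact: bmf_cst|
    case/andP: (phi01 i (xi M i x))].
pose v (i : 'I_m) x := u i x - p i.
have bv i : bmf (v i) by apply: bmfB => //; exact: bmf_cst.
pose X := zero_ext v.
pose w (j : nat) : R := if insub j is Some j' then p j' / eta + eta else 0.
have w0 j : 0 <= w j.
  by rewrite /w; case: insub => // j'; rewrite addr_ge0 ?divr_ge0 ?(ltW eta0).
have pw (q : R) : 0 <= q -> Num.sqrt q <= q / eta + eta.
  move=> q0; have := sqr_ge0 (Num.sqrt q - eta).
  rewrite sqrrB sqr_sqrtr// => h; rewrite -(@ler_pM2r _ eta)// mulrDl divfK ?gt_eqF//.
  have : 0 <= Num.sqrt q * eta by rewrite mulr_ge0 ?sqrtr_ge0// ltW.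
  by rewrite -expr2; lra.
have psq (q : R) : 0 <= q -> q <= 1 -> q <= Num.sqrt q.
  move=> q0 q1; rewrite -{1}(sqr_sqrtr q0) expr2 ler_piMl ?sqrtr_ge0//.
  by rewrite -sqrtr1 ler_sqrt.
have C0 : 0 <= C by case: mixC.
have := @psum_var _ _ _ P X (fun e => 2 * (C / e%:R ^+ 2)) w (4 * C) m.
have -> : Ex P (fun x => psum X m x ^+ 2) = Ex P (fun x => (\sum_i (u i x - p i)) ^+ 2).
  by apply: eq_Ex => x; rewrite psum_zero_ext.
have -> : \sum_(j < m) w j = \sum_i (p i / eta + eta).
  by apply: eq_bigr => i _; rewrite /w valK.
rewrite mulrA -natrM; apply.
- move=> i; rewrite /X; case: (@zero_ext_cases m v i) => [[i' [_ ->]]|->]; first exact: bv.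
  exact: bmf_cst.
- move=> i j ij; rewrite /X.
  case: (@zero_ext_cases m v i) => [[i' [ii' ->]]|->]; last first.
    rewrite (@eq_Ex _ _ _ P _ (fun=> 0)); last by move=> x; rewrite mul0r.
    rewrite Ex_cst normr0 mulr_ge0 ?w0// mulr_ge0// divr_ge0// sqr_ge0//.
  case: (@zero_ext_cases m v j) => [[j' [jj' ->]]|->]; last first.
    rewrite (@eq_Ex _ _ _ P _ (fun=> 0)); last by move=> x; rewrite mulr0.
    rewrite Ex_cst normr0 mulr_ge0 ?w0// mulr_ge0// divr_ge0// sqr_ge0//.
  rewrite ii' jj' in ij *.
  have -> : w j' = p j' / eta + eta by rewrite /w valK.
  have -> : Ex P (fun x => v i' x * v j' x) = cov P (u i') (u j').
    rewrite (@eq_Ex _ _ _ P _ (fun x => u i' x * u j' x - (p j' * u i' x + p i' * u j' x)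
      + p i' * p j')); last by move=> x; rewrite /v; ring.
    have b1 := bmfM (bu i') (bu j'); have b2 := bmfZ (p j') (bu i').
    have b3 := bmfZ (p i') (bu j').
    rewrite ExD; [|by apply: bmfB => //; exact: bmfD|exact: bmf_cst].
    rewrite ExB//; last exact: bmfD.
    by rewrite Ex_cst ExD// ExZ// ExZ// /cov -/(p i') -/(p j'); ring.
  have c1 : `|cov P (u i') (u j')| <= 4 * mixing_coef M (j' - i').
    by have := xi_fun_cov mphi phi1 ij (phi1 i') (phi1 j'); rewrite !mulr1.
  have c2 : `|cov P (u i') (u j')| <= p j'.
    have e0 : 0 <= Ex P (fun x => u i' x * u j' x).
      apply: Ex_ge0 => x; rewrite mulr_ge0//.
        by case/andP: (phi01 i' (xi M i' x)).
      by case/andP: (phi01 j' (xi M j' x)).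
    have e1 : Ex P (fun x => u i' x * u j' x) <= p j'.
      apply: Ex_le => [||x]; [exact: bmfM|exact: bu|].
      rewrite ler_piMl//; first by case/andP: (phi01 j' (xi M j' x)).
      by case/andP: (phi01 i' (xi M i' x)).
    have e2 : p i' * p j' <= p j' by rewrite ler_piMl.
    have e3 : 0 <= p i' * p j' by rewrite mulr_ge0.
    by rewrite /cov -/(p i') -/(p j') ler_norml; lra.
  have a0 := mixing_coef_ge0 (j' - i').
  set a := mixing_coef M (j' - i') in c1 a0.
  apply: (@le_trans _ _ (2 * Num.sqrt a * Num.sqrt (p j'))).
    set y := `|_| in c1 c2 *.
    have y0 : 0 <= y by exact: normr_ge0.
    rewrite -(@ler_pXn2r _ 2)// ?nnegrE ?mulr_ge0 ?sqrtr_ge0//.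
    rewrite !exprMn !sqr_sqrtr// expr2.
    by rewrite (_ : 2 ^+ 2 * a = 4 * a) ?ler_pM//; ring.
  rewrite -mulrA -[leRHS]mulrA ler_wpM2l// ler_pM ?sqrtr_ge0//.
    by rewrite /a; apply: poly_mixing_sqrt => //; rewrite subn_gt0.
  exact: pw.
- move=> j; rewrite /X; case: (@zero_ext_cases m v j) => [[j' [jj' ->]]|->]; last first.
    rewrite (@eq_Ex _ _ _ P _ (fun=> 0)); last by move=> x; rewrite expr0n.
    by rewrite Ex_cst w0.
  have -> : w j = p j' / eta + eta by rewrite /w jj' valK.
  apply: le_trans (pw _ (p0 j')); apply: le_trans (psq _ (p0 j') (p1 j')).
  rewrite (@eq_Ex _ _ _ P _ (fun x => u j' x ^+ 2 - 2 * p j' * u j' x + p j' ^+ 2)); last first.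
    by move=> x; rewrite /v; ring.
  have b1 := bmfX 2 (bu j'); have b2 := bmfZ (2 * p j') (bu j').
  rewrite ExD; [|exact: bmfB|exact: bmf_cst].
  rewrite ExB// ExZ// Ex_cst -/(p j').
  have : Ex P (fun x => u j' x ^+ 2) <= p j'.
    apply: Ex_le => [||x] //; have /andP[h0 h1] := phi01 j' (xi M j' x).
    by rewrite expr2 ler_piMl.
  have : 0 <= p j' ^+ 2 by exact: sqr_ge0.
  by rewrite -mulrA -expr2; lra.
- move=> j; have := @sum_inv_squares R j 0; rewrite subn0 divr1 => h.
  rewrite -mulr_sumr -mulr_sumr (_ : 4 * C = 2 * (C * 2)); last by ring.
  by rewrite ler_wpM2l// ler_wpM2l.
Qed.

(** At each m the gap is the sixth root of m up to a factor 2. The transform of S_m is then within D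
    / s of the Gaussian one with variance V(s, m), and V(s, m) is within O(1 / s) of the second
    moment of S_m, which tends to [sigma2]. A vanishing [sigma2] needs no separate treatment. *)
Lemma mixing_array_cvg (C kappa sigma2 : R) (phi : forall m, 'I_m -> R * bool -> R) :
  poly_mixing C -> (forall m (i : 'I_m), measurable_fun setT (phi m i)) ->
  (forall m (i : 'I_m) x, `|phi m i x| <= kappa) ->
  let S m x := (Num.sqrt m%:R)^-1 *
    \sum_i (phi m i (xi M i x) - Ex P (fun x => phi m i (xi M i x))) in
  Ex P (fun x => S m x ^+ 2) @[m --> \oo] --> sigma2 ->
  forall t c, Ex P (fun x => cos (t * S m x + c)) @[m --> \oo] -->
    expR (- (sigma2 * t ^+ 2 / 2)) * cos c.
Proof.
move=> mixC mphi phik S Scvg t c.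
have C0 : 0 <= C by case: mixC.
have k0 : 0 <= kappa.
  by apply: le_trans (phik 1%N ord0 (0, true)).
pose p m (i : 'I_m) := Ex P (fun x => phi m i (xi M i x)).
have pk m i : `|p m i| <= kappa.
  by apply: Ex_bound => [|x]; [exact: bmf_xi_fun (mphi m) (@phik m) i|exact: phik].
pose phi' m (i : 'I_m) y := (Num.sqrt m%:R)^-1 * (phi m i y - p m i).
have mphi' m i : measurable_fun setT (phi' m i).
  by apply: measurable_funM => //; exact: measurable_funB.
(* Centring doubles the bound [kappa]. *)
pose K m : R := 2 * kappa / Num.sqrt m%:R.
have phiK m i y : `|phi' m i y| <= K m.
  rewrite normrM ger0_norm ?invr_ge0 ?sqrtr_ge0// mulrC ler_wpM2r ?invr_ge0 ?sqrtr_ge0//.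
  by apply: le_trans (ler_normB _ _) _; rewrite mulr_natl mulr2n lerD.
pose v := 1 + 8 * tau_mix C 0.
have t0 s : 0 <= tau_mix C s.
  by rewrite /tau_mix divr_ge0// mulr_ge0// sqr_ge0.
have v0 : 0 <= v by rewrite /v addr_ge0// mulr_ge0.
pose X m := zero_ext (fun (i : 'I_m) x => phi' m i (xi M i x)).
have SE m x : S m x = psum (X m) m x.
  by rewrite psum_zero_ext /S mulr_sumr.
pose V s m := \sum_(j < m) local_var P (X m) s j.
have Xb m i x : `|X m i x| <= K m.
  rewrite /X; case: (@zero_ext_cases m (fun (i : 'I_m) x => phi' m i (xi M i x)) i) =>
    [[i' [_ ->]]|->]; first exact: phiK.
  by rewrite normr0 /K divr_ge0 ?sqrtr_ge0// mulr_ge0.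
have Xp m i := zero_ext_past (mphi' m) (@phiK m) i.
have Xf m i := zero_ext_future (mphi' m) (@phiK m) i.
have Xc m i : Ex P (X m i) = 0.
  rewrite /X; case: (@zero_ext_cases m (fun (i : 'I_m) x => phi' m i (xi M i x)) i) =>
    [[i' [_ ->]]|->]; last by rewrite Ex_cst.
  have bp := bmf_xi_fun (mphi m) (@phik m) i'.
  rewrite ExZ; last by apply: bmfB => //; exact: bmf_cst.
  by rewrite ExB ?Ex_cst ?subrr ?mulr0//; exact: bmf_cst.
pose B := t ^+ 2 * (2 * kappa) ^+ 2 * v / 2.
pose D := expR B * (`|t| ^+ 3 * (2 * kappa) ^+ 3 * (4 + v) +
   (32 * `|t| * (2 * kappa) + 8 * t ^+ 2 * (2 * kappa) ^+ 2) * C ^+ 2 + 2 * B ^+ 2).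
have main m s : (0 < m)%N -> B / m%:R <= 1 / 2 ->
    (0 < s)%N -> (s ^ 6 <= m)%N -> (m <= (2 * s) ^ 6)%N ->
    `|Ex P (fun x => cos (t * S m x + c)) - expR (- (t ^+ 2 * V s m / 2)) * cos c| <= D / s%:R.
  move=> m0 Bm s0 sm ms.
  have r0 : 0 < Num.sqrt m%:R :> R by rewrite sqrtr_gt0 ltr0n.
  have r2 : Num.sqrt m%:R ^+ 2 = m%:R :> R by rewrite sqr_sqrtr.
  rewrite (@eq_Ex _ _ _ P _ (fun x => cos (t * psum (X m) m x + c))); last first.
    by move=> x; rewrite SE.
  have bE : t ^+ 2 * vmax (tau_mix C) (K m) / 2 = B / m%:R.
    rewrite /vmax /B /K -/v; move: r0 r2; set r := Num.sqrt _ => r0 <-.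
    by field; rewrite gt_eqF.
  have := @cos_psum_bound _ _ _ P (past m) (future m) (mixing_coef M) (tau_mix C)
    (fun n => @sigma_xi_meas m _) (fun n => @sigma_xi_meas m _) (@past_mono m)
    (@future_mono m) (@past_future_mixing m) (fun j s => poly_mixing_sum j s mixC)
    mixing_coef_ge0 (X m) (K m) (Xb m) (Xp m) (Xf m) (Xc m) t c s m s0.
  rewrite bE => /(_ Bm) h; apply: (le_trans h).
  have aC : mixing_coef M s <= C ^+ 2 / s%:R ^+ 4 by case: mixC => _; exact.
  have := @clt_rate R t (2 * kappa) (C ^+ 2) v (K m) (B / m%:R) (mixing_coef M s) s m s0
    _ v0 (sqr_ge0 _) (mixing_coef_ge0 s) sm ms erefl _ aC.
  apply; first by rewrite mulr_ge0.
  by rewrite -bE /vmax.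
have Vbound m s : (0 < m)%N -> (0 < s)%N ->
    `|V s m - Ex P (fun x => S m x ^+ 2)| <= 64 * kappa ^+ 2 * C ^+ 2 / s%:R.
  move=> m0 s0.
  have r0 : 0 < Num.sqrt m%:R :> R by rewrite sqrtr_gt0 ltr0n.
  have r2 : Num.sqrt m%:R ^+ 2 = m%:R :> R by rewrite sqr_sqrtr.
  rewrite (@eq_Ex _ _ _ P _ (fun x => psum (X m) m x ^+ 2)); last first.
    by move=> x; rewrite SE.
  have := @sum_local_var _ _ _ P (past m) (future m) (mixing_coef M) (tau_mix C)
    (fun n => @sigma_xi_meas m _) (fun n => @sigma_xi_meas m _)
    (@past_mono m) (@past_future_mixing m) (fun j s => poly_mixing_sum j s mixC)
    (X m) (K m) (Xb m) (Xp m) (Xf m) (Xc m) s m.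
  move=> h; apply: (le_trans h); rewrite /K /tau_mix.
  have sp : 0 < s%:R :> R by rewrite ltr0n.
  rewrite [leLHS](_ : _ = 64 * kappa ^+ 2 * C ^+ 2 / s.+1%:R); last first.
    have : 0 < s.+1%:R :> R by rewrite ltr0n.
    move: (s.+1%:R : R) r0 r2 => y; set r := Num.sqrt _ => r0 <- y0.
    by field; rewrite !gt_eqF.
  apply: ler_wpM2l; first by rewrite !mulr_ge0 ?sqr_ge0.
  by rewrite lef_pV2 ?posrE ?ltr0n// ler_nat.
pose E := 64 * kappa ^+ 2 * C ^+ 2.
have E0 : 0 <= E by rewrite /E mulr_ge0 ?sqr_ge0// mulr_ge0 ?sqr_ge0.
pose f (x : R) := expR (- (t ^+ 2 * x / 2)) * cos c.
have cf : {for sigma2, continuous f}.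
  apply: cvgM; last exact: cvg_cst.
  apply: (@continuous_comp _ _ _ (fun x : R => - (t ^+ 2 * x / 2)) expR); last exact: continuous_expR.
  by apply: cvgN; apply: cvgMl; apply: cvgMr; exact: cvg_id.
have -> : expR (- (sigma2 * t ^+ 2 / 2)) * cos c = f sigma2.
  by rewrite /f (mulrC sigma2).
apply/cvgrPdist_le => e e0.
have e20 : 0 < e / 2 by rewrite divr_gt0.
have /cvgrPdist_le/(_ _ e20) := cf.
rewrite near_nbhs => /nbhs_ballP[dl /= dl0 fdl].
have dl20 : 0 < dl / 2 by rewrite divr_gt0.
have dl30 : 0 < dl / 4 by rewrite divr_gt0.
have [N [N0 ND NE]] : exists N, [/\ (0 < N)%N, D / N%:R <= e / 2 & E / N%:R <= dl / 4].
  have [N NN] : exists N : nat, 1 + D / (e / 2) + E / (dl / 4) <= N%:R.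
    exact: filter_ex (nbhs_infty_ger _).
  have D0 : 0 <= D.
    rewrite /D; apply: mulr_ge0; first exact: expR_ge0.
    apply: addr_ge0; last by apply: mulr_ge0 => //; exact: sqr_ge0.
    have kk : 0 <= 2 * kappa by exact: mulr_ge0.
    apply: addr_ge0; first by apply: mulr_ge0; rewrite ?addr_ge0 ?mulr_ge0 ?exprn_ge0.
    apply: mulr_ge0; last exact: sqr_ge0.
    apply: addr_ge0; first by apply: mulr_ge0 => //; exact: mulr_ge0.
    by apply: mulr_ge0; [apply: mulr_ge0 => //|]; exact: sqr_ge0.
  have q1 : 0 <= D / (e / 2) by rewrite divr_ge0 ?(ltW e20).
  have q2 : 0 <= E / (dl / 4) by rewrite divr_ge0 ?(ltW dl30).
  have N0 : 0 < N%:R :> R by apply: lt_le_trans NN; lra.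
  exists N; split; first by rewrite -(@ltr0n R).
    by rewrite ler_pdivrMr// mulrC -ler_pdivrMr//; lra.
  by rewrite ler_pdivrMr// mulrC -ler_pdivrMr//; lra.
have N0' : 0 < N%:R :> R by rewrite ltr0n.
near=> m.
have m0 : (0 < m)%N by near: m; exact: nbhs_infty_gt.
have m0' : 0 < m%:R :> R by rewrite ltr0n.
have Bm : B / m%:R <= 1 / 2.
  rewrite ler_pdivrMr// mulrC -ler_pdivrMr//; near: m; exact: nbhs_infty_ger.
have mN : ((2 * N) ^ 6 <= m)%N by near: m; exact: nbhs_infty_ge.
have [s [s0 sm ms]] := exists_sixth_root m0.
(* From (2 N) ^ 6 <= m <= (2 s) ^ 6: the gap eventually exceeds any prescribed [N]. *)
have Ns : (N <= s)%N.
  by have := leq_trans mN ms; rewrite leq_exp2r// leq_mul2l.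
have s0' : 0 < s%:R :> R by rewrite ltr0n.
have sN : s%:R^-1 <= N%:R^-1 :> R by rewrite lef_pV2 ?posrE// ler_nat.
have h1 := main m s m0 Bm s0 sm ms.
have h2 := Vbound m s m0 s0.
have h3 : `|sigma2 - Ex P (fun x => S m x ^+ 2)| <= dl / 4.
  by near: m; move/cvgrPdist_le : Scvg; apply.
have D0 : 0 <= D.
  have : 0 <= D / s%:R by exact: le_trans h1.
  by rewrite pmulr_lge0 ?invr_gt0.
have h4 : D / s%:R <= e / 2 by apply: le_trans ND; rewrite ler_wpM2l.
have h5 : 64 * kappa ^+ 2 * C ^+ 2 / s%:R <= dl / 4.
  by apply: le_trans NE; rewrite ler_wpM2l.
have h6 : `|f sigma2 - f (V s m)| <= e / 2.
  apply: fdl; rewrite /ball/=.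
  have : `|sigma2 - V s m| <= dl / 2.
    rewrite (_ : sigma2 - V s m = (sigma2 - Ex P (fun x => S m x ^+ 2)) -
      (V s m - Ex P (fun x => S m x ^+ 2))); last by ring.
    apply: le_trans (ler_normB _ _) _.
    have -> : dl / 2 = dl / 4 + dl / 4 by field.
    by apply: lerD => //; exact: le_trans h5.
  by move=> /le_lt_trans; apply; rewrite ltr_pdivrMr// ltr_pMr// ltr1n.
rewrite (_ : f sigma2 - _ = (f sigma2 - f (V s m)) -
  (Ex P (fun x => cos (t * S m x + c)) - f (V s m))); last by ring.
rewrite [e]splitr; apply: le_trans (ler_normB _ _) (lerD h6 _).
exact: le_trans h4.
Unshelve. all: by end_near. Qed.

End factor_model_mixing.

(** * The empirical processes *)

Section conditional_model.
Context {d : measure_display} {T : measurableType d} {R : realType}.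
Context {P : probability T R} {k : nat}.
Variables (M : factor_model P k) (w : 'rV[R]_k).
Local Notation N01 := (normal_prob (0 : R) 1).

Definition shift_ m (i : 'I_m) (r : bool) : R := muA M * r%:R + dotprod (L M i) w.

Definition sd_ m (i : 'I_m) : R := Num.sqrt (Sigma M m i i).

Definition std_noise m (i : 'I_m) (x : T) : R := (sd_ i)^-1 * eps M i x.

(** A function of the value of [xi] rather than of the sample point, so that it is measurable for
    the sigma-algebra of the single coordinate i. *)
Definition ind m (i : 'I_m) (r : bool) (t : R) (y : R * bool) : R :=
  (y.2 == r)%:R * (barPhi (muA M * y.2%:R + dotprod (L M i) w + y.1) <= t)%R%:R.

Lemma sd_gt0 m (i : 'I_m) : 0 < sd_ i.
Proof. by rewrite sqrtr_gt0 Sigma_diag_gt0. Qed.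

Lemma sd_sqr m (i : 'I_m) : sd_ i ^+ 2 = Sigma M m i i.
Proof. by rewrite sqr_sqrtr// ltW// Sigma_diag_gt0. Qed.

Lemma ind01 m (i : 'I_m) r t y : 0 <= ind i r t y <= 1.
Proof. by rewrite /ind -natrM mulnb ler0n lern1 leq_b1. Qed.

Lemma measurable_boolfun d' (U : measurableType d') (b : U -> bool) :
  measurable_fun setT b -> measurable_fun setT (fun x => (b x)%:R : R).
Proof.
move=> mb; rewrite (_ : (fun x => _) = \1_[set x | b x]).
  apply: measurable_indic; rewrite -[X in measurable X]setTI.
  have : measurable (setT `&` b @^-1` [set true]) by exact: mb.
  exact.
by apply/funext => x; rewrite indic_bool.
Qed.

Lemma measurable_ind m (i : 'I_m) r t : measurable_fun setT (ind i r t).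
Proof.
have m1 := @measurable_fst _ _ (measurableTypeR R) bool.
have m2 := @measurable_snd _ _ (measurableTypeR R) bool.
apply: measurable_funM; apply: measurable_boolfun.
  apply: (measurableT_comp (f := fun b : bool => b == r)) m2.
  by [].
apply: measurable_fun_ler => //; apply: measurableT_comp; first exact: measurable_barPhi.
apply: measurable_funD => //; apply: measurable_funD => //; apply: measurable_funM => //.
exact: (measurable_boolfun m2).
Qed.

Lemma bmf_ind m (i : 'I_m) r t : bmf (fun x => ind i r t (xi M i x)).
Proof.
apply: (@bmf_xi_fun _ _ _ P k M m (fun i => ind i r t) 1).
  by move=> j; exact: measurable_ind.
by move=> j y; have := ind01 j r t y; rewrite ler_norml; lra.
Qed.

Lemma ind_xi m (i : 'I_m) r t x :
  ind i r t (xi M i x) = (H M i x == r)%:R * (pvalue M i w x <= t)%R%:R.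
Proof. by []. Qed.

Lemma ind_xi_indic m (i : 'I_m) r t x : ind i r t (xi M i x) =
  \1_[set x | (pvalue M i w x <= t) && (H M i x == r)] x.
Proof.
by rewrite ind_xi (indic_bool (fun x => (pvalue M i w x <= t) && (H M i x == r)))
  -mulnb natrM mulrC.
Qed.

Lemma measurable_pvalue m (i : 'I_m) : measurable_fun setT (pvalue M i w).
Proof.
apply: measurableT_comp; first exact: measurable_barPhi.
apply: measurable_funD; last exact: measurable_eps.
apply: measurable_funD => //; apply: measurable_funM => //.
by apply: measurable_boolfun; exact: measurable_H.
Qed.

Lemma measurable_Hset m (i : 'I_m) (B : set bool) : measurable (H M i @^-1` B).
Proof. by rewrite -[X in measurable X]setTI; exact: measurable_H. Qed.

Lemma measurable_HE m (i : 'I_m) r : measurable [set x | H M i x = r].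
Proof. exact: (measurable_Hset i [set r]). Qed.

Lemma measurable_pset m (i : 'I_m) r t :
  measurable [set x | (pvalue M i w x <= t) && (H M i x == r)].
Proof.
rewrite (_ : [set x | _] = [set x | pvalue M i w x <= t] `&` [set x | H M i x = r]).
  apply: measurableI; last exact: measurable_HE.
  by apply: measurable_le_cst; exact: measurable_pvalue.
by apply/seteqP; split => x /= => [/andP[-> /eqP]//|[-> ->]]; rewrite eqxx.
Qed.

Lemma prob_H m (i : 'I_m) r : fine (P [set x | H M i x = r]) = pi_ M m r.
Proof.
have [_ PH _] := H_law M m; case: r => /=; first by rewrite PH.
rewrite (_ : [set x | H M i x = false] = ~` [set x | H M i x = true]); last first.
  by apply/seteqP; split => x /=; case: (H M i x).
rewrite fineP_setC; last exact: measurable_HE.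
by rewrite PH.
Qed.

Lemma pi_gt0 m r : (0 < m)%N -> 0 < pi_ M m r.
Proof. by move=> m0; have := pi1_range M m0; case: r => /=; lra. Qed.

Lemma Ex_ind m (i : 'I_m) r t : (0 < m)%N ->
  Ex P (fun x => ind i r t (xi M i x)) = pi_ M m r * gamma_ M w i r t.
Proof.
move=> m0; rewrite /gamma_ prob_H mulrC divfK ?gt_eqF ?pi_gt0//.
rewrite (eq_Ex P (ind_xi_indic i r t)) Ex_indic; last exact: measurable_pset.
congr (fine (P _)); apply/seteqP; split => x /= => [/andP[-> /eqP]//|[-> ->]].
by rewrite eqxx.
Qed.

Lemma FmE m r t : Fm M w m r t = m%:R^-1 * \sum_(i < m) Ex P (fun x => ind i r t (xi M i x)).
Proof.
case: m => [|m]; first by rewrite /Fm !big_ord0 !mulr0.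
rewrite /Fm mulr_sumr mulr_sumr; apply: eq_bigr => i _.
by rewrite Ex_ind//; ring.
Qed.

Lemma FhatE m r t x : Fhat M w m r t x = m%:R^-1 * \sum_(i < m) ind i r t (xi M i x).
Proof. by []. Qed.

Lemma sqrt_natV (n : nat) : Num.sqrt n%:R * n%:R^-1 = (Num.sqrt n%:R)^-1 :> R.
Proof.
case: n => [|n]; first by rewrite sqrtr0 mul0r invr0.
by rewrite -{2}(sqr_sqrtr (ler0n R n.+1)) expr2 invfM mulrA divff ?mul1r// gt_eqF// sqrtr_gt0.
Qed.

Lemma WprocE m r t x : Wproc M w m r t x = (Num.sqrt m%:R)^-1 *
  \sum_(i < m) (ind i r t (xi M i x) - Ex P (fun x => ind i r t (xi M i x))).
Proof.
rewrite /Wproc FhatE FmE -mulrBr mulrA sqrt_natV; congr (_ * _).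
by rewrite sumrB.
Qed.

Lemma bmf_Fhat m r t : bmf (Fhat M w m r t).
Proof.
rewrite (_ : Fhat M w m r t = fun x => m%:R^-1 * \sum_(i < m) ind i r t (xi M i x))//.
by apply: bmfZ; apply: bmf_sum => i; exact: bmf_ind.
Qed.

Lemma bmf_Wproc m r t : bmf (Wproc M w m r t).
Proof.
by apply: bmfZ; apply: bmfB; [exact: bmf_Fhat|exact: bmf_cst].
Qed.

Lemma Ex_Wproc m r t : Ex P (Wproc M w m r t) = 0.
Proof.
rewrite (eq_Ex P (@WprocE m r t)) ExZ; last first.
  by apply: bmf_sum => i; apply: bmfB; [exact: bmf_ind|exact: bmf_cst].
rewrite Ex_sum => [|i]; last by apply: bmfB; [exact: bmf_ind|exact: bmf_cst].
rewrite big1 ?mulr0// => i _.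
by rewrite ExB ?Ex_cst ?subrr//; [exact: bmf_ind|exact: bmf_cst].
Qed.

Lemma ind_mono m (i : 'I_m) r s t y : s <= t -> ind i r s y <= ind i r t y.
Proof.
move=> st; rewrite /ind ler_wpM2l// ler_nat.
by case: (leP _ s) => // h; rewrite (le_trans h st).
Qed.

Lemma Fhat_mono m r x : {homo Fhat M w m r ^~ x : s t / s <= t}.
Proof.
move=> s t st; rewrite !FhatE ler_wpM2l ?invr_ge0//.
by apply: ler_sum => i _; exact: ind_mono.
Qed.

Lemma Fm_mono m r : {homo Fm M w m r : s t / s <= t}.
Proof.
move=> s t st; rewrite !FmE ler_wpM2l ?invr_ge0//.
apply: ler_sum => i _; apply: Ex_le => [||x]; [exact: bmf_ind..|].
exact: ind_mono.
Qed.

Lemma Fm_ge0 m r t : 0 <= Fm M w m r t.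
Proof.
rewrite FmE mulr_ge0 ?invr_ge0//; apply: sumr_ge0 => i _; apply: Ex_ge0 => x.
by case/andP: (ind01 i r t (xi M i x)).
Qed.

Lemma Fm_le1 m r t : Fm M w m r t <= 1.
Proof.
rewrite FmE; case: m => [|m]; first by rewrite big_ord0 mulr0.
rewrite ler_pdivrMl ?ltr0n// mulr1.
apply: (@le_trans _ _ (\sum_(i < m.+1) 1)); last by rewrite sumr_const card_ord.
apply: ler_sum => i _; rewrite -(Ex_cst P 1); apply: Ex_le => [||x].
- exact: bmf_ind.
- exact: bmf_cst.
- by case/andP: (ind01 i r t (xi M i x)).
Qed.

Lemma Wproc_increment (C eta : R) m r s t : poly_mixing M C -> 0 < eta -> s <= t ->
  (0 < m)%N ->
  Ex P (fun x => (Wproc M w m r t x - Wproc M w m r s x) ^+ 2) <=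
  (1 + 8 * C) * ((Fm M w m r t - Fm M w m r s) / eta + eta).
Proof.
move=> mixC eta0 st m0.
pose phi (i : 'I_m) y := ind i r t y - ind i r s y.
have mphi i : measurable_fun setT (phi i) by apply: measurable_funB; exact: measurable_ind.
have phi01 i y : 0 <= phi i y <= 1.
  have := ind_mono i r y st; have := ind01 i r t y; have := ind01 i r s y.
  by rewrite /phi; lra.
have Ephi i : Ex P (fun x => phi i (xi M i x)) =
    Ex P (fun x => ind i r t (xi M i x)) - Ex P (fun x => ind i r s (xi M i x)).
  by rewrite ExB//; exact: bmf_ind.
have := var_indicators mixC eta0 mphi phi01.
have -> : \sum_i (Ex P (fun x => phi i (xi M i x)) / eta + eta) =
    m%:R * ((Fm M w m r t - Fm M w m r s) / eta + eta).
  have m0' : m%:R != 0 :> R by rewrite pnatr_eq0 -lt0n.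
  rewrite big_split/= sumr_const card_ord -[eta *+ m]mulr_natl mulrDr; congr (_ + _).
  rewrite -mulr_suml !FmE -mulrBr mulrA; congr (_ / _).
  rewrite mulVKf// -sumrB; apply: eq_bigr => i _; exact: Ephi.
have r0 : 0 < Num.sqrt m%:R :> R by rewrite sqrtr_gt0 ltr0n.
have -> : Ex P (fun x => (Wproc M w m r t x - Wproc M w m r s x) ^+ 2) =
  m%:R^-1 * Ex P (fun x => (\sum_i (phi i (xi M i x) - Ex P (fun x => phi i (xi M i x)))) ^+ 2).
  have bph i : bmf (fun x => phi i (xi M i x)) by apply: bmfB; exact: bmf_ind.
  rewrite -ExZ; last first.
    by apply: bmfX; apply: bmf_sum => i; apply: bmfB => //; exact: bmf_cst.
  apply: eq_Ex => x; rewrite !WprocE -mulrBr exprMn exprVn sqr_sqrtr//; congr (_ * _ ^+ 2).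
  by rewrite -sumrB; apply: eq_bigr => i _; rewrite Ephi /phi; ring.
move=> h; rewrite ler_pdivrMl ?ltr0n//.
by rewrite mulrCA.
Qed.

Lemma pvalue_gt0 m (i : 'I_m) x : 0 < pvalue M i w x.
Proof. exact: barPhi_gt0. Qed.

Lemma ind0 m (i : 'I_m) r y : ind i r 0 y = 0.
Proof. by rewrite /ind leNgt barPhi_gt0/= mulr0. Qed.

Lemma Wproc0 m r x : Wproc M w m r 0 x = 0.
Proof.
rewrite WprocE big1 ?mulr0// => i _.
by rewrite (eq_Ex P (fun x => ind0 i r _)) Ex_cst ind0 subrr.
Qed.

(** The increment bound from 0 with eta = 1; the process vanishes at 0 because p-values are
    positive. *)
Lemma Wproc_var (C : R) m r t : poly_mixing M C -> (0 < m)%N -> 0 <= t ->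
  Ex P (fun x => Wproc M w m r t x ^+ 2) <= 2 * (1 + 8 * C).
Proof.
move=> mixC m0 t0; have := @Wproc_increment C 1 m r 0 t mixC ltr01 t0 m0.
rewrite (@eq_Ex _ _ _ P _ (fun x => Wproc M w m r t x ^+ 2)); last first.
  by move=> x; rewrite Wproc0 subr0.
move=> /le_trans; apply; rewrite mulrC ler_wpM2r//.
  by case: mixC => C0 _; rewrite addr_ge0// mulr_ge0.
by have := Fm_le1 m r t; have := Fm_ge0 m r 0; rewrite divr1; lra.
Qed.

Lemma Wproc_chebyshev (C c : R) m r t : poly_mixing M C -> (0 < m)%N -> 0 <= t -> 0 < c ->
  fine (P [set x | c <= `|Wproc M w m r t x|]) <= 2 * (1 + 8 * C) / c ^+ 2.
Proof.
move=> mixC m0 t0 c0; apply: le_trans (chebyshev2 P (bmf_Wproc m r t) c0) _.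
by rewrite ler_pM2r ?invr_gt0 ?exprn_gt0// Wproc_var.
Qed.

End conditional_model.

(** * Covariances of the empirical processes, their limits, and the central limit theorem at a
    point *)

Section covariance_limit.
Context {d : measure_display} {T : measurableType d} {R : realType}.
Context {P : probability T R} {k : nat}.
Variables (M : factor_model P k) (w : 'rV[R]_k).
Local Notation N01 := (normal_prob (0 : R) 1).
Local Notation shift i r := (shift_ M w i r).
Local Notation sd i := (sd_ M i).

Lemma measurable_std_noise m (i : 'I_m) : measurable_fun setT (std_noise M i).
Proof. by apply: measurable_funM => //; exact: measurable_eps. Qed.

Lemma pvalue_std_noise m (i : 'I_m) r (u : R) x : H M i x = r ->
  (pvalue M i w x <= barPhi u) = ((u - shift i r) / sd i <= std_noise M i x).
Proof.
move=> Hr; rewrite /pvalue Hr barPhi_le /std_noise [_ / sd i]mulrC.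
rewrite ler_pM2l ?invr_gt0 ?sd_gt0//.
by rewrite lerBlDl.
Qed.

Lemma quadratic_form_delta n (S : 'M[R]_n) (i j : 'I_n) (s t : R) : S^T = S ->
  let a : 'rV[R]_n := s *: delta_mx 0 i + t *: delta_mx 0 j in
  (a *m S *m a^T) 0 0 = s ^+ 2 * S i i + t ^+ 2 * S j j + 2 * (s * t * S i j).
Proof.
move=> symS a.
have dS (l l' : 'I_n) :
    (delta_mx 0 l *m S *m (delta_mx 0 l')^T : 'M[R]_(1, 1)) 0 0 = S l l'.
  by rewrite -rowE trmx_delta -colE !mxE.
have Sji : S j i = S i j by rewrite -[in LHS]symS mxE.
have := dS i i; have := dS i j; have := dS j i; have := dS j j; rewrite Sji.
rewrite /a linearD/= !linearZ/= !mulmxDl !mulmxDr -?scalemxAl -?scalemxAr -?scalemxAl.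
move: (_ *m _ *m _) (_ *m _ *m _) (_ *m _ *m _) (_ *m _ *m _) => A B C D.
by rewrite !mxE => -> -> -> ->; ring.
Qed.

Lemma Ex_cos_std_noise m (i j : 'I_m) (s t c : R) :
  Ex P (fun x => cos (s * std_noise M i x + t * std_noise M j x + c)) =
  expR (- ((s ^+ 2 + t ^+ 2 + 2 * (s * t * noise_corr M i j)) / 2)) * cos c.
Proof.
have [Ssym Spos _ law] := eps_law M m.
pose a : 'rV[R]_m := (s / sd i) *: delta_mx 0 i + (t / sd j) *: delta_mx 0 j.
have sumE x : \sum_(l < m) a 0 l * eps M l x = s * std_noise M i x + t * std_noise M j x.
  have pick (l : 'I_m) (y : R) : \sum_(l' < m) y * (l' == l)%:R * eps M l' x = y * eps M l x.
    rewrite (bigD1 l)//= eqxx mulr1 big1 ?addr0// => l' /negbTE ->.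
    by rewrite mulr0 mul0r.
  rewrite /a; under eq_bigr => l _ do rewrite !mxE eqxx/= mulrDl.
  by rewrite big_split/= !pick /std_noise !mulrA.
have varE : (a *m Sigma M m *m a^T) 0 0 = s ^+ 2 + t ^+ 2 + 2 * (s * t * noise_corr M i j).
  rewrite quadratic_form_delta// -!sd_sqr /noise_corr sqrtrM ?ltW ?Sigma_diag_gt0//.
  rewrite -/(sd i) -/(sd j).
  have /gt_eqF di := sd_gt0 M i; have /gt_eqF dj := sd_gt0 M j.
  by field; rewrite di dj.
have := @Ex_cos_law R _ T P (fun x => s * std_noise M i x + t * std_noise M j x)
  ((a *m Sigma M m *m a^T) 0 0) 1 c (Spos a).
rewrite varE expr1n mulr1 => <-.
- by apply: eq_Ex => x; rewrite mul1r.
- by apply: measurable_funD; apply: measurable_funM => //; exact: measurable_std_noise.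
- move=> A mA; rewrite -varE -law//; congr (P _).
  by apply/seteqP; split => x; rewrite /= sumE.
Qed.

(** Cauchy-Schwarz: the standardized quadratic form 1 + t ^ 2 + 2 t r is nonnegative, and t = - r
    leaves 1 - r ^ 2. *)
Lemma noise_corr_sqr_le1 m (i j : 'I_m) : noise_corr M i j ^+ 2 <= 1.
Proof.
have [Ssym Spos _ _] := eps_law M m.
set r := noise_corr M i j.
suff h (t : R) : 0 <= 1 + t ^+ 2 + 2 * (t * r).
  by have := h (- r); lra.
have := Spos ((1 / sd i) *: delta_mx 0 i + (t / sd j) *: delta_mx 0 j).
rewrite quadratic_form_delta// -!sd_sqr.
have di := sd_gt0 M i; have dj := sd_gt0 M j.
have -> : Sigma M m i j = r * (sd i * sd j).
  rewrite /r /noise_corr sqrtrM ?ltW ?Sigma_diag_gt0// -/(sd i) -/(sd j).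
  by rewrite divfK// mulf_eq0 !gt_eqF.
suff -> : (1 / sd i) ^+ 2 * sd i ^+ 2 + (t / sd j) ^+ 2 * sd j ^+ 2 +
  2 * (1 / sd i * (t / sd j) * (r * (sd i * sd j))) = 1 + t ^+ 2 + 2 * (t * r) by [].
by field; rewrite !gt_eqF.
Qed.

(** A Gaussian vector prescribes only the laws of linear combinations. Their cosine transforms agree
    with those of the pair realizing [rho_tilde], and [cos_eq_joint] recovers the quadrant
    probabilities. *)
Lemma std_noise_joint m (i j : 'I_m) (x y : R) :
  fine (P [set o | (x <= std_noise M i o) && (y <= std_noise M j o)]) =
  fine ((N01 \x N01)%E [set z : R * R | (x <= z.1) &&
    (y <= noise_corr M i j * z.1 + Num.sqrt (1 - noise_corr M i j ^+ 2) * z.2)]).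
Proof.
have m1 := @measurable_fst _ _ (measurableTypeR R) (measurableTypeR R).
have m2 := @measurable_snd _ _ (measurableTypeR R) (measurableTypeR R).
pose Q : probability _ R := (N01 \x N01)%E.
apply: (@cos_eq_joint _ _ _ P _ _ Q).
- exact: measurable_std_noise.
- exact: measurable_std_noise.
- exact: m1.
- by apply: measurable_funD; apply: measurable_funM.
- move=> s t c; rewrite Ex_cos_std_noise; symmetry; apply: Ex_cos_prod_normal.
  exact: noise_corr_sqr_le1.
Qed.

Lemma std_noise_ge m (i : 'I_m) (x : R) :
  fine (P [set o | x <= std_noise M i o]) = barPhi x.
Proof.
have [Ssym _ _ law] := eps_law M m.
have di := sd_gt0 M i.
rewrite barPhiE.
have mA : measurable ([set y | x <= y] : set (measurableTypeR R)).
  by rewrite -[X in measurable X]setTI; apply: measurable_fun_ler.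
have := law ((sd i)^-1 *: delta_mx 0 i) _ mA.
rewrite (_ : (_ *m _ *m _) 0 0 = 1) /centered_normal ?oner_eq0 ?sqrtr1 => [<-|].
  congr (fine (P _)); apply/seteqP; split => o /=; rewrite (bigD1 i)//= big1 ?addr0 ?mxE ?eqxx ?mulr1//.
    by move=> l /negbTE li; rewrite !mxE li andbF mulr0 mul0r.
  by move=> l /negbTE li; rewrite !mxE li andbF mulr0 mul0r.
have := @quadratic_form_delta _ _ i i (sd i)^-1 0 Ssym; rewrite /= scale0r addr0 => ->.
by rewrite -sd_sqr; field; rewrite gt_eqF.
Qed.

Lemma g_sigma_preimage_coord d1 (U : measurableType d1) (S : pointedType) n
    (f : 'I_n -> S -> U) i (B : set U) :
  measurable B -> g_sigma_preimage f (f i @^-1` B).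
Proof.
move=> mB; apply: sub_sigma_algebra; rewrite (bigD1 i)//=; left.
by exists B => //; rewrite setTI.
Qed.

Lemma g_sigma_preimageI d1 (U : measurableType d1) (S : pointedType) n
    (f : 'I_n -> S -> U) (A B : set S) :
  g_sigma_preimage f A -> g_sigma_preimage f B -> g_sigma_preimage f (A `&` B).
Proof. exact: (@measurableI _ (g_sigma_algebraType _)). Qed.

Lemma measurable_std_noise_ge m (i : 'I_m) (x : R) :
  measurable [set o | x <= std_noise M i o].
Proof. by apply: measurable_ge_cst; exact: measurable_std_noise. Qed.

Lemma H_noise_independent m (i j : 'I_m) (r0 r1 : bool) (x y : R) :
  fine (P [set o | ((H M i o == r0) && (H M j o == r1)) &&
     ((x <= std_noise M i o) && (y <= std_noise M j o))]) =
  fine (P [set o | (H M i o == r0) && (H M j o == r1)]) *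
  fine (P [set o | (x <= std_noise M i o) && (y <= std_noise M j o)]).
Proof.
have ind3 := @H_eps_W_independent _ _ _ _ _ M m.
have setTE (h : T -> bool) (A : set T) : (forall o, A o <-> h o) -> [set o | h o] = A.
  by move=> hA; apply/seteqP; split => o /=; rewrite hA.
have noiseE (l : 'I_m) z : [set o | z <= std_noise M l o] = eps M l @^-1` [set u | sd l * z <= u].
  apply/seteqP; split => o /=; rewrite /std_noise ler_pdivlMl ?sd_gt0//.
have mge (z : R) : measurable [set u : R | z <= u].
  by rewrite -[X in measurable X]setTI; apply: measurable_fun_ler.
pose A := (H M i @^-1` [set r0]) `&` (H M j @^-1` [set r1]).
pose B := (eps M i @^-1` [set u | sd i * x <= u]) `&` (eps M j @^-1` [set u | sd j * y <= u]).
have EA : [set o | (H M i o == r0) && (H M j o == r1)] = A.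
  apply: setTE => o; split => [[/= hi hj]|/andP[/eqP hi /eqP hj]]; last by split.
  by rewrite hi hj !eqxx.
have EB : [set o | (x <= std_noise M i o) && (y <= std_noise M j o)] = B.
  rewrite /B -!noiseE; apply: setTE => o.
  by split => [[/= h1 h2]|/andP[h1 h2]]; [apply/andP|]; split.
rewrite EA EB -[RHS]mulr1.
have -> : [set o | ((H M i o == r0) && (H M j o == r1)) &&
     ((x <= std_noise M i o) && (y <= std_noise M j o))] = A `&` B `&` setT.
  rewrite setIT -EA -EB; apply/seteqP; split => o /=; first by move=> /andP[].
  by move=> [-> ->].
rewrite ind3.
- by have := probability_setT P; rewrite /= => ->.
- by apply: g_sigma_preimageI; exact: g_sigma_preimage_coord.
- by apply: g_sigma_preimageI; exact: g_sigma_preimage_coord.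
- exact: (@measurableT _ (g_sigma_algebraType _)).
Qed.

Lemma prob_H_pair m (i j : 'I_m) r0 r1 : i != j ->
  fine (P [set o | (H M i o == r0) && (H M j o == r1)]) = pi_ M m r0 * pi_ M m r1.
Proof.
move=> ij; have [_ _ prodr] := H_law M m.
have := prodr [set i; j]%SET (fun l => if l == i then [set r0] else [set r1]).
rewrite (big_setU1 _ _)/= ?inE// big_set1 eqxx eq_sym (negbTE ij).
rewrite -(prob_H M i r0) -(prob_H M j r1) => <-.
congr (fine (P _)); apply/seteqP; split => o /=.
  by move=> /andP[/eqP hi /eqP hj] l /=; rewrite !inE => /orP[]/eqP ->; rewrite ?eqxx// eq_sym (negbTE ij).
move=> h; have := h i; have := h j; rewrite /= !inE !eqxx orbT eq_sym (negbTE ij)/=.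
by move=> -> // -> //; rewrite !eqxx.
Qed.

Lemma gammaE m (i : 'I_m) r (u : R) : (0 < m)%N ->
  gamma_ M w i r (barPhi u) = barPhi ((u - shift i r) / sd i).
Proof.
move=> m0; set y := _ / sd i.
rewrite /gamma_ prob_H -(std_noise_ge i y).
(* Equal coordinates and thresholds reduce the statement for pairs to one hypothesis and its
   noise. *)
have := H_noise_independent i i r r y y.
have -> : [set o | ((H M i o == r) && (H M i o == r)) &&
  ((y <= std_noise M i o) && (y <= std_noise M i o))] =
  [set o | pvalue M i w o <= barPhi u /\ H M i o = r].
  apply/seteqP; split => o /=; rewrite !andbb.
    by move=> /andP[/eqP Hr yo]; rewrite (pvalue_std_noise _ Hr).
  by move=> [po Hr]; rewrite Hr eqxx/= -(pvalue_std_noise _ Hr).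
under [X in _ = fine (P X) * _]eq_set => o do rewrite andbb.
under [X in _ = _ * fine (P X)]eq_set => o do rewrite andbb.
move=> ->.
have -> : [set o | H M i o == r] = [set o | H M i o = r].
  by apply/seteqP; split => o /= /eqP.
by rewrite prob_H mulrAC divff ?mul1r ?gt_eqF ?pi_gt0.
Qed.
Lemma cov_centerE (f g : T -> R) : bmf f -> bmf g ->
  cov P f g = Ex P (fun x => (f x - Ex P f) * (g x - Ex P g)).
Proof.
move=> bf bg.
rewrite (@eq_Ex _ _ _ P _ (fun x => f x * g x + (- Ex P f * g x + (- Ex P g * f x + Ex P f * Ex P g)))); last first.
  by move=> x; ring.
have b1 : bmf (fun x : T => - Ex P g * f x + Ex P f * Ex P g).
  by apply: bmfD; [exact: bmfZ|exact: bmf_cst].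
have b2 : bmf (fun x : T => - Ex P f * g x) by exact: bmfZ.
rewrite ExD; [|exact: bmfM|exact: bmfD].
rewrite ExD// ExD; [|exact: bmfZ|exact: bmf_cst].
by rewrite Ex_cst !ExZ// /cov; ring.
Qed.

(** Writing t as barPhi u turns every threshold of [rho_tilde] into a real number. Independence of
    the two H's from each other and from the noises takes out the weights [pi_], leaving a quadrant
    probability minus the product of its marginals. *)
Lemma cov_ind_distinct m (i j : 'I_m) r0 r1 (t : R) : (0 < m)%N -> 0 < t < 1 -> i != j ->
  cov P (fun x => ind M w i r0 t (xi M i x)) (fun x => ind M w j r1 t (xi M j x)) =
  pi_ M m r0 * pi_ M m r1 *
    rho_tilde (gamma_ M w i r0 t) (gamma_ M w j r1 t) (noise_corr M i j).
Proof.
move=> m0 t01 ij; rewrite /cov !Ex_ind//.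
have [u tu] := barPhi_surj t01; rewrite -tu !gammaE//.
set y := (_ / sd i); set z := (_ / sd j).
suff -> : Ex P (fun x => ind M w i r0 (barPhi u) (xi M i x) * ind M w j r1 (barPhi u) (xi M j x)) =
  pi_ M m r0 * pi_ M m r1 * fine (P [set o | (y <= std_noise M i o) && (z <= std_noise M j o)]).
  rewrite std_noise_joint /rho_tilde !barPhi_inv_barPhi.
  rewrite (_ : [set o : R * R | _ /\ _] = [set o : R * R | (y <= o.1) &&
    (z <= noise_corr M i j * o.1 + Num.sqrt (1 - noise_corr M i j ^+ 2) * o.2)]); last first.
    by apply/seteqP; split => o /=; rewrite !lee_fin => /andP.
  move: (fine _) (barPhi y) (barPhi z) (pi_ M m r0) (pi_ M m r1) => *; ring.
rewrite -(prob_H_pair r0 r1 ij) -H_noise_independent.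
rewrite -Ex_indic; last first.
  rewrite (_ : [set o | _] = (H M i @^-1` [set r0] `&` H M j @^-1` [set r1]) `&`
      ([set o | y <= std_noise M i o] `&` [set o | z <= std_noise M j o])).
    by apply: measurableI; apply: measurableI; exact: measurable_Hset || exact: measurable_std_noise_ge.
  apply/seteqP; split => o /=; first by move=> /andP[/andP[/eqP-> /eqP->] /andP[-> ->]].
  by move=> [[-> ->] [-> ->]]; rewrite !eqxx.
apply: eq_Ex => x; rewrite !ind_xi -!natrM !mulnb.
rewrite (indic_bool (fun o => ((H M i o == r0) && (H M j o == r1)) &&
     ((y <= std_noise M i o) && (z <= std_noise M j o)))).
congr (_%:R); congr nat_of_bool.
have [hi|//] := eqVneq (H M i x) r0; have [hj|/=] := eqVneq (H M j x) r1; last by rewrite andbF.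
by rewrite (pvalue_std_noise _ hi) (pvalue_std_noise _ hj).
Qed.

Lemma cov_ind_same m (i : 'I_m) r0 r1 (t : R) : (0 < m)%N ->
  cov P (fun x => ind M w i r0 t (xi M i x)) (fun x => ind M w i r1 t (xi M i x)) =
  (r0 == r1)%:R * Ex P (fun x => ind M w i r0 t (xi M i x)) -
  pi_ M m r0 * pi_ M m r1 * (gamma_ M w i r0 t * gamma_ M w i r1 t).
Proof.
move=> m0; rewrite /cov; congr (_ - _); last by rewrite !Ex_ind//; ring.
rewrite -ExZ; last exact: bmf_ind.
apply: eq_Ex => x; rewrite !ind_xi.
have [<-|r01] := eqVneq r0 r1.
  by case: (H M i x == r0); case: (_ <= t); rewrite /= ?(mul0r, mul1r).
rewrite mul0r; have [h0|h0] := eqVneq (H M i x) r0; last by rewrite mul0r mul0r.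
by rewrite h0 (negbTE r01) mul0r mulr0.
Qed.

(** The value of [cov_m] at (t, t) for 0 < t < 1 and positive m, arranged as three sequences with
    known limits: the first two come from equal indices, the third from distinct ones. *)
Definition cov_formula m r0 r1 t : R :=
  (r0 == r1)%:R * Fm M w m r0 t -
  pi_ M m r0 * pi_ M m r1 / m%:R * (\sum_(i < m) gamma_ M w i r0 t * gamma_ M w i r1 t) +
  pi_ M m r0 * pi_ M m r1 / m%:R * (\sum_(i < m) \sum_(j < m | j != i)
     rho_tilde (gamma_ M w i r0 t) (gamma_ M w j r1 t) (noise_corr M i j)).

Lemma Ex_WprocM m r0 r1 (t : R) : (0 < m)%N -> 0 < t < 1 ->
  Ex P (fun x => Wproc M w m r0 t x * Wproc M w m r1 t x) = cov_formula m r0 r1 t.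
Proof.
move=> m0 t01.
pose X r (i : 'I_m) x := ind M w i r t (xi M i x).
have bX r i : bmf (X r i) by exact: bmf_ind.
have bS r : bmf (fun x => \sum_i X r i x) by apply: bmf_sum => i; exact: bX.
have ES r : Ex P (fun x => \sum_i X r i x) = \sum_i Ex P (X r i) by exact: Ex_sum.
have bY r i : bmf (fun x => X r i x - Ex P (X r i)) by apply: bmfB => //; exact: bmf_cst.
have -> : Ex P (fun x => Wproc M w m r0 t x * Wproc M w m r1 t x) =
   m%:R^-1 * cov P (fun x => \sum_i X r0 i x) (fun x => \sum_i X r1 i x).
  have -> : cov P (fun x => \sum_i X r0 i x) (fun x => \sum_i X r1 i x) =
    Ex P (fun x => (\sum_i X r0 i x - Ex P (fun x => \sum_i X r0 i x)) *
      (\sum_i X r1 i x - Ex P (fun x => \sum_i X r1 i x))).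
    exact: cov_centerE.
  rewrite -ExZ; last by apply: bmfM; apply: bmfB => //; exact: bmf_cst.
  apply: eq_Ex => x; rewrite !WprocE mulrACA -invfM -expr2 sqr_sqrtr//.
  by congr (_ * (_ * _)); rewrite sumrB ES.
rewrite cov_suml//; under eq_bigr => i _ do rewrite covC cov_suml//.
under eq_bigr => i _ do under eq_bigr => j _ do rewrite covC.
have -> : \sum_(i < m) \sum_(j < m) cov P (X r0 i) (X r1 j) =
   \sum_(i < m) cov P (X r0 i) (X r1 i) + \sum_(i < m) \sum_(j < m | j != i) cov P (X r0 i) (X r1 j).
  rewrite -big_split/=; apply: eq_bigr => i _; by rewrite (bigD1 i).
transitivity (m%:R^-1 * (\sum_(i < m) ((r0 == r1)%:R * Ex P (X r0 i) -
     pi_ M m r0 * pi_ M m r1 * (gamma_ M w i r0 t * gamma_ M w i r1 t)) +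
   \sum_(i < m) pi_ M m r0 * pi_ M m r1 * \sum_(j < m | j != i)
     rho_tilde (gamma_ M w i r0 t) (gamma_ M w j r1 t) (noise_corr M i j))).
  congr (_ * (_ + _)); apply: eq_bigr => i _; first exact: cov_ind_same.
  rewrite mulr_sumr; apply: eq_bigr => j ji; apply: cov_ind_distinct => //.
  by rewrite eq_sym.
rewrite sumrB -mulr_sumr -mulr_sumr.
rewrite -mulr_sumr /cov_formula FmE.
by ring.
Qed.

Lemma fine_expectation (f : T -> R) : fine ('E_P[f])%E = Ex P f.
Proof. by rewrite unlock. Qed.

Lemma cov_mE m r0 r1 (t : R) :
  cov_m M w m r0 r1 t t = Ex P (fun x => Wproc M w m r0 t x * Wproc M w m r1 t x).
Proof.
rewrite /cov_m unlock !fine_expectation !Ex_Wproc.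
by apply: eq_Ex => x /=; rewrite !mulrfctE /= !subr0.
Qed.

Definition cov_terms_cvg (t : R) := forall r0 r1 : bool,
  [/\ cvgn (fun m => Fm M w m r0 t),
      cvgn (fun m => pi_ M m r0 * pi_ M m r1 / m%:R *
        \sum_(i < m) gamma_ M w i r0 t * gamma_ M w i r1 t)
    & cvgn (fun m => pi_ M m r0 * pi_ M m r1 / m%:R *
        \sum_(i < m) \sum_(j < m | j != i)
          rho_tilde (gamma_ M w i r0 t) (gamma_ M w j r1 t) (noise_corr M i j))].

Lemma cov_m_cvg (t : R) r0 r1 : 0 < t < 1 -> cov_terms_cvg t ->
  cov_m M w m r0 r1 t t @[m --> \oo] --> cov_lim M w r0 r1 t t.
Proof.
move=> t01 /(_ r0 r1)[c1 c2 c3].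
have h : cvgn (fun m => cov_formula m r0 r1 t).
  apply: is_cvgD => //; apply: is_cvgB => //; apply: is_cvgM => //; exact: is_cvg_cst.
rewrite /cov_lim.
suff : cvgn (fun m => cov_m M w m r0 r1 t t) by [].
apply/cvg_ex; exists (limn (fun m => cov_formula m r0 r1 t)).
apply: cvg_trans h; apply: near_eq_cvg; near=> m.
by rewrite cov_mE Ex_WprocM//; near: m; exact: nbhs_infty_gt.
Unshelve. all: by end_near. Qed.

Definition quad_var (a0 a1 t : R) :=
  a0 ^+ 2 * cov_lim M w false false t t + a1 ^+ 2 * cov_lim M w true true t t +
  2 * a1 * a0 * cov_lim M w true false t t.

Lemma Wproc_lin_var (a0 a1 t : R) : 0 < t < 1 -> cov_terms_cvg t ->
  Ex P (fun x => (a0 * Wproc M w m false t x + a1 * Wproc M w m true t x) ^+ 2) @[m --> \oo]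
    --> quad_var a0 a1 t.
Proof.
move=> t01 ct; rewrite (_ : (fun m => Ex P _) = (fun m =>
  a0 ^+ 2 * cov_m M w m false false t t + a1 ^+ 2 * cov_m M w m true true t t +
  2 * a1 * a0 * cov_m M w m true false t t)).
  apply: cvgD; [apply: cvgD|]; apply: cvgM; solve [exact: cvg_cst | exact: cov_m_cvg].
apply/funext => m; rewrite !cov_mE.
have b r := @bmf_Wproc _ _ _ _ _ M w m r t.
rewrite -!ExZ; try exact: bmfM.
rewrite -!ExD; first by apply: eq_Ex => x; ring.
all: by do ?apply: bmfD; apply: bmfZ; apply: bmfM.
Qed.

Lemma Wproc_clt (C a0 a1 t : R) : poly_mixing M C -> 0 < t < 1 -> cov_terms_cvg t ->
  forall s c, Ex P (fun x => cos (s * (a0 * Wproc M w m false t x + a1 * Wproc M w m true t x) + c))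
    @[m --> \oo] --> expR (- (quad_var a0 a1 t * s ^+ 2 / 2)) * cos c.
Proof.
move=> mixC t01 ct s c.
pose phi m (i : 'I_m) y := a0 * ind M w i false t y + a1 * ind M w i true t y.
have mphi m (i : 'I_m) : measurable_fun setT (phi m i).
  by apply: measurable_funD; apply: measurable_funM => //; exact: measurable_ind.
have phib m (i : 'I_m) y : `|phi m i y| <= `|a0| + `|a1|.
  apply: le_trans (ler_normD _ _) _; rewrite (normrM a0) (normrM a1).
  apply: lerD; rewrite ler_piMr//.
    by have := ind01 M w i false t y; rewrite ler_norml; lra.
  by have := ind01 M w i true t y; rewrite ler_norml; lra.
have SE m x : (Num.sqrt m%:R)^-1 *
    \sum_i (phi m i (xi M i x) - Ex P (fun x => phi m i (xi M i x))) =
    a0 * Wproc M w m false t x + a1 * Wproc M w m true t x.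
  rewrite !WprocE mulrCA [a1 * _]mulrCA -mulrDr; congr (_ * _).
  rewrite !mulr_sumr -big_split/=; apply: eq_bigr => i _.
  have b r := @bmf_ind _ _ _ P _ M w m i r t.
  by rewrite ExD ?ExZ//; [rewrite /phi; ring|exact: bmfZ..].
have := mixing_array_cvg mixC mphi phib.
move=> /(_ (quad_var a0 a1 t)) clt.
rewrite (_ : (fun m => _) = (fun m => Ex P (fun x => cos (s * ((Num.sqrt m%:R)^-1 *
    \sum_(i < m) (phi m i (xi M i x) - Ex P (fun x => phi m i (xi M i x)))) + c)))).
  apply: clt; rewrite (_ : (fun m => _) = (fun m =>
    Ex P (fun x => (a0 * Wproc M w m false t x + a1 * Wproc M w m true t x) ^+ 2))).
    exact: Wproc_lin_var.
  by apply/funext => m; apply: eq_Ex => x; rewrite SE.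
by apply/funext => m; apply: eq_Ex => x; rewrite SE.
Qed.

(** In the variable u with t = barPhi u the function is a finite sum of continuous ones.
    Monotonicity carries continuity back to t, since barPhi (u + dl / 2) and barPhi (u - dl / 2)
    enclose a neighbourhood of t. *)
Lemma continuous_Fm m r (t : R) : (0 < m)%N -> 0 < t < 1 -> {for t, continuous (Fm M w m r)}.
Proof.
move=> m0 t01; have [u tu] := barPhi_surj t01.
have cg : {for u, continuous (fun u => Fm M w m r (barPhi u))}.
  rewrite (_ : (fun u => _) = (fun u => pi_ M m r / m%:R *
      \sum_(i < m) barPhi ((u - shift i r) / sd i))).
    apply: continuousM; first exact: cst_continuous.
    elim: (index_enum _) => [|i l IHl].
      rewrite (_ : (fun u => _) = fun=> 0); first exact: cst_continuous.
      by apply/funext => v; rewrite big_nil.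
    rewrite (_ : (fun u => _) = (fun u => barPhi ((u - shift i r) / sd i) +
        \sum_(i <- l) barPhi ((u - shift i r) / sd i))); last first.
      by apply/funext => v; rewrite big_cons.
    apply: continuousD => //.
    apply: (@continuous_comp _ _ _ (fun u => (u - shift i r) / sd i) barPhi); last exact: continuous_barPhi.
    apply: continuousM; last exact: cst_continuous.
    by apply: continuousB; [exact: cvg_id|exact: cst_continuous].
  by apply/funext => v; rewrite /Fm; congr (_ * _); apply: eq_bigr => i _; rewrite gammaE.
apply/cvgrPdist_le => e e0.
move/cvgrPdist_le : cg => /(_ e e0)/nbhs_ballP[dl /= dl0 hd].
have d2 : 0 < dl / 2 by rewrite divr_gt0.
have lo : barPhi (u + dl / 2) < t by rewrite -tu barPhi_lt// ltrDl.
have hi : t < barPhi (u - dl / 2) by rewrite -tu barPhi_lt// ltrBlDr ltrDl.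
have bl : `|Fm M w m r (barPhi u) - Fm M w m r (barPhi (u + dl / 2))| <= e.
  by apply: hd; rewrite /ball/= opprD addNKr normrN gtr0_norm//; lra.
have bh : `|Fm M w m r (barPhi u) - Fm M w m r (barPhi (u - dl / 2))| <= e.
  by apply: hd; rewrite /ball/= opprB addrC subrK gtr0_norm//; lra.
near=> s.
have s1 : barPhi (u + dl / 2) <= s by near: s; apply: lt_le_nbhsr.
have s2 : s <= barPhi (u - dl / 2) by near: s; apply: lt_le_nbhsl.
have := Fm_mono M w m r s1; have := Fm_mono M w m r s2.
move: bl bh; rewrite tu !ler_norml.
move: (Fm M w m r (barPhi (u + dl / 2))) (Fm M w m r (barPhi (u - dl / 2))).
move: (Fm M w m r t) (Fm M w m r s) => *; lra.
Unshelve. all: by end_near. Qed.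
End covariance_limit.

(** * The Benjamini-Hochberg procedure *)

Section bh_rejection_count.
Context {R : realType}.
Variables (q : R) (m : nat) (p : 'I_m -> R).
Hypotheses (q0 : 0 < q) (m0 : (0 < m)%N) (p_gt0 : forall i, 0 < p i).

Definition pcount (x : R) : nat := #|[pred i | p i <= x]|.

(* Rejects the same hypotheses as bh_threshold, and solves Ghat t = t / q exactly. *)
Definition bh_level : R := (bh_rejections q p)%:R * q / m%:R.

Lemma pcount_le x : (pcount x <= m)%N.
Proof. by rewrite -[X in (_ <= X)%N](card_ord m) max_card. Qed.

Lemma pcount_mono x y : x <= y -> (pcount x <= pcount y)%N.
Proof.
move=> xy; apply/subset_leq_card/fintype.subsetP => i; rewrite !inE => h.
exact: le_trans h xy.
Qed.

Lemma pcountE x : pcount x = count (<= x)%O (sort <=%R [seq p i | i <- enum 'I_m]).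
Proof.
rewrite (permP (permEl (perm_sort _ _))) count_map -sum1_count big_enum_cond /=.
by rewrite /pcount -sum1_card; apply: eq_bigl => i; rewrite inE.
Qed.

(** The Galois connection between order statistics and the counting function, which removes sorting
    from what follows. The bound 0 <= x serves the convention at j = 0. *)
Lemma order_stat_le j x : (j <= m)%N -> 0 <= x -> (order_stat p j <= x) = (j <= pcount x)%N.
Proof.
case: j => [|j] jm x0; rewrite /order_stat/=; first by rewrite x0.
rewrite pcountE; set t := sort _ _.
have st : sorted <=%O t by exact: sort_le_sorted.
have sz : size t = m by rewrite size_sort size_map size_enum_ord.
apply/idP/idP => [h|h]; last by apply: nth_count_le.
rewrite ltnNge; apply/negP => cj.
have : (count (<= x)%O t <= j < size t)%N by rewrite cj sz.
by move=> /(nth_count_gt 0 st); rewrite ltNge h.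
Qed.

Let level_ge0 (j : nat) : 0 <= j%:R * q / m%:R.
Proof. by rewrite !mulr_ge0 ?invr_ge0// ltW. Qed.

Lemma order_stat_le_level (j : nat) : (j <= m)%N ->
  (order_stat p j <= j%:R * q / m%:R) = (j <= pcount (j%:R * q / m%:R))%N.
Proof. by move=> jm; apply: order_stat_le. Qed.

Lemma bh_rejections_le : (bh_rejections q p <= m)%N.
Proof. by apply/bigmax_leqP => i _; rewrite -ltnS. Qed.

Lemma bh_rejections_cond :
  order_stat p (bh_rejections q p) <= (bh_rejections q p)%:R * q / m%:R.
Proof.
have h : (0 < #|[pred j : 'I_m.+1 | (order_stat p j <= j%:R * q / m%:R)%R]|)%N.
  by apply/card_gt0P; exists ord0; rewrite inE /= mul0r mul0r.
have [j hj e] := eq_bigmax_cond (fun j : 'I_m.+1 => nat_of_ord j) h.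
have -> : bh_rejections q p = j by rewrite -e; apply: eq_bigl => l; rewrite inE.
by move: hj; rewrite inE.
Qed.

Lemma bh_rejections_max (j : nat) : (j <= pcount (j%:R * q / m%:R))%N ->
  (j <= bh_rejections q p)%N.
Proof.
move=> h; have jm : (j < m.+1)%N by rewrite ltnS (leq_trans h)// pcount_le.
by apply: (@leq_bigmax_cond _ _ _ (Ordinal jm)); rewrite /= order_stat_le_level.
Qed.

(** The count at the level of R is at least R. Call it c: its own level is at least that of R, so
    the count there is at least c, and the maximality of R gives c <= R. *)
Lemma pcount_bh_level : pcount bh_level = bh_rejections q p.
Proof.
have h1 : (bh_rejections q p <= pcount bh_level)%N.
  by rewrite -order_stat_le_level ?bh_rejections_le// bh_rejections_cond.
apply/eqP; rewrite eqn_leq h1 andbT; apply: bh_rejections_max.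
apply: pcount_mono; rewrite /bh_level ler_pM2r ?invr_gt0 ?ltr0n//.
by rewrite ler_pM2r// ler_nat.
Qed.

(** The threshold is at most the level, so one rejection set contains the other, and both have R
    elements. *)
Lemma bh_threshold_rejects i : (p i <= bh_threshold q p) = (p i <= bh_level).
Proof.
have tl : bh_threshold q p <= bh_level by exact: bh_rejections_cond.
have sub : [pred i | p i <= bh_threshold q p] \subset [pred i | p i <= bh_level].
  by apply/fintype.subsetP => l; rewrite !inE => h; exact: le_trans h tl.
suff e : [pred i | p i <= bh_threshold q p] =i [pred i | p i <= bh_level].
  by have := e i; rewrite !inE.
apply/subset_cardP => //; apply/eqP; rewrite eqn_leq subset_leq_card//=.
rewrite -[X in (X <= _)%N]/(pcount _) -[X in (_ <= X)%N]/(pcount _) pcount_bh_level.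
case E : (bh_rejections q p) => [|n] //.
have t0 : 0 <= bh_threshold q p.
  rewrite /bh_threshold /order_stat E/=; have [h|h] := ltnP n (size (sort <=%R [seq p i | i <- enum 'I_m])).
    have : nth 0 (sort <=%R [seq p i | i <- enum 'I_m]) n \in [seq p i | i <- enum 'I_m].
      by rewrite -(mem_sort <=%R) mem_nth.
    by move=> /mapP[l _ ->]; rewrite ltW.
  by rewrite nth_default.
by rewrite -E -order_stat_le ?bh_rejections_le.
Qed.

Lemma bh_level_le : bh_level <= q.
Proof.
rewrite /bh_level mulrAC ler_piMl ?(ltW q0)// ler_pdivrMr ?ltr0n// mul1r ler_nat.
exact: bh_rejections_le.
Qed.

Lemma bh_level_max (s : R) : 0 <= s -> s / q <= (pcount s)%:R / m%:R -> s <= bh_level.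
Proof.
move=> s0 h; have le_s : s <= (pcount s)%:R * q / m%:R by rewrite mulrAC -ler_pdivrMr.
apply: (le_trans le_s); rewrite /bh_level ler_pM2r ?invr_gt0 ?ltr0n// ler_pM2r// ler_nat.
by apply: bh_rejections_max; exact: pcount_mono.
Qed.

Lemma bh_fdpE (h : 'I_m -> bool) : bh_fdp q p h =
  (\sum_(i < m) (~~ h i && (p i <= bh_level))%:R) / (maxn (bh_rejections q p) 1)%:R.
Proof.
rewrite /bh_fdp; congr (_ / _); rewrite -natr_sum; congr (_%:R).
transitivity #|[pred i | ~~ h i && (p i <= bh_level)]|; last first.
  by rewrite -sum1_card big_mkcond; apply: eq_bigr => i _; rewrite inE; case: (_ && _).
apply: eq_card => i; rewrite inE -bh_threshold_rejects andbC.
by apply/idP/idP => [/set_mem//|ha]; exact: mem_set.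
Qed.

(** Describes the event R = j by finitely many events on counts at fixed levels, for the
    measurability of the FDP. *)
Lemma bh_rejectionsE (j : nat) : (j <= m)%N -> (bh_rejections q p == j) =
  (j <= pcount (j%:R * q / m%:R))%N &&
  [forall l : 'I_m.+1, (j < l)%N ==> ~~ (l <= pcount (l%:R * q / m%:R))%N].
Proof.
move=> jm; apply/eqP/andP => [<-|[h1 /forallP h2]].
  split; first by rewrite pcount_bh_level.
  apply/forallP => l; apply/implyP => rl; apply/negP => /bh_rejections_max.
  by rewrite leqNgt rl.
apply/eqP; rewrite eqn_leq (bh_rejections_max h1) andbT leqNgt; apply/negP => jr.
have rm : (bh_rejections q p < m.+1)%N by rewrite ltnS bh_rejections_le.
have := h2 (Ordinal rm); rewrite /= jr/= => /negP; apply.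
by rewrite pcount_bh_level.
Qed.

End bh_rejection_count.

(** * The BH level in the model: its defining equation, its maximality, and measurability of the
    FDP *)

Section model_bh.
Context {d : measure_display} {T : measurableType d} {R : realType}.
Context {P : probability T R} {k : nat}.
Variables (M : factor_model P k) (w : 'rV[R]_k) (q : R).
Hypothesis q0 : 0 < q.

Definition tauhat m (x : T) : R := bh_level q (fun i : 'I_m => pvalue M i w x).

Lemma Ghat_pcount m t x : Fhat M w m false t x + Fhat M w m true t x =
  (pcount (fun i : 'I_m => pvalue M i w x) t)%:R / m%:R.
Proof.
rewrite /Fhat -mulrDr mulrC; congr (_ / _); rewrite -big_split/=.
rewrite /pcount -sum1_card natr_sum [RHS]big_mkcond/=; apply: eq_bigr => i _.
by rewrite inE -mulrDl; case: (H M i x); case: (_ <= t); rewrite /= ?(add0r, addr0, mul1r, mulr0).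
Qed.

Lemma Ghat_tauhat m x : (0 < m)%N ->
  Fhat M w m false (tauhat m x) x + Fhat M w m true (tauhat m x) x = tauhat m x / q.
Proof.
move=> m0; rewrite Ghat_pcount /tauhat pcount_bh_level//.
by rewrite /bh_level mulrAC mulfK// gt_eqF.
Qed.

Lemma tauhat_le m x : (0 < m)%N -> tauhat m x <= q.
Proof. by move=> m0; apply: bh_level_le => // i; exact: pvalue_gt0. Qed.

Lemma tauhat_max m x s : (0 < m)%N -> 0 <= s ->
  s / q <= Fhat M w m false s x + Fhat M w m true s x -> s <= tauhat m x.
Proof. by move=> m0 s0; rewrite Ghat_pcount; exact: bh_level_max. Qed.

Lemma FDP_tauhat m x : (0 < m)%N -> 0 < tauhat m x ->
  FDP M w q m x = q * Fhat M w m false (tauhat m x) x / tauhat m x.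
Proof.
move=> m0 t0; rewrite /FDP bh_fdpE//; last by move=> i; exact: pvalue_gt0.
have m0' : 0 < m%:R :> R by rewrite ltr0n.
move: t0; rewrite {1}/tauhat {1}/bh_level; set j := bh_rejections _ _ => t0.
have j0 : (0 < j)%N.
  by case: j t0 => // ; rewrite mul0r mul0r ltxx.
have j0' : 0 < j%:R :> R by rewrite ltr0n.
rewrite (maxn_idPl j0) /Fhat.
have -> : \sum_(i < m) (~~ H M i x && (pvalue M i w x <= bh_level q (fun i : 'I_m => pvalue M i w x)))%:R =
    \sum_(i < m) (H M i x == false)%:R * (pvalue M i w x <= tauhat m x)%R%:R :> R.
  by apply: eq_bigr => i _; rewrite -natrM mulnb eqbF_neg.
set S := \sum_i _; have -> : tauhat m x = j%:R * q / m%:R by [].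
by field; rewrite !gt_eqF.
Qed.

Lemma measurable_bool_forall (I : finType) (b : I -> T -> bool) :
  (forall i, measurable_fun setT (b i)) -> measurable_fun setT (fun x => [forall i, b i x]).
Proof.
move=> mb; rewrite (_ : (fun x => _) = (fun x => \big[andb/true]_(i <- enum I) b i x)).
  elim: (enum I) => [|i s IHs].
    by rewrite (_ : (fun x => _) = cst true)//; apply/funext => x; rewrite big_nil.
  rewrite (_ : (fun x => _) = (fun x => b i x && \big[andb/true]_(i <- s) b i x)).
    exact: measurable_and.
  by apply/funext => x; rewrite big_cons.
by apply/funext => x; rewrite big_enum big_andE.
Qed.

Lemma measurable_pvalue_le m (i : 'I_m) t : measurable_fun setT (fun x => pvalue M i w x <= t).
Proof. by apply: measurable_fun_ler => //; exact: measurable_pvalue. Qed.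

Lemma measurable_pcount_ge m (j : nat) t :
  measurable_fun setT (fun x => (j <= pcount (fun i : 'I_m => pvalue M i w x) t)%N).
Proof.
rewrite (_ : (fun x => _) =
    (fun x => j%:R <= \sum_(i < m) (pvalue M i w x <= t)%R%:R :> R)).
  apply: measurable_fun_ler => //; apply: measurable_sum => i.
  by apply: measurable_boolfun; exact: measurable_pvalue_le.
apply/funext => x; rewrite -natr_sum ler_nat /pcount -sum1_card big_mkcond/=.
by congr (_ <= _)%N; apply: eq_bigr => i _; rewrite inE; case: (_ <= t).
Qed.

(** On the event R = j the random level is the constant j q / m, so the FDP is a finite sum over j
    of measurable terms. *)
Lemma measurable_FDP m : (0 < m)%N -> measurable_fun setT (FDP M w q m).
Proof.
move=> m0; pose pv x := fun i : 'I_m => pvalue M i w x.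
rewrite (_ : FDP M w q m = (fun x => \sum_(j < m.+1) (bh_rejections q (pv x) == j)%:R *
   ((\sum_(i < m) (~~ H M i x && (pv x i <= j%:R * q / m%:R))%:R) / (maxn j 1)%:R))).
  apply: measurable_sum => j; apply: measurable_funM.
    apply: measurable_boolfun.
    rewrite (_ : (fun x => _) = (fun x => (j <= pcount (pv x) (j%:R * q / m%:R))%N &&
      [forall l : 'I_m.+1, (j < l)%N ==> ~~ (l <= pcount (pv x) (l%:R * q / m%:R))%N])).
      apply: measurable_and; first exact: measurable_pcount_ge.
      apply: measurable_bool_forall => l.
      case: (j < l)%N => /=; last exact: measurable_cst.
      by apply: measurable_neg; exact: measurable_pcount_ge.
    by apply/funext => x; apply: bh_rejectionsE => //; rewrite -ltnS.
  apply: measurable_funM => //; apply: measurable_sum => i; apply: measurable_boolfun.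
  apply: measurable_and; last exact: measurable_pvalue_le.
  by apply: measurable_neg; exact: measurable_H.
apply/funext => x; rewrite /FDP bh_fdpE//; last by move=> i; exact: pvalue_gt0.
have rm : (bh_rejections q (pv x) < m.+1)%N.
  by rewrite ltnS; apply: bh_rejections_le.
rewrite (bigD1 (Ordinal rm))//= eqxx mul1r [X in _ = _ + X]big1 ?addr0//.
move=> j; rewrite -val_eqE/= eq_sym => /negbTE ->; exact: mul0r.
Qed.

End model_bh.

Lemma near_sqrt_gt (R : realType) (A : R) : \forall m \near \oo, A < Num.sqrt m%:R.
Proof.
near=> m; have [A0|A0] := ltP A 0; first exact: lt_le_trans (sqrtr_ge0 _).
rewrite -[ltLHS](ger0_norm A0) -sqrtr_sqr ltr_sqrt; last first.
  by rewrite ltr0n; near: m; exact: nbhs_infty_gt.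
near: m; exact: nbhs_infty_gtr.
Unshelve. all: by end_near. Qed.

(** * Localisation and linearisation of the BH threshold *)

Section unlikely_events.
Context {d : measure_display} {T : measurableType d} {R : realType}.
Variable P : probability T R.

(* The events E m need not be measurable: they are covered by measurable events
   of probability at most e, for all large m. *)
Definition unlikely (e : R) (E : nat -> set T) : Prop :=
  \forall m \near \oo, exists B, [/\ measurable B, fine (P B) <= e & E m `<=` B].

Lemma unlikelyS e E E' : (\forall m \near \oo, E m `<=` E' m) -> unlikely e E' -> unlikely e E.
Proof.
move=> sub uE; near=> m.
have [B [mB PB EB]] : exists B, [/\ measurable B, fine (P B) <= e & E' m `<=` B].
  by near: m.
exists B; split=> //; apply: subset_trans EB.
by near: m.
Unshelve. all: by end_near. Qed.

Lemma unlikelyW e e' E : e <= e' -> unlikely e E -> unlikely e' E.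
Proof.
move=> ee; apply: filterS => m [B [mB PB EB]]; exists B; split => //.
exact: le_trans ee.
Qed.

Lemma unlikelyU e e' E E' : unlikely e E -> unlikely e' E' ->
  unlikely (e + e') (fun m => E m `|` E' m).
Proof.
apply: filterS2 => m [B [mB PB EB]] [B' [mB' PB' EB']].
exists (B `|` B'); split; [exact: measurableU| |exact: setUSS].
apply: le_trans (lerD PB PB'); rewrite -lee_fin EFinD !fineK ?fin_num_measure//.
  exact: measureU2.
exact: measurableU.
Qed.

Lemma unlikely_bigU (N : nat) (E : nat -> nat -> set T) :
  (forall l e, 0 < e -> unlikely e (E l)) -> forall e, 0 < e ->
  unlikely e (fun m => [set x | exists2 l, (l < N)%N & E l m x]).
Proof.
move=> uE; elim: N => [|N IHN] e e0.
  by near=> m; exists set0; split=> [||x [l]] //; rewrite measure0 ltW.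
have e2 : 0 < e / 2 by rewrite divr_gt0.
rewrite [e]splitr; apply: unlikelyS (unlikelyU (IHN _ e2) (uE N _ e2)).
near=> m => x [l]; rewrite ltnS leq_eqVlt => /orP[/eqP -> ?|lN ?]; first by right.
by left; exists l.
Unshelve. all: by end_near. Qed.

End unlikely_events.

Lemma excursion_lower (R : realType) (f0 f1 g0 g1 u s D y t : R) :
  u <= s - D -> f0 + f1 = t -> f0 <= g0 -> f1 <= g1 -> y <= t ->
  D - (s - y) <= g0 + g1 - u.
Proof. lra. Qed.

(** For [tauhat_right]: [u] is the scaled deviation of the empirical distribution from [G], [v] and
    [z] are the two biases of [Fm], and r = 1 / q is the loss from rounding to the grid. *)
Lemma deviation_above (R : realType) (u v z c l r : R) : 0 < r -> r + c <= c * l / 4 ->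
  `|v| <= 1 / 2 * c -> `|z| <= 1 / 2 * c -> c * l + c - r <= u ->
  2 * (c * l / 4) <= `|u - (v + z)|.
Proof. by rewrite !ler_norml ler_normr => *; apply/orP; left; lra. Qed.

Lemma deviation_below (R : realType) (u v z D : R) :
  `|v| <= D / 4 -> `|z| <= D / 4 -> u <= - D -> 2 * (D / 4) <= `|u - (v + z)|.
Proof. by rewrite !ler_norml ler_normr => *; apply/orP; right; lra. Qed.

Lemma sum_norm_or (R : realType) (u v A : R) : 2 * A <= `|u + v| -> A <= `|u| \/ A <= `|v|.
Proof.
move=> h; have := ler_normD u v; have [hu|hu] := leP A `|u|; [by left|right; lra].
Qed.

Lemma grid_cell_bounds (R : realType) (v v1 y u K : R) :
  v <= y -> y <= v1 -> v1 = v + u -> u <= 1 -> 0 < u -> - K <= y -> y <= K ->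
  `|v| <= K + 1 /\ `|v1| <= K + 1.
Proof. by move=> *; rewrite !ler_norml; split; apply/andP; split; lra. Qed.

(** For [Wproc_oscillation]: the A's are values of sqrt m Fhat, the B's of sqrt m Fm, and p1, p2 the
    linear approximations at neighbouring grid points. By monotonicity A - B is at most A2 - B1, so
    it exceeds a grid value by at most B2 - B1, and symmetrically below. *)
Lemma oscillation_bound (R : realType) (eta A1 A2 A A0 B1 B2 B B0 F0 p1 p2 : R) :
  `|A1 - B1 - (A0 - B0)| < eta / 4 -> `|A2 - B2 - (A0 - B0)| < eta / 4 ->
  `|B1 - F0 - p1| <= eta / 16 -> `|B2 - F0 - p2| <= eta / 16 ->
  A1 <= A -> A <= A2 -> B1 <= B -> B <= B2 -> p2 - p1 <= eta / 4 ->
  `|A - B - (A0 - B0)| <= eta.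
Proof. by rewrite !ltr_norml !ler_norml => *; apply/andP; split; lra. Qed.

(* The equation X0 + X1 = h / q, that is Ghat tauhat = tauhat / q, is what eliminates
   h = sqrt m (tauhat - tau). *)
Lemma FDP_expansion (R : realType) (q s th tau' X0 X1 h W0 W1 f0 f1 F0 F1 d0 d1 al : R) :
  0 < q -> 0 < th -> 0 < tau' -> q^-1 - (f0 + f1) != 0 ->
  h = s * (th - tau') -> X0 = W0 + f0 * h + d0 -> X1 = W1 + f1 * h + d1 ->
  X0 + X1 = h / q -> al = (f0 - F0 / tau') / (q^-1 - (f0 + f1)) ->
  q / th * (X0 - F0 / tau' * h) -
    (q / tau' * (1 + al) * W0 + q / tau' * al * W1) =
  q / th * (d0 + al * (d0 + d1)) -
    q * (W0 + al * (W0 + W1)) / tau' * ((th - tau') / th).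
Proof.
move=> q0 th0 ta0 k0 hE X0E X1E sumE alE.
have hk : (q^-1 - (f0 + f1)) * h = W0 + W1 + d0 + d1.
  by move: sumE; rewrite X0E X1E => e; rewrite mulrBl [q^-1 * h]mulrC -e; ring.
have num : X0 - F0 / tau' * h = W0 + al * (W0 + W1) + (d0 + al * (d0 + d1)).
  have -> : X0 - F0 / tau' * h = W0 + d0 + (f0 - F0 / tau') * h by rewrite X0E; ring.
  have -> : (f0 - F0 / tau') * h = al * ((q^-1 - (f0 + f1)) * h) by rewrite alE mulrA divfK.
  by rewrite hk; ring.
rewrite num; field.
by rewrite !gt_eqF.
Qed.
(** Each term gets eta / 2: the first is proportional to [e], the second to |th - tau'| <= K / s.
    The bound tau' / 2 <= th controls the divisions. *)
Lemma FDP_remainder_bound (R : realType) (q th tau' d0 d1 W0 W1 al e A K s eta : R) :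
  0 < q -> q < 1 -> 0 < tau' -> tau' / 2 <= th -> 0 < s -> 0 < eta ->
  `|d0| <= e -> `|d1| <= e -> `|W0| <= A -> `|W1| <= A -> `|s * (th - tau')| <= K ->
  4 * (1 + 2 * `|al|) * e <= eta * tau' ->
  4 * (1 + 2 * `|al|) * A * K <= eta * tau' ^+ 2 * s ->
  `|q / th * (d0 + al * (d0 + d1)) -
    q * (W0 + al * (W0 + W1)) / tau' * ((th - tau') / th)| <= eta.
Proof.
move=> q0 q1 t0 tth s0 eta0 hd0 hd1 hW0 hW1 hs he hA.
have th0 : 0 < th by apply: lt_le_trans tth; rewrite divr_gt0.
have al0 : 0 <= `|al| := normr_ge0 _.
have lin (u v B : R) : `|u| <= B -> `|v| <= B -> `|u + al * (u + v)| <= (1 + 2 * `|al|) * B.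
  move=> hu hv; apply: le_trans (ler_normD _ _) _; rewrite normrM.
  have : `|al| * `|u + v| <= `|al| * (2 * B).
    by rewrite ler_wpM2l//; apply: le_trans (ler_normD _ _) _; lra.
  by lra.
have h1 := lin _ _ _ hd0 hd1; have h2 := lin _ _ _ hW0 hW1.
have thV : th^-1 <= 2 / tau'.
  by rewrite -[2 / tau']invrK invf_div lef_pV2 ?posrE ?divr_gt0.
have thV0 : 0 <= th^-1 by rewrite invr_ge0 ltW.
have tV0 : 0 <= tau'^-1 by rewrite invr_ge0 ltW.
have e0 : 0 <= e by apply: le_trans hd0.
have A0 : 0 <= A by apply: le_trans hW0.
have K0 : 0 <= K by apply: le_trans hs.
apply: le_trans (ler_normB _ _) _; rewrite [eta]splitr; apply: lerD.
  rewrite !normrM (gtr0_norm q0) normfV (gtr0_norm th0).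
  apply: (@le_trans _ _ (1 * (2 / tau') * ((1 + 2 * `|al|) * e))).
    apply: ler_pM => //; first by rewrite mulr_ge0// ltW.
    by apply: ler_pM => //; rewrite ltW.
  rewrite mul1r mulrAC ler_pdivrMr//; move: he.
  move: (`|al| * e) => ?; lra.
rewrite !normrM (gtr0_norm q0) !normfV (gtr0_norm th0) (gtr0_norm t0).
have hth : `|th - tau'| <= K / s.
  by rewrite ler_pdivlMr// mulrC -{1}(gtr0_norm s0) -normrM.
apply: (@le_trans _ _ (1 * ((1 + 2 * `|al|) * A) / tau' * (K / s * (2 / tau')))).
  apply: ler_pM => //.
  - by rewrite !mulr_ge0// ltW.
  - by rewrite mulr_ge0.
  - by rewrite ler_wpM2r//; apply: ler_pM => //; rewrite ltW.
  - exact: ler_pM.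
rewrite mul1r (_ : _ * _ = 4 * (1 + 2 * `|al|) * A * K / (tau' ^+ 2 * s) / 2); last first.
  by field; rewrite !gt_eqF.
rewrite ler_pM2r// ler_pdivrMr ?mulr_gt0 ?exprn_gt0// mulrA//.
Qed.

(** * Shape of G around the Simes point, localisation of the BH level, and linearisation of the
    FDP *)

Section simes_point_analysis.
Context {d : measure_display} {T : measurableType d} {R : realType}.
Context {P : probability T R} {k : nat}.
Variables (M : factor_model P k) (w : 'rV[R]_k) (q a b : R).
Local Notation tau := (simes_point M w q).
Local Notation Fm := (Fm M w).
Local Notation F := (F M w).
Local Notation G := (G M w).
Hypothesis q01 : 0 < q < 1.
Hypothesis hab : is_simes_interval M w q a b.
Hypothesis h3 : forall (t : R) (r : bool), 0 <= t <= 1 -> cvgn (fun m => Fm m r t).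
Hypothesis h6 : forall r : bool, derivable (F r) tau 1.
Hypothesis halpha : q^-1 - derive1 G tau != 0.
Hypothesis h7 : forall r : bool,
  sup [set `|Num.sqrt m%:R * (Fm m r t - F r t)| | t in [set t : R | a <= t <= b]]
    @[m --> \oo] --> (0 : R).

Lemma simes_interval_bounds : [/\ 0 < q, 0 < a, a < tau, tau < b & b < 1].
Proof. by have [/andP[? ?] /andP[? ?] _ [/andP[? ?] _] _] := hab; split => //; case/andP: q01. Qed.

Lemma F01 t r : 0 <= t <= 1 -> 0 <= F r t <= 1.
Proof.
move=> t01; have c := @h3 t r t01; apply/andP; split.
  by apply: limr_ge => //; near=> m; exact: Fm_ge0.
by apply: limr_le => //; near=> m; exact: Fm_le1.
Unshelve. all: by end_near. Qed.

Lemma Fm_uniform (e : R) : 0 < e ->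
  \forall m \near \oo, forall r t, a <= t <= b -> `|Num.sqrt m%:R * (Fm m r t - F r t)| <= e.
Proof.
move=> e0; have [_ a0 _ _ b1] := simes_interval_bounds.
have h r : \forall m \near \oo, forall t, a <= t <= b -> `|Num.sqrt m%:R * (Fm m r t - F r t)| <= e.
  have /cvgrPdist_le/(_ _ e0) := h7 r; apply: filterS => m.
  rewrite sub0r normrN => /(le_trans (ler_norm _)) he t tab; apply: le_trans he.
  (* A real supremum dominates its set only if the set is bounded; sqrt m is a bound, both functions
     having values in [0, 1]. *)
  apply: ub_le_sup; last by exists t.
  exists (Num.sqrt m%:R) => y [s /= /andP[sa sb] <-].
  rewrite normrM ger0_norm ?sqrtr_ge0// ler_piMr ?sqrtr_ge0//.
  have s01 : 0 <= s <= 1 by apply/andP; split; lra.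
  have := F01 r s01; have := Fm_ge0 M w m r s; have := Fm_le1 M w m r s.
  by rewrite ler_norml; lra.
by have := h true; have := h false; apply: filterS2 => m hf ht [].
Qed.

(** A uniform limit of continuous functions on [a, b]: the factor sqrt m in the uniform convergence
    is at least 1. *)
Lemma F_continuous r (t : R) : a < t < b -> {for t, continuous (F r)}.
Proof.
move=> /andP[ta tb]; have [_ a0 _ _ b1] := simes_interval_bounds.
apply/cvgrPdist_le => e e0.
have e3 : 0 < e / 3 by rewrite divr_gt0.
have [m _ hm] := Fm_uniform e3.
have {}hm s : a <= s <= b -> `|Fm m.+1 r s - F r s| <= e / 3.
  move=> sab; have := hm m.+1 (leqnSn m) r s sab; rewrite normrM ger0_norm//.
  apply: le_trans; rewrite ler_peMl// -[leLHS]sqrtr1 ler_wsqrtr// ler1n //.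
have t01 : 0 < t < 1 by apply/andP; split; lra.
have /cvgrPdist_le/(_ _ e3) := @continuous_Fm _ _ _ _ _ M w m.+1 r t (ltn0Sn m) t01.
move=> hc; near=> s.
have h1 : `|Fm m.+1 r t - Fm m.+1 r s| <= e / 3 by near: s.
have sa : a <= s by near: s; exact: lt_le_nbhsr.
have sb : s <= b by near: s; exact: lt_le_nbhsl.
have h2 : `|Fm m.+1 r s - F r s| <= e / 3 by apply: hm; rewrite sa.
have h4 : `|Fm m.+1 r t - F r t| <= e / 3 by apply: hm; rewrite !ltW.
move: h1 h2 h4; rewrite !ler_norml; lra.
Unshelve. all: by end_near. Qed.

Lemma F_expansion (e : R) : 0 < e -> exists2 dl : R, 0 < dl & forall r t, `|t - tau| <= dl ->
  `|F r t - F r tau - derive1 (F r) tau * (t - tau)| <= e * `|t - tau|.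
Proof.
move=> e0.
have one r : exists2 dl : R, 0 < dl & forall t, `|t - tau| <= dl ->
    `|F r t - F r tau - derive1 (F r) tau * (t - tau)| <= e * `|t - tau|.
  have /cvgrPdist_le/(_ _ e0) := @h6 r.
  move=> /nbhs_ballP[dl /= dl0 hd]; exists (dl / 2); first by rewrite divr_gt0.
  move=> t td; have [->|tt] := eqVneq t tau; first by rewrite !subrr mulr0 subrr normr0 mulr0.
  have tt0 : t - tau != 0 by rewrite subr_eq0.
  have := hd (t - tau); rewrite /ball/= sub0r normrN => /(_ _)/(_ tt0) h.
  have {}h : `|derive1 (F r) tau - (t - tau)^-1 * (F r t - F r tau)| <= e.
    rewrite derive1E; move: h; rewrite [_ *: 1]mulr1 subrK; apply.
    by apply: le_lt_trans td _; rewrite ltr_pdivrMr// ltr_pMr// ltr1n.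
  have -> : F r t - F r tau - derive1 (F r) tau * (t - tau) =
     - (derive1 (F r) tau - (t - tau)^-1 * (F r t - F r tau)) * (t - tau) by field.
  by rewrite normrM normrN ler_wpM2r.
have [d1 d10 h1] := one true; have [d2 d20 h2] := one false.
exists (Num.min d1 d2); first by rewrite lt_min d10.
by move=> [] t; rewrite le_min => /andP[? ?]; [exact: h1|exact: h2].
Qed.

Lemma derive1_G : derive1 G tau = derive1 (F false) tau + derive1 (F true) tau.
Proof.
rewrite !derive1E; rewrite -deriveD//.
Qed.

Lemma G_expansion (e : R) : 0 < e -> exists2 dl : R, 0 < dl & forall t, `|t - tau| <= dl ->
  `|G t - G tau - derive1 G tau * (t - tau)| <= e * `|t - tau|.
Proof.
move=> e0; have e2 : 0 < e / 2 by rewrite divr_gt0.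
have [dl dl0 h] := F_expansion e2; exists dl => // t td.
have h1 := h false t td; have h2 := h true t td.
rewrite derive1_G /Defs.G.
have -> : F false t + F true t - (F false tau + F true tau) -
   (derive1 (F false) tau + derive1 (F true) tau) * (t - tau) =
   (F false t - F false tau - derive1 (F false) tau * (t - tau)) +
   (F true t - F true tau - derive1 (F true) tau * (t - tau)) by ring.
rewrite [e in leRHS]splitr mulrDl; exact: le_trans (ler_normD _ _) (lerD h1 h2).
Qed.

Lemma G_tau : G tau = tau / q. Proof. by have [_ _ _ [_ ->] _] := hab. Qed.

Lemma G_lt t : tau < t -> t < 1 -> G t < t / q.
Proof.
move=> tt t1; have [_ a0 at_ _ _] := simes_interval_bounds.
rewrite ltNge; apply/negP => h.
have : t <= tau.
  apply: ub_le_sup; first by exists 1 => y [/andP[_ /ltW]].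
  by split => //; apply/andP; split => //; lra.
by lra.
Qed.

(** Otherwise the slope is strictly larger, by [halpha]. Expanding with error rate equal to the
    excess gives G t >= t / q for t slightly above [tau], against [G_lt]. *)
Lemma slope_lt : derive1 G tau < q^-1.
Proof.
have [q0 a0 at_ tb b1] := simes_interval_bounds.
rewrite ltNge; apply/negP => h.
have {h} e0 : 0 < derive1 G tau - q^-1.
  by rewrite lt_neqAle subr_ge0 h andbT eq_sym -oppr_eq0 opprB.
have [dl dl0 hd] := G_expansion e0.
pose s := Num.min dl ((b - tau) / 2).
have s0 : 0 < s by rewrite lt_min dl0 divr_gt0// subr_gt0.
have sb : s <= (b - tau) / 2 by rewrite ge_min lexx orbT.
have := hd (tau + s); rewrite addrC addKr gtr0_norm// ge_min lexx => /(_ isT).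
have := @G_lt (s + tau); rewrite ltrDr => /(_ s0) gl.
have {}gl := gl ltac:(lra).
rewrite ler_norml G_tau => /andP[hl _]; move: hl gl.
rewrite [tau + s]addrC; move: (G _) (derive1 G tau) q^-1 => u D qi; nra.
Qed.

Lemma gap_left : exists c dl : R, [/\ 0 < c, 0 < dl &
  forall t, tau - dl <= t -> t <= tau -> t / q + c * (tau - t) <= G t].
Proof.
pose c := (q^-1 - derive1 G tau) / 2.
have c0 : 0 < c by rewrite divr_gt0// subr_gt0 slope_lt.
have [dl dl0 hd] := G_expansion c0; exists c, dl; split => // t t1 t2.
have tn : `|t - tau| = tau - t by rewrite distrC ger0_norm// subr_ge0.
have := hd t; rewrite tn lerBlDl -lerBlDr => /(_ t1).
rewrite ler_norml G_tau => /andP[hl _]; move: hl; rewrite /c.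
move: (G t) (derive1 G tau) q^-1 => u D qi; lra.
Qed.

(** Near [tau] the gap is linear by differentiability, with half of the slope difference as rate. On
    the remaining compact interval it attains a positive minimum [mu], and t - tau <= 1 converts
    [mu] into a linear bound. *)
Lemma gap_right (b' : R) : b' < b -> exists2 c : R, 0 < c &
  forall t, tau <= t -> t <= b' -> G t <= t / q - c * (t - tau).
Proof.
move=> bb; have [q0 a0 at_ tb b1] := simes_interval_bounds.
pose c := (q^-1 - derive1 G tau) / 2.
have c0 : 0 < c by rewrite divr_gt0// subr_gt0 slope_lt.
have [dl dl0 hd] := G_expansion c0.
have near_ t : tau <= t -> t <= tau + dl -> G t <= t / q - c * (t - tau).
  move=> t1 t2; have tn : `|t - tau| = t - tau by rewrite ger0_norm// subr_ge0.
  have := hd t; rewrite tn lerBlDl => /(_ t2).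
  rewrite ler_norml G_tau => /andP[_ hl]; move: hl; rewrite /c.
  move: (G t) (derive1 G tau) q^-1 => u D qi; lra.
have [lb|lb] := leP b' (tau + dl).
  by exists c => // t t1 t2; apply: near_ => //; exact: le_trans lb.
have cont : {within `[tau + dl, b'], continuous (fun t => t / q - G t)}.
  apply: continuous_in_subspaceT => t; rewrite inE/= in_itv/= => /andP[t1 t2].
  have tab : a < t < b by apply/andP; split; lra.
  apply: cvgB; first by apply: cvgM; [exact: cvg_id|exact: cvg_cst].
  by apply: cvgD; exact: F_continuous.
have [s] := EVT_min (ltW lb) cont; rewrite in_itv/= => /andP[s1 s2] smin.
pose mu := s / q - G s.
have mu0 : 0 < mu by rewrite subr_gt0; apply: G_lt; lra.
exists (Num.min c mu); first by rewrite lt_min c0.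
move=> t t1 t2; have [tl|tl] := leP t (tau + dl).
  apply: le_trans (near_ t t1 tl) _; rewrite lerD2l lerN2 ler_wpM2r ?subr_ge0//.
  by rewrite ge_min lexx.
have := smin t; rewrite in_itv/= (ltW tl) t2 => /(_ isT); rewrite -/mu => h.
have : Num.min c mu * (t - tau) <= mu * 1.
  by apply: ler_pM => //; rewrite ?subr_ge0// ?le_min ?(ltW c0) ?(ltW mu0)// ?ge_min ?lexx ?orbT//; lra.
by rewrite mulr1; lra.
Qed.

(** Uniform convergence at rate o(1 / sqrt m) replaces [Fm] by [F], and differentiability at [tau]
    then applies at distance K / sqrt m. The denominators use K + 1 to allow K = 0. *)
Lemma Fm_expansion (K e : R) : 0 <= K -> 0 < e ->
  \forall m \near \oo, forall r t, `|Num.sqrt m%:R * (t - tau)| <= K ->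
    [/\ a <= t <= b, tau / 2 <= t & `|Num.sqrt m%:R * (Fm m r t - F r tau) -
       derive1 (F r) tau * (Num.sqrt m%:R * (t - tau))| <= e].
Proof.
move=> K0 e0; have [q0 a0 at_ tb b1] := simes_interval_bounds.
have e2 : 0 < e / 2 by rewrite divr_gt0.
have eK : 0 < e / (2 * (K + 1)) by rewrite divr_gt0// mulr_gt0//; lra.
have [dl dl0 hd] := F_expansion eK.
pose rho := Num.min dl (Num.min (tau / 2) (Num.min (tau - a) (b - tau))).
have rho0 : 0 < rho by rewrite !lt_min dl0 !subr_gt0 at_ tb !andbT/=; lra.
have [rd [rt [ra rb]]] : rho <= dl /\ rho <= tau / 2 /\ rho <= tau - a /\ rho <= b - tau.
  by rewrite !ge_min !lexx !orbT.
near=> m => r t tK.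
have sm : 0 < Num.sqrt m%:R :> R by near: m; exact: near_sqrt_gt.
have td : `|t - tau| <= rho.
  move: tK; rewrite normrM gtr0_norm// mulrC -ler_pdivlMr// => /le_trans; apply.
  rewrite ler_pdivrMr// mulrC -ler_pdivrMr// ltW//; near: m; exact: near_sqrt_gt.
have tab : a <= t <= b by move: td; rewrite ler_norml => /andP[? ?]; apply/andP; split; lra.
split => //; first by move: td; rewrite ler_norml => /andP[? ?]; lra.
have hu : `|Num.sqrt m%:R * (Fm m r t - F r t)| <= e / 2.
  by move: r t tab {tK td}; near: m; exact: Fm_uniform.
have -> : Num.sqrt m%:R * (Fm m r t - F r tau) -
    derive1 (F r) tau * (Num.sqrt m%:R * (t - tau)) =
    Num.sqrt m%:R * (Fm m r t - F r t) +
    Num.sqrt m%:R * (F r t - F r tau - derive1 (F r) tau * (t - tau)) by ring.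
apply: le_trans (ler_normD _ _) _; rewrite [leRHS]splitr; apply: lerD => //.
rewrite normrM gtr0_norm//.
apply: (@le_trans _ _ (Num.sqrt m%:R * (e / (2 * (K + 1)) * `|t - tau|))).
  by rewrite ler_pM2l//; apply: hd; exact: le_trans rd.
rewrite mulrCA -[X in _ * (X * _)](gtr0_norm sm) -normrM.
apply: (@le_trans _ _ (e / (2 * (K + 1)) * (K + 1))).
  by rewrite ler_pM2l//; apply: le_trans tK _; rewrite lerDl.
by rewrite invfM mulrA divfK// gt_eqF//; lra.
Unshelve. all: by end_near. Qed.
Variable C : R.
Hypothesis mixC : poly_mixing M C.
Local Notation Wp := (Wproc M w).
Local Notation f r := (derive1 (F r) tau).

Let C0 : 0 <= C. Proof. by case: mixC. Qed.

Lemma unlikely_Wproc (A : R) r (s : nat -> R) : 0 < A -> (\forall m \near \oo, 0 <= s m) ->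
  unlikely P (2 * (1 + 8 * C) / A ^+ 2) (fun m => [set x | A <= `|Wp m r (s m) x|]).
Proof.
move=> A0 s0; near=> m; exists [set x | A <= `|Wp m r (s m) x|]; split => //.
  by apply: measurable_ge_norm; apply: bmf_meas; exact: bmf_Wproc.
by apply: Wproc_chebyshev => //; near: m => //; exact: nbhs_infty_gt.
Unshelve. all: by end_near. Qed.

Lemma Wproc_sumE m t x : Wp m false t x + Wp m true t x =
  Num.sqrt m%:R * (Fhat M w m false t x + Fhat M w m true t x - G t) -
  (Num.sqrt m%:R * (Fm m false t - F false t) + Num.sqrt m%:R * (Fm m true t - F true t)).
Proof. by rewrite /Wproc /Defs.G; ring. Qed.

(** If tauhat lies below s = tau - K / sqrt m, then Ghat(s) < s / q by maximality of tauhat, whereas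
    G(s) exceeds s / q by at least c K / sqrt m. The two biases take at most c K / 4 each, so one of
    the processes at s reaches c K / 4 in absolute value. *)
Lemma tauhat_left (e : R) : 0 < e -> exists2 K0 : R, 0 < K0 & forall K, K0 <= K ->
  unlikely P e (fun m => [set x | Num.sqrt m%:R * (tauhat M w q m x - tau) < - K]).
Proof.
move=> e0; have [q0 a0 at_ tb b1] := simes_interval_bounds.
have [c [dl [c0 dl0 gap]]] := gap_left.
pose B := 2 * (1 + 8 * C).
have B0 : 0 < B by rewrite mulr_gt0//; have := C0; lra.
(* The two Chebyshev bounds add up to 32 B / (c K) ^ 2, and K >= 1 allows one factor K to be
   dropped. *)
exists (Num.max 1 (32 * B / (c ^+ 2 * e))); first by rewrite lt_max ltr01.
move=> K; rewrite ge_max => /andP[K1 KB].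
have K0 : 0 < K by lra.
have cK0 : 0 < c * K / 4 by rewrite divr_gt0// mulr_gt0.
pose s m := tau - K / Num.sqrt m%:R.
have ra0 : 0 < Num.min dl (tau - a) by rewrite lt_min dl0 subr_gt0.
have near_s : \forall m \near \oo, [/\ 0 < Num.sqrt m%:R :> R, tau - dl <= s m & a <= s m].
  near=> m.
  have sm : 0 < Num.sqrt m%:R :> R by near: m; exact: near_sqrt_gt.
  have : K / Num.sqrt m%:R <= Num.min dl (tau - a).
    rewrite ler_pdivrMr// mulrC -ler_pdivrMr// ltW//; near: m; exact: near_sqrt_gt.
  by rewrite le_min /s => /andP[? ?]; split => //; lra.
have near_s0 : \forall m \near \oo, 0 <= s m.
  by apply: filterS near_s => m [_ _]; apply: le_trans; exact: ltW.
apply: (@unlikelyW _ _ _ P (B / (c * K / 4) ^+ 2 + B / (c * K / 4) ^+ 2)); last first.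
  apply: unlikelyS (unlikelyU (unlikely_Wproc false cK0 near_s0) (unlikely_Wproc true cK0 near_s0)).
  near=> m => x /= hx.
  have [sm sdl sa] : [/\ 0 < Num.sqrt m%:R :> R, tau - dl <= s m & a <= s m] by near: m.
  have st : s m <= tau by rewrite /s gerBl divr_ge0// ltW.
  have m0 : (0 < m)%N by near: m; exact: nbhs_infty_gt.
  have hu : forall r t, a <= t <= b -> `|Num.sqrt m%:R * (Fm m r t - F r t)| <= c * K / 4.
    by near: m; exact: Fm_uniform.
  have sab : a <= s m <= b by rewrite sa (le_trans st)// ltW.
  have h0 := hu false _ sab; have h1 := hu true _ sab.
  have hs : tauhat M w q m x < s m.
    by rewrite /s -ltrBlDl -mulNr ltr_pdivlMr// mulrC.
  have hlt : Fhat M w m false (s m) x + Fhat M w m true (s m) x < s m / q.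
    rewrite ltNge; apply/negP => /(tauhat_max q0 m0 _); rewrite (le_trans (ltW a0) sa).
    by move=> /(_ isT); rewrite leNgt hs.
  have hg := gap _ sdl st.
  have gs : Num.sqrt m%:R * (c * (tau - s m)) = c * K.
    by rewrite /s subKr; field; rewrite gt_eqF.
  have hd : Num.sqrt m%:R * (Fhat M w m false (s m) x + Fhat M w m true (s m) x - G (s m)) <= - (c * K).
    by rewrite -gs -mulrN ler_pM2l//; lra.
  apply: sum_norm_or; rewrite Wproc_sumE.
  move: h0 h1 hd; set v := _ * (Fm m false _ - _); set z := _ * (Fm m true _ - _); set u := _ * (_ - G _).
  exact: deviation_below.
have -> : B / (c * K / 4) ^+ 2 + B / (c * K / 4) ^+ 2 = 32 * B / (c ^+ 2) / K / K.
  by field; rewrite !gt_eqF.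
have KB' : 32 * B / c ^+ 2 / K <= e.
  rewrite ler_pdivrMr// ler_pdivrMr ?exprn_gt0//.
  rewrite (_ : e * K * c ^+ 2 = K * (c ^+ 2 * e)); last by ring.
  by rewrite -ler_pdivrMr// mulr_gt0// exprn_gt0.
apply: le_trans KB'; rewrite ler_pdivrMr// ler_peMr// divr_ge0 ?(ltW K0)//.
by rewrite divr_ge0 ?sqr_ge0// mulr_ge0// ltW.
Unshelve. all: by end_near. Qed.

(* An excursion of tauhat beyond tau + K / sqrt m forces, by monotonicity of Ghat, an
   excursion of the empirical process of order l at some grid point
   tau + (l + 1) / sqrt m with l >= K; the Chebyshev bounds sum to O(1 / K). *)
Lemma tauhat_right (e : R) : 0 < e -> exists K0 : nat, forall K, (K0 <= K)%N ->
  unlikely P e (fun m => [set x | K%:R < Num.sqrt m%:R * (tauhat M w q m x - tau)]).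
Proof.
move=> e0; have [q0 a0 at_ tb b1] := simes_interval_bounds.
have [_ /andP[qb _] _ _ _] := hab.
(* Since tauhat <= q, the grid point just beyond it is at most q + 1 / sqrt m, eventually below
   b'. *)
pose b' := (q + b) / 2.
have [bb qb'] : b' < b /\ q < b' by rewrite /b'; split; lra.
have [c c0 gap] := gap_right bb.
pose B := 2 * (1 + 8 * C).
have B0 : 0 < B by rewrite mulr_gt0//; have := C0; lra.
(* At grid index l the two Chebyshev bounds add up to (D / 2) / l ^ 2; over l > K they sum to at
   most D / (K + 1). *)
pose D := 64 * B / (c ^+ 2).
(* The term 4 / (c q) + 4 ensures 1 / q + c <= c l / 4 for all relevant l, as [deviation_above]
   requires. *)
have [K0 K0P] : exists n : nat, Num.max (D / e) (4 / (c * q) + 4) <= n%:R.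
  exact: filter_ex (nbhs_infty_ger _).
exists K0.+1 => -[//|K]; rewrite ltnS => KK.
move: K0P; rewrite ge_max => /andP[KD Kc].
have K1 : 0 < K.+1%:R :> R by rewrite ltr0n.
have KK' : K0%:R <= K.+1%:R :> R by rewrite ler_nat ltnW.
pose s m (l : nat) := tau + l.+1%:R / Num.sqrt m%:R.
have s0 m l : 0 <= s m l by rewrite addr_ge0// ?divr_ge0// ?sqrtr_ge0//; lra.
pose E m r l := [set x | c * l%:R / 4 <= `|Wp m r (s m l) x|].
have mE m r l : measurable (E m r l).
  by apply: measurable_ge_norm; apply: bmf_meas; exact: bmf_Wproc.
(* The reversed index m - i runs over l = K + 1, ..., m, the form of [sum_inv_squares]. Indices up
   to m suffice because sqrt m (tauhat - tau) <= m. *)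
pose A m (i : nat) := E m false (m - i)%N `|` E m true (m - i)%N.
near=> m; exists (\big[setU/set0]_(i < m - K) A m i); split.
- by apply: bigsetU_measurable => i _; exact: measurableU.
- have m0 : (0 < m)%N by near: m; exact: nbhs_infty_gt.
  apply: (le_trans (fineP_bigU _ _ _)); first by move=> i; exact: measurableU.
  apply: (@le_trans _ _ (\sum_(i < m - K) (D / 2) * ((m - i)%N%:R ^- 2))).
    apply: ler_sum => i _; apply: le_trans (fineP_setU P (mE _ _ _) (mE _ _ _)) _.
    have mi0 : (0 < m - i)%N by rewrite subn_gt0 (leq_trans (ltn_ord i))// leq_subr.
    have mi0' : 0 < (m - i)%N%:R :> R by rewrite ltr0n.
    have cl0 : 0 < c * (m - i)%N%:R / 4 by rewrite divr_gt0// mulr_gt0.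
    have := Wproc_chebyshev w false mixC m0 (s0 m (m - i)%N) cl0.
    have := Wproc_chebyshev w true mixC m0 (s0 m (m - i)%N) cl0.
    rewrite -/B => h1 h2; apply: le_trans (lerD h2 h1) _.
    suff -> : D / 2 * (m - i)%N%:R ^- 2 = B / (c * (m - i)%N%:R / 4) ^+ 2 + B / (c * (m - i)%N%:R / 4) ^+ 2 by [].
    by rewrite /D; move: (_%:R) mi0' {h1 h2 cl0} => u u0; field; rewrite !gt_eqF.
  rewrite -mulr_sumr.
  have D0 : 0 < D by rewrite divr_gt0 ?exprn_gt0// mulr_gt0.
  apply: (@le_trans _ _ (D / 2 * (2 / K.+1%:R))).
    apply: ler_wpM2l; first by rewrite divr_ge0// ltW.
    by have := @sum_inv_squares R m K.
  rewrite mulrA divfK// ler_pdivrMr// mulrC -ler_pdivrMr//; exact: le_trans KK'.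
- move=> x /= hx.
  have m0 : (0 < m)%N by near: m; exact: nbhs_infty_gt.
  have sm : 1 < Num.sqrt m%:R :> R by near: m; exact: near_sqrt_gt.
  have sm0 : 0 < Num.sqrt m%:R :> R by lra.
  pose y := Num.sqrt m%:R * (tauhat M w q m x - tau).
  have y0 : 0 <= y by apply: le_trans (ltW hx).
  pose l := Num.truncn y; have /andP[ly yl] := truncn_itv y0.
  have Kl : (K.+1 <= l)%N.
    by rewrite -ltnS -(ltr_nat R); exact: lt_trans hx yl.
  have tq := tauhat_le M w q0 x m0.
  have lm : (l <= m)%N.
    rewrite -(ler_nat R); apply: le_trans ly _; rewrite -[leRHS]sqr_sqrtr// expr2.
    rewrite /y ler_pM2l//; lra.
  have st : tauhat M w q m x <= s m l.
    by rewrite /s -lerBlDl ler_pdivlMr// mulrC ltW.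
  have stau : tau <= s m l by rewrite /s lerDl divr_ge0// ltW.
  have sb : s m l <= b'.
    have h1 : l%:R / Num.sqrt m%:R <= q - tau.
      by rewrite ler_pdivrMr// mulrC; apply: le_trans ly _; rewrite ler_pM2l// lerB.
    have h2 : (Num.sqrt m%:R)^-1 <= b' - q.
      rewrite -[leLHS]div1r ler_pdivrMr// mulrC -ler_pdivrMr ?subr_gt0// ltW//.
      by near: m; exact: near_sqrt_gt.
    by rewrite /s -natr1 mulrDl mul1r; lra.
  suff [r hr] : exists r, E m r l x.
    have lK : (m - l < m - K)%N by rewrite ltn_sub2l// (leq_trans Kl).
    apply: (bigsetU_sup lK); rewrite /A subKn//.
    by case: r hr; [right|left].
  have sab : a <= s m l <= b by apply/andP; split; lra.
  have hu : forall r t, a <= t <= b -> `|Num.sqrt m%:R * (Fm m r t - F r t)| <= 1 / 2 * c.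
    by near: m; apply: Fm_uniform; lra.
  have h0 := hu false _ sab; have h1 := hu true _ sab.
  have hg := gap _ stau sb.
  have G1 := Ghat_tauhat M w q0 x m0.
  have F1 := Fhat_mono M w m false x st; have F2 := Fhat_mono M w m true x st.
  have gs : Num.sqrt m%:R * (c * (s m l - tau)) = c * l.+1%:R.
    by rewrite /s addrC addKr; field; rewrite gt_eqF.
  have tl : tauhat M w q m x / q >= (tau + l%:R / Num.sqrt m%:R) / q.
    rewrite ler_pM2r ?invr_gt0// -lerBrDl ler_pdivrMr// mulrC; exact: ly.
  have tl' : Num.sqrt m%:R * (s m l / q - (tau + l%:R / Num.sqrt m%:R) / q) = q^-1.
    by rewrite /s -natr1; field; rewrite !gt_eqF.
  (* Monotonicity gives Ghat(s) >= Ghat(tauhat) = tauhat / q, and tauhat is at least s minus one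
     mesh 1 / sqrt m; hence the loss 1 / q after scaling. *)
  have hd : c * l.+1%:R - q^-1 <= Num.sqrt m%:R * (Fhat M w m false (s m l) x + Fhat M w m true (s m l) x - G (s m l)).
    rewrite -gs -tl' -mulrBr ler_pM2l//; exact: excursion_lower hg G1 F1 F2 tl.
  have lc : q^-1 + c <= c * l%:R / 4.
    have h4 : 4 / (c * q) + 4 <= l%:R.
      refine (le_trans Kc _); rewrite ler_nat; exact: leq_trans (KK) (ltnW Kl).
    have -> : q^-1 + c = c * (4 / (c * q) + 4) / 4 by field; rewrite !gt_eqF.
    by rewrite ler_pM2r// ler_pM2l.
  have qi0 : 0 < q^-1 by rewrite invr_gt0.
  suff : c * l%:R / 4 <= `|Wp m false (s m l) x| \/ c * l%:R / 4 <= `|Wp m true (s m l) x|.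
    by case; [exists false|exists true].
  apply: sum_norm_or; rewrite Wproc_sumE.
  move: hd; rewrite -[l.+1%:R]natr1 [c * (_ + 1)]mulrDr mulr1; move: h0 h1; set v := _ * (Fm m false _ - _); set z := _ * (Fm m true _ - _); set u := _ * (_ - G _).
  exact: (deviation_above qi0 lc).
Unshelve. all: by end_near. Qed.

Lemma tauhat_localised (e : R) : 0 < e -> exists2 K : nat, (0 < K)%N &
  unlikely P e (fun m => [set x | K%:R < `|Num.sqrt m%:R * (tauhat M w q m x - tau)|]).
Proof.
move=> e0; have e2 : 0 < e / 2 by rewrite divr_gt0.
have [K1 K10 h1] := tauhat_left e2; have [K2 h2] := tauhat_right e2.
have [n nK] : exists n : nat, K1 <= n%:R by exact: filter_ex (nbhs_infty_ger _).
exists (maxn n.+1 K2); first by rewrite leq_max.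
rewrite [e]splitr; apply: unlikelyS (unlikelyU (h1 (maxn n.+1 K2)%:R _) (h2 _ (leq_maxr n.+1 K2))).
  by near=> m => x /=; rewrite ltr_normr => /orP[?|?]; [right|left; rewrite /= ltrNr].
by apply: le_trans nK _; rewrite ler_nat leq_max leqnSn.
Unshelve. all: by end_near. Qed.

(** At distance v / sqrt m the increment of [Fm] is O(1 / sqrt m), eventually below zeta ^ 2; the
    increment bound with parameter [zeta] then gives variance at most 2 B zeta. *)
Lemma Wproc_close (v eta e : R) r : 0 < eta -> 0 < e ->
  unlikely P e (fun m => [set x |
    eta <= `|Wp m r (tau + v / Num.sqrt m%:R) x - Wp m r tau x|]).
Proof.
move=> eta0 e0; have [q0 a0 at_ tb b1] := simes_interval_bounds.
pose B := 1 + 8 * C.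
have B0 : 0 < B by rewrite /B; have := C0; lra.
(* Makes 2 B zeta equal to e eta ^ 2, the value Chebyshev requires. *)
pose zeta := e * eta ^+ 2 / (2 * B).
have z0 : 0 < zeta by rewrite divr_gt0 ?mulr_gt0// exprn_gt0.
pose D := `|f r| * `|v| + 2.
have v0 : 0 <= `|v| := normr_ge0 v.
near=> m; exists [set x | eta <= `|Wp m r (tau + v / Num.sqrt m%:R) x - Wp m r tau x|].
have sm0 : 0 < Num.sqrt m%:R :> R by near: m; exact: near_sqrt_gt.
have m0 : (0 < m)%N by near: m; exact: nbhs_infty_gt.
have bW t : bmf (Wp m r t) by exact: bmf_Wproc.
split => //.
  by apply: measurable_ge_norm; apply: bmf_meas; exact: bmfB.
apply: le_trans (chebyshev2 P (bmfB (bW _) (bW _)) eta0) _.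
rewrite ler_pdivrMr ?exprn_gt0//.
have hE (t : R) : `|Num.sqrt m%:R * (t - tau)| <= `|v| ->
    `|Num.sqrt m%:R * (Fm m r t - F r tau) - f r * (Num.sqrt m%:R * (t - tau))| <= 1.
  have h : forall r t, `|Num.sqrt m%:R * (t - tau)| <= `|v| ->
    [/\ a <= t <= b, tau / 2 <= t & `|Num.sqrt m%:R * (Fm m r t - F r tau) -
       f r * (Num.sqrt m%:R * (t - tau))| <= 1] by near: m; exact: Fm_expansion.
  by move=> /(h r)[].
have tv : Num.sqrt m%:R * (tau + v / Num.sqrt m%:R - tau) = v.
  by rewrite addrC addKr mulrC divfK// gt_eqF.
have := hE (tau + v / Num.sqrt m%:R); rewrite tv => /(_ (lexx _)) h1.
have := hE tau; rewrite subrr !mulr0 normr0 subr0 => /(_ v0) h2.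
have dF : `|Fm m r (tau + v / Num.sqrt m%:R) - Fm m r tau| <= zeta ^+ 2.
  apply: (@le_trans _ _ (D / Num.sqrt m%:R)).
    rewrite ler_pdivlMr// mulrC -{1}(gtr0_norm sm0) -normrM.
    rewrite (_ : _ * (_ - _) = Num.sqrt m%:R * (Fm m r (tau + v / Num.sqrt m%:R) - F r tau) - f r * v -
      Num.sqrt m%:R * (Fm m r tau - F r tau) + f r * v); last by ring.
    apply: le_trans (ler_normD _ _) _; rewrite /D normrM addrC lerD2l.
    by apply: le_trans (ler_normB _ _) _; lra.
  rewrite ler_pdivrMr// mulrC -ler_pdivrMr ?exprn_gt0// ltW//.
  by near: m; exact: near_sqrt_gt.
have incr : Ex P (fun x => (Wp m r (tau + v / Num.sqrt m%:R) x - Wp m r tau x) ^+ 2) <=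
    B * (`|Fm m r (tau + v / Num.sqrt m%:R) - Fm m r tau| / zeta + zeta).
  have [vp|vn] := leP 0 v.
    have tt : tau <= tau + v / Num.sqrt m%:R by rewrite lerDl divr_ge0// ltW.
    by rewrite ger0_norm ?subr_ge0 ?Fm_mono//; exact: Wproc_increment.
  have tt : tau + v / Num.sqrt m%:R <= tau by rewrite gerDl mulr_le0_ge0// ?invr_ge0 ltW.
  rewrite distrC ger0_norm ?subr_ge0 ?Fm_mono//.
  rewrite (@eq_Ex _ _ _ P _ (fun x => (Wp m r tau x - Wp m r (tau + v / Num.sqrt m%:R) x) ^+ 2)).
    exact: Wproc_increment.
  by move=> x; rewrite -sqrrN opprB.
apply: le_trans incr _.
have : `|Fm m r (tau + v / Num.sqrt m%:R) - Fm m r tau| / zeta <= zeta.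
  by rewrite ler_pdivrMr// -expr2.
have -> : e * eta ^+ 2 = B * (zeta + zeta) by rewrite /zeta; field; rewrite gt_eqF.
by rewrite ler_pM2l//; lra.
Unshelve. all: by end_near. Qed.

(** On the scale 1 / sqrt m the window is [-K, K], so a fixed mesh has a number of points
    independent of m and [Wproc_close] applies to all of them at once; [oscillation_bound]
    interpolates. *)
Lemma Wproc_oscillation (K : nat) (eta e : R) r : 0 < eta -> 0 < e ->
  unlikely P e (fun m => [set x | exists2 t, `|Num.sqrt m%:R * (t - tau)| <= K%:R &
    eta < `|Wp m r t x - Wp m r tau x|]).
Proof.
move=> eta0 e0; have [q0 a0 at_ tb b1] := simes_interval_bounds.
have eta4 : 0 < eta / 4 by rewrite divr_gt0.
have eta16 : 0 < eta / 16 by rewrite divr_gt0.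
have D0 : 0 <= `|f r| := normr_ge0 _.
have [n nD] : exists n : nat, `|f r| / (eta / 4) <= n%:R by exact: filter_ex (nbhs_infty_ger _).
have nn : n%:R <= n.+1%:R :> R by rewrite ler_nat.
have n0 : 0 < n.+1%:R :> R by rewrite ltr0n.
have Dn : `|f r| / n.+1%:R <= eta / 4.
  by rewrite ler_pdivrMr// mulrC -ler_pdivrMr//; exact: le_trans nn.
pose v (l : nat) : R := l%:R / n.+1%:R - K%:R.
(* One grid point beyond the right end K, so that every t in the window has a right neighbour; this
   is why expansions are taken up to K + 1. *)
pose N := (2 * K * n.+1).+2.
apply: unlikelyS (unlikely_bigU N (fun l e => @Wproc_close (v l) (eta / 4) e r eta4) e0).
have K1 : 0 <= K%:R + 1 :> R by rewrite addr_ge0.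
have hexp := Fm_expansion K1 eta16.
near=> m => x /= [t tK]; rewrite ltNge => /negP tbad; apply: contrapT => hgrid.
have {}hgrid l : (l < N)%N -> `|Wp m r (tau + v l / Num.sqrt m%:R) x - Wp m r tau x| < eta / 4.
  by move=> lN; rewrite ltNge; apply/negP => h; apply: hgrid; exists l.
apply: tbad.
have sm : 0 < Num.sqrt m%:R :> R by near: m; exact: near_sqrt_gt.
have hE : forall r t, `|Num.sqrt m%:R * (t - tau)| <= K%:R + 1 ->
    [/\ a <= t <= b, tau / 2 <= t & `|Num.sqrt m%:R * (Fm m r t - F r tau) -
       f r * (Num.sqrt m%:R * (t - tau))| <= eta / 16] by near: m.
have gridE l : Num.sqrt m%:R * (tau + v l / Num.sqrt m%:R - tau) = v l.
  by rewrite [tau + _]addrC addrK mulrC divfK// gt_eqF.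
pose y := Num.sqrt m%:R * (t - tau) + K%:R.
have /andP[ty1 ty2] : - K%:R <= Num.sqrt m%:R * (t - tau) <= K%:R by rewrite -ler_norml.
have y0 : 0 <= n.+1%:R * y by rewrite mulr_ge0// /y; lra.
pose l := Num.truncn (n.+1%:R * y); have /andP[ly yl] := truncn_itv y0.
have lN : (l.+1 < N)%N.
  rewrite ltnS /N ltnS -(ler_nat R); apply: le_trans ly _.
  by rewrite mulrC natrM ler_pM2r// natrM /y; lra.
have vl : v l <= Num.sqrt m%:R * (t - tau).
  by rewrite /v lerBlDr -/y ler_pdivrMr// mulrC.
have vl1 : Num.sqrt m%:R * (t - tau) <= v l.+1.
  by rewrite /v lerBrDr -/y ler_pdivlMr// mulrC ltW.
have vd : v l.+1 = v l + n.+1%:R^-1 by rewrite /v -[l.+1%:R]natr1; ring.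
have ninv : n.+1%:R^-1 <= 1 :> R by rewrite invf_le1// ler1n.
have ninv0 : 0 < n.+1%:R^-1 :> R by rewrite invr_gt0.
have tl : tau + v l / Num.sqrt m%:R <= t.
  by rewrite -lerBrDl ler_pdivrMr// mulrC.
have tl1 : t <= tau + v l.+1 / Num.sqrt m%:R.
  by rewrite -lerBlDl ler_pdivlMr// mulrC.
have [vK vK1] : `|v l| <= K%:R + 1 /\ `|v l.+1| <= K%:R + 1.
  exact: (grid_cell_bounds vl vl1 vd ninv ninv0 ty1 ty2).
have [_ _ E1] := hE r (tau + v l / Num.sqrt m%:R) (eq_ind_r (fun z => `|z| <= _) vK (gridE l)).
have [_ _ E2] := hE r (tau + v l.+1 / Num.sqrt m%:R) (eq_ind_r (fun z => `|z| <= _) vK1 (gridE l.+1)).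
have g1 := hgrid _ (ltnW lN); have g2 := hgrid _ lN.
have Fh1 := Fhat_mono M w m r x tl; have Fh2 := Fhat_mono M w m r x tl1.
have Fm1 := Fm_mono M w m r tl; have Fm2 := Fm_mono M w m r tl1.
rewrite !gridE in E1 E2.
have slope : f r * v l.+1 - f r * v l <= eta / 4.
  apply: le_trans Dn; rewrite -mulrBr vd addrC addKr ler_pM2r//; exact: ler_norm.
move: g1 g2 E1 E2 Fh1 Fh2 Fm1 Fm2 slope.
set t1 := tau + v l / _; set t2 := tau + v l.+1 / _.
rewrite -[Fhat M w m r t1 x <= _](ler_pM2l sm) -[Fhat M w m r t x <= _](ler_pM2l sm).
rewrite -[Fm m r t1 <= _](ler_pM2l sm) -[Fm m r t <= _](ler_pM2l sm).
move: (f r * v l) (f r * v l.+1) => p1 p2; rewrite /Wproc !mulrBr.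
exact: oscillation_bound.
Unshelve. all: by end_near. Qed.

Local Notation al := (alpha_const M w q).

(** Off five events of probability at most e / 5 (localisation, size of the two processes at [tau],
    their two oscillations), the algebraic identity [FDP_expansion] holds with small remainders. *)
Lemma FDP_linearised (eta e : R) : 0 < eta -> 0 < e ->
  unlikely P e (fun m => [set x | eta < `|Num.sqrt m%:R * (FDP M w q m x - q * F false tau / tau) -
    (q / tau * (1 + al) * Wp m false tau x + q / tau * al * Wp m true tau x)|]).
Proof.
move=> eta0 e0; have [q0 a0 at_ tb b1] := simes_interval_bounds.
have q1 : q < 1 by case/andP: q01.
have t0 : 0 < tau by lra.
have al0 : 0 <= `|al| := normr_ge0 _.
pose L := 1 + 2 * `|al|; have L0 : 0 < L by rewrite /L; lra.
(* Oscillation and expansion each contribute [e1] to the remainders, and 4 L (2 e1) = eta tau is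
   what [FDP_remainder_bound] allows. *)
pose e1 := eta * tau / (8 * L).
have e10 : 0 < e1 by rewrite divr_gt0// mulr_gt0.
have e5 : 0 < e / 5 by rewrite divr_gt0.
pose B := 2 * (1 + 8 * C).
have B0 : 0 < B by rewrite /B; have := C0; lra.
pose A := 1 + B / (e / 5).
have A0 : 0 < B / (e / 5) by rewrite divr_gt0.
have [K K0 hK] := tauhat_localised e5.
have tA : B / A ^+ 2 <= e / 5.
  have A1 : 0 < A by rewrite /A; lra.
  rewrite ler_pdivrMr ?exprn_gt0// mulrC -ler_pdivrMr// expr2.
  apply: (@le_trans _ _ A); first by rewrite /A; lra.
  by rewrite ler_peMr ?(ltW A1)// /A; lra.
have A1 : 0 < A by rewrite /A; lra.
have t0' : \forall m \near \oo, (fun _ : nat => 0 <= tau) m by apply: nearW => _; exact: ltW.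
have WA r := unlikelyW tA (unlikely_Wproc r A1 t0').
have osc r := Wproc_oscillation K r e10 e5.
apply: (@unlikelyW _ _ _ P (e / 5 + (e / 5 + e / 5 + (e / 5 + e / 5)))); first by lra.
apply: unlikelyS (unlikelyU hK (unlikelyU (unlikelyU (WA false) (WA true))
  (unlikelyU (osc false) (osc true)))).
have hexp := Fm_expansion (ler0n R K) e10.
near=> m => x /= hbad; apply: contrapT => hgood; move: hbad; rewrite ltNge => /negP; apply.
have sm : 0 < Num.sqrt m%:R :> R by near: m; exact: near_sqrt_gt.
have m0 : (0 < m)%N by near: m; exact: nbhs_infty_gt.
have sm' : 4 * L * A * K%:R / (eta * tau ^+ 2) < Num.sqrt m%:R.
  by near: m; exact: near_sqrt_gt.
have hE : forall r t, `|Num.sqrt m%:R * (t - tau)| <= K%:R ->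
    [/\ a <= t <= b, tau / 2 <= t & `|Num.sqrt m%:R * (Fm m r t - F r tau) -
       f r * (Num.sqrt m%:R * (t - tau))| <= e1] by near: m.
have hloc : `|Num.sqrt m%:R * (tauhat M w q m x - tau)| <= K%:R.
  by rewrite leNgt; apply/negP => h; apply: hgood; left.
have hW r : `|Wp m r tau x| <= A.
  by rewrite leNgt; apply/negP => /ltW h; apply: hgood; right; left; case: r h; [right|left].
have hosc r : `|Wp m r (tauhat M w q m x) x - Wp m r tau x| <= e1.
  rewrite leNgt; apply/negP => h; apply: hgood; right; right.
  by case: r h => h; [right|left]; exists (tauhat M w q m x).
set th := tauhat M w q m x in hloc hosc *.
have [_ tth _] := hE true _ hloc.
have th0 : 0 < th by apply: lt_le_trans tth; rewrite divr_gt0.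
pose h := Num.sqrt m%:R * (th - tau).
pose X r := Num.sqrt m%:R * (Fhat M w m r th x - F r tau).
pose dd r := X r - Wp m r tau x - f r * h.
have hd r : `|dd r| <= 2 * e1.
  have [_ _ h1] := hE r _ hloc.
  have -> : dd r = (Wp m r th x - Wp m r tau x) +
     (Num.sqrt m%:R * (Fm m r th - F r tau) - f r * h) by rewrite /dd /X /Wproc; ring.
  rewrite (_ : 2 * e1 = e1 + e1); last by ring.
  exact: le_trans (ler_normD _ _) (lerD (hosc r) h1).
have -> : Num.sqrt m%:R * (FDP M w q m x - q * F false tau / tau) =
    q / th * (X false - F false tau / tau * h).
  rewrite FDP_tauhat// -/th /X /h; field; by rewrite !gt_eqF.
rewrite (@FDP_expansion _ q (Num.sqrt m%:R) th tau (X false) (X true) h (Wp m false tau x)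
   (Wp m true tau x) (f false) (f true) (F false tau) (F true tau) (dd false) (dd true) al)//.
- apply: (FDP_remainder_bound q0 q1 t0 tth sm eta0 (hd false) (hd true) (hW false) (hW true) hloc).
    rewrite -/L (_ : 4 * L * (2 * e1) = e1 * (8 * L)); last by ring.
    by rewrite /e1 divfK// gt_eqF// mulr_gt0.
  rewrite -/L [leRHS]mulrC -ler_pdivrMr ?mulr_gt0 ?exprn_gt0//; exact: ltW.
- by have := halpha; rewrite derive1_G.
- by rewrite /dd; ring.
- by rewrite /dd; ring.
- rewrite /X -mulrDr addrACA -opprD.
  have -> : Fhat M w m false th x + Fhat M w m true th x = th / q by exact: Ghat_tauhat.
  have -> : F false tau + F true tau = tau / q by have := G_tau.
  by rewrite -mulrBl mulrA.
- by rewrite /alpha_const derive1_G.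
Unshelve. all: by end_near. Qed.
End simes_point_analysis.

(** * From the linear approximation to convergence in distribution *)

Section weak_limit.
Context {d : measure_display} {T : measurableType d} {R : realType}.
Variable P : probability T R.

Lemma centered_normal_probability (v : R) :
  exists Q : probability (measurableTypeR R) R, forall A, Q A = centered_normal v A.
Proof.
rewrite /centered_normal; case: ifP => _.
  by exists (\d_(0 : measurableTypeR R)).
by exists (normal_prob 0 (Num.sqrt v)).
Qed.

(** A form of Slutsky's theorem. Tightness of [Z] comes from its convergent second moments; shifts
    by r absorb first X - Z and then the margin of [cvg_cos_cdf], and continuity of the limit at x
    removes both. *)
Lemma cvg_in_distribution_normal (v : R) (X Z : nat -> T -> R) :
  (forall n, bmf (Z n)) -> Ex P (fun x => Z n x ^+ 2) @[n --> \oo] --> v ->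
  (forall t c, Ex P (fun x => cos (t * Z n x + c)) @[n --> \oo] -->
     expR (- (v * t ^+ 2 / 2)) * cos c) ->
  (\forall n \near \oo, measurable_fun setT (X n)) ->
  (forall eta e, 0 < eta -> 0 < e ->
     unlikely P e (fun n => [set x | eta < `|X n x - Z n x|])) ->
  cvg_in_distribution P X (centered_normal v).
Proof.
move=> bZ Zv Zcos mX XZ.
have mZ n : measurable_fun setT (Z n) by apply: bmf_meas.
have v0 : 0 <= v.
  rewrite -(cvg_lim _ Zv)//; apply: limr_ge; first by apply/cvg_ex; eexists; exact: Zv.
  by near=> m; apply: Ex_ge0 => x; exact: sqr_ge0.
have [Q QE] := centered_normal_probability v.
have mid : measurable_fun setT (fun z : measurableTypeR R => z : R) by exact: measurable_id.
have tight (e : R) : 0 < e -> exists A : R,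
    \forall n \near \oo, fine (P [set z | A <= `|Z n z|]) <= e.
  move=> e0; pose A := 1 + (v + 1) / e; exists A.
  have A0 : 0 < (v + 1) / e by rewrite divr_gt0//; lra.
  have A1 : 1 <= A by rewrite /A; lra.
  have Zb : \forall n \near \oo, Ex P (fun x => Z n x ^+ 2) <= v + 1.
    by apply: (cvgr_le v) => //; lra.
  apply: filterS Zb => n Zn.
  have Apos : 0 < A by lra.
  apply: le_trans (chebyshev2 P (bZ n) Apos) _.
  rewrite ler_pdivrMr ?exprn_gt0//; apply: le_trans Zn _.
  rewrite mulrC -ler_pdivrMr// expr2; apply: (@le_trans _ _ A); first by rewrite /A; lra.
  by rewrite ler_peMr// ltW.
have Qcos t c : Ex Q (fun z => cos (t * z + c)) = expR (- (v * t ^+ 2 / 2)) * cos c.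
  by apply: Ex_cos_law => // A mA; rewrite QE.
have hcdf := @cvg_cos_cdf _ _ _ P _ _ Q Z (fun z => z) mZ mid _ tight.
have {}hcdf : forall x e dl : R, 0 < e -> 0 < dl ->
    \forall n \near \oo,
    fine (P [set z | Z n z <= x]) <= fine (centered_normal v `]-oo, x + dl]%classic) + e /\
    fine (centered_normal v `]-oo, x - dl]%classic) - e <= fine (P [set z | Z n z <= x]).
  move=> x e dl e0 dl0; rewrite -!QE !set_itvNyc; apply: hcdf => // t c.
  rewrite Qcos; exact: Zcos.
move=> x xcont; apply/cvgrPdist_le => e e0.
have e4 : 0 < e / 4 by rewrite divr_gt0.
move/cvgrPdist_le : xcont => /(_ _ e4)/nbhs_ballP[dl /= dl0 hd].
pose r := dl / 4.
have r0 : 0 < r by rewrite divr_gt0.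
pose Phi y := fine (centered_normal v `]-oo, y]%classic).
have hd' y : `|x - y| <= 2 * r -> `|Phi x - Phi y| <= e / 4.
  by move=> xy; apply: hd; rewrite /ball/=; move: xy; rewrite /r; lra.
have hp : `|Phi x - Phi (x + r + r)| <= e / 4.
  by apply: hd'; rewrite ler_norml; apply/andP; split; lra.
have hm : `|Phi x - Phi (x - r - r)| <= e / 4.
  by apply: hd'; rewrite ler_norml; apply/andP; split; lra.
have cp := hcdf (x + r) _ _ e4 r0; have cm := hcdf (x - r) _ _ e4 r0.
have ux := XZ r _ r0 e4.
near=> n.
have mXn : measurable_fun setT (X n) by near: n.
have [p1 _] : fine (P [set z | Z n z <= x + r]) <= Phi (x + r + r) + e / 4 /\
   Phi (x + r - r) - e / 4 <= fine (P [set z | Z n z <= x + r]) by near: n.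
have [_ p2] : fine (P [set z | Z n z <= x - r]) <= Phi (x - r + r) + e / 4 /\
   Phi (x - r - r) - e / 4 <= fine (P [set z | Z n z <= x - r]) by near: n.
have [B [mB PB XB]] : exists B, [/\ measurable B, fine (P B) <= e / 4 &
    [set x | r < `|X n x - Z n x|] `<=` B] by near: n.
have mle (g : T -> R) y : measurable_fun setT g -> measurable [set z | g z <= y].
  by move=> mg; exact: measurable_le_cst.
have u1 : fine (P [set z | X n z <= x]) <= fine (P [set z | Z n z <= x + r]) + fine (P B).
  apply: le_trans (fineP_setU P (mle _ _ (mZ n)) mB); apply: fineP_le.
  - exact: mle.
  - by apply: measurableU => //; exact: mle.
  - move=> z /= Xz; have [h|h] := leP (Z n z) (x + r); [by left|right].
    by apply: XB; rewrite /= ltr_normr; apply/orP; right; lra.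
have u2 : fine (P [set z | Z n z <= x - r]) <= fine (P [set z | X n z <= x]) + fine (P B).
  apply: le_trans (fineP_setU P (mle _ _ mXn) mB); apply: fineP_le.
  - exact: mle.
  - by apply: measurableU => //; exact: mle.
  - move=> z /= Zz; have [h|h] := leP (X n z) x; [by left|right].
    by apply: XB; rewrite /= ltr_normr; apply/orP; left; lra.
move: hp hm; rewrite -/(Phi x) !ler_norml => /andP[? ?] /andP[? ?].
apply/andP; split; lra.
Unshelve. all: by end_near. Qed.

End weak_limit.

Theorem theorem3p1 (R : realType) (d : measure_display) (T : measurableType d)
    (P : probability T R) (k : nat) (M : factor_model P k) (q : R)
    (q01 : 0 < q < 1) (w : 'rV[R]_k) (a b : R)
    (hab : is_simes_interval M w q a b)
    (h1 : sup [set x : R | exists (m : nat) (i : 'I_m), x = sqnorm2 (L M i)] < 1)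
    (h2 : exists (Q : nat) (g : R),
      [/\ ~~ odd Q, (2 < Q)%N, 0 < g, g / (2 + g) + 2 / Q%:R < 1
        & (\sum_(1 <= e <oo) (e%:R ^+ (Q - 2) *
             mixing_coef M e `^ (g / (Q%:R + g)))%:E < +oo)%E])
    (h3 : forall (t : R) (r : bool), 0 <= t <= 1 ->
      cvgn (fun m => Fm M w m r t))
    (h4 : [/\ 0 < simes_point M w q,
      simes_point M w q = sup [set t : R | 0 < t < 1 /\ t / q < G M w t]
      & ~ limit_point [set t : R | 0 < t < 1 /\ G M w t = t / q]
            (simes_point M w q)])
    (h5 : forall (s t : R) (r0 r1 : bool), a <= s <= b -> a <= t <= b ->
      cvgn (fun m => pi_ M m r0 * pi_ M m r1 / m%:R *
        \sum_(i < m) gamma_ M w i r0 t * gamma_ M w i r1 s) /\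
      cvgn (fun m => pi_ M m r0 * pi_ M m r1 / m%:R *
        \sum_(i < m) \sum_(j < m | j != i)
          rho_tilde (gamma_ M w i r0 t) (gamma_ M w j r1 s) (noise_corr M i j)))
    (h6 : forall r : bool, derivable (F M w r) (simes_point M w q) 1)
    (* the denominator of the constant alpha_const does not vanish *)
    (halpha : q^-1 - derive1 (G M w) (simes_point M w q) != 0)
    (h7 : forall r : bool,
      sup [set `|Num.sqrt m%:R * (Fm M w m r t - F M w r t)| |
             t in [set t : R | a <= t <= b]] @[m --> \oo] --> (0 : R)) :
  cvg_in_distribution P
    (fun m omega => Num.sqrt m%:R * (FDP M w q m omega -
       q * F M w false (simes_point M w q) / simes_point M w q))
    (centered_normal (sigmaL2 M w q)).
Proof.
have [Q [g [Qeven Q2 g0 gQ Qsum]]] := h2.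
have [C mixC] := poly_mixingP Qeven Q2 g0 gQ Qsum.
have [q0 a0 at_ tb b1] := simes_interval_bounds q01 hab.
set tau := simes_point M w q in at_ tb h6 halpha *.
have t01 : 0 < tau < 1 by apply/andP; split; lra.
have tab : a <= tau <= b by rewrite !ltW.
have ct : cov_terms_cvg M w tau.
  move=> r0 r1; have [c1 c2] := @h5 tau tau r0 r1 tab tab; split => //.
  by apply: h3; rewrite !ltW//; lra.
pose al := alpha_const M w q.
pose Z m x := q / tau * (1 + al) * Wproc M w m false tau x + q / tau * al * Wproc M w m true tau x.
(* The factor q ^ 2 / tau ^ 2 is absorbed into the two coefficients of the linear approximation. *)
have -> : sigmaL2 M w q = quad_var M w (q / tau * (1 + al)) (q / tau * al) tau.
  rewrite /sigmaL2 -/tau -/al /quad_var; field.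
  by case/andP: t01 => ? _; rewrite gt_eqF.
apply: (@cvg_in_distribution_normal _ _ _ _ _ _ Z).
- by move=> m; apply: bmfD; apply: bmfZ; exact: bmf_Wproc.
- exact: Wproc_lin_var.
- exact: Wproc_clt mixC t01 ct.
- near=> m; apply: measurable_funM => //; apply: measurable_funB => //.
  apply: measurable_FDP => //; near: m; exact: nbhs_infty_gt.
- by move=> eta e eta0 e0; exact: (FDP_linearised q01 hab h3 h6 halpha h7 mixC eta0 e0).
Unshelve. all: by end_near. Qed.
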